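(* Let $m\in\mathbb{Z}_{>0}$ and $a\in\{0,1,\dots,m-1\}$. Define \[ X_m^{(a)}(q)=\sum_{k_1,\dots,k_m=0}^\infty (q)_{k_m}\,q^{k_1^2+\cdots+k_{m-1}^2+k_{a+1}+\cdots+k_{m-1}}\Big(\prod_{\substack{i=1\\ i\ne a}}^{m-1}\begin{bmatrix} k_{i+1}\\ k_i\end{bmatrix}\Big)\begin{bmatrix} k_{a+1}+1\\ k_a\end{bmatrix}, \] where for $a=0$ the factor $\begin{bmatrix} k_{a+1}+1\\ k_a\end{bmatrix}$ is taken to be $1$ (i.e. $k_0=0$). Then, as formal power series in $t$, \[ X_m^{(a)}(e^{-t})=e^{\frac{(2m-2a-1)^2}{8(2m+1)}t}\sum_{n=0}^\infty\frac{T_m^{(a)}(n)}{n!}\Big(\frac{t}{8(2m+1)}\Big)^n, \] where \[ T_m^{(a)}(n)=\tfrac12(-1)^{n+1}L(-2n-1,\chi_{8m+4}^{(a)})=(-1)^n2^{4n}\frac{(2m+1)^{2n+1}}{n+1}\sum_{r=1}^{8m+4}\chi_{8m+4}^{(a)}(r)\,B_{2n+2}\Big(\frac{r}{8m+4}\Big), \] with $B_k(x)$ the Bernoulli polynomials.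
   Context: Notation: $(x)_n=(x;q)_n=\prod_{i=1}^n(1-xq^{i-1})$, and $\begin{bmatrix} n\\ c\end{bmatrix}=\frac{(q)_n}{(q)_c(q)_{n-c}}$ for $0\le c\le n$ and $0$ otherwise. The series $X_m^{(a)}$ need not converge; after substituting $q=e^{-t}$ the terms with given $k_m$ are finitely many and are $O(t^{k_m})$, so $X_m^{(a)}(e^{-t})$ is a well-defined formal power series in $t$. The periodic function $\chi_{8m+4}^{(a)}$ (period $8m+4$) takes the value $1$ at $n\equiv 2m-2a-1$, $-1$ at $n\equiv 2m+2a+3$, $-1$ at $n\equiv 6m-2a+1$, $1$ at $n\equiv 6m+2a+5 \pmod{8m+4}$, and $0$ otherwise. For a periodic $\chi$ with mean zero, $L(s,\chi)=\sum_{n\ge1}\chi(n)n^{-s}$ for $\operatorname{Re}s>1$, analytically continued to an entire function. *)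

(* Defs.v *)
From HB Require Import structures.
From mathcomp Require Import all_boot all_order all_algebra.
From mathcomp Require Import complex.
From mathcomp Require Import all_classical all_reals all_analysis.

Set Implicit Arguments.
Unset Strict Implicit.
Unset Printing Implicit Defensive.

Import Order.TTheory GRing.Theory Num.Theory.
Import numFieldNormedType.Exports.

Local Open Scope classical_set_scope.
Local Open Scope ring_scope.
Local Open Scope complex_scope.

(* A formal power series in t over K is its sequence of coefficients. *)
Section FormalPowerSeries.
Variable K : fieldType.

Definition fps := nat -> K.

Definition fps1 : fps := fun n => (n == 0%N)%:R.

Definition fps_mul (f g : fps) : fps :=
  fun n => \sum_(i < n.+1) f i * g (n - i)%N.

Definition fps_pow (f : fps) (j : nat) : fps := iter j (fps_mul f) fps1.

(* e^{ct} *)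
Definition fps_expX (c : K) : fps := fun n => c ^+ n / n`!%:R.

(* p(f), i.e. the result of substituting q = f in the polynomial p(q) *)
Definition fps_subst (p : {poly K}) (f : fps) : fps :=
  fun n => \sum_(j < size p) p`_j * fps_pow f j n.

End FormalPowerSeries.

(* The indeterminate 'X of {poly K} plays the role of q. *)
Section QSeries.
Variable K : fieldType.

Definition qpoch (x : {poly K}) (n : nat) : {poly K} :=
  \prod_(1 <= i < n.+1) (1 - x * 'X^(i.-1)).

(* The division is exact: Gaussian binomials are polynomials in q. *)
Definition qbinom (n c : nat) : {poly K} :=
  if (c <= n)%N then qpoch 'X n %/ (qpoch 'X c * qpoch 'X (n - c)) else 0.

(* k_i for 0 <= i <= m, where k = (k_1, ..., k_m) and k_0 = 0 *)
Definition kidx (m : nat) (k : m.-tuple nat) (i : nat) : nat :=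
  nth 0%N (0%N :: k) i.

(* For a = 0 the last factor is [k_1 + 1; 0] = 1. *)
Definition Xterm (m a : nat) (k : m.-tuple nat) : {poly K} :=
  qpoch 'X (kidx k m)
  * 'X^(\sum_(1 <= i < m) kidx k i ^ 2 + \sum_(a.+1 <= i < m) kidx k i)
  * (\prod_(1 <= i < m | i != a) qbinom (kidx k i.+1) (kidx k i))
  * qbinom (kidx k a.+1).+1 (kidx k a).

(* X_m^{(a)}(e^{-t}).  For each n only finitely many tuples k contribute to
   the coefficient of t^n: the term of index k is O(t^{k_m}), and it vanishes
   unless k_i <= k_{i+1} + 1 for all i.  The sum over all k is the finitely
   supported sum of fsbigop. *)
Definition X_exp_opp (m a : nat) : fps K :=
  fun n => \sum_(k \in [set: m.-tuple nat])
             fps_subst (Xterm a k) (fps_expX (- 1)) n.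

End QSeries.

Section Bernoulli.
Variable K : fieldType.

(* [:: B_0; ...; B_(n-1)], from \sum_(k <= n) 'C(n+1, k) B_k = (n == 0) *)
Fixpoint bernoulli_seq (n : nat) : seq K :=
  if n is n'.+1 then
    let s := bernoulli_seq n' in
    rcons s ((n' == 0%N)%:R
             - (n'.+1)%:R^-1 * \sum_(k < n') 'C(n'.+1, k)%:R * s`_k)
  else [::].

Definition bernoulli (n : nat) : K := (bernoulli_seq n.+1)`_n.

Definition bernoulli_poly (n : nat) : {poly K} :=
  \sum_(k < n.+1) ('C(n, k)%:R * bernoulli k) *: 'X^(n - k).

End Bernoulli.

(* The four residues are pairwise distinct, and the natural-number
   subtractions are not truncated, when a < m. *)
Definition chi (K : fieldType) (m a n : nat) : K :=
  if (n == 2 * m - 2 * a - 1 %[mod 8 * m + 4])%N then 1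
  else if (n == 2 * m + 2 * a + 3 %[mod 8 * m + 4])%N then - 1
  else if (n == 6 * m - 2 * a + 1 %[mod 8 * m + 4])%N then - 1
  else if (n == 6 * m + 2 * a + 5 %[mod 8 * m + 4])%N then 1
  else 0.

(* R[i]^o is R[i] with its topology as a normed space over itself. *)
Section LFunction.
Variable R : realType.
Local Notation C := R[i].

Definition Cexp (z : C) : C :=
  (expR (complex.Re z))%:C * (cos (complex.Im z) +i* sin (complex.Im z)).

(* n^s for n >= 1 *)
Definition natCpow (n : nat) (s : C) : C := Cexp (s * (ln (n%:R : R))%:C).

Definition analytic_at (f : C -> C) (z0 : C) : Prop :=
  exists c : nat -> C,
    \forall z \near (z0 : C^o),
      series (fun n => c n * (z - z0) ^+ n : C^o) @ \oo --> (f z : C^o).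

Definition entire (f : C -> C) : Prop := forall z, analytic_at f z.

Definition is_dirichlet_continuation (x : nat -> C) (L : C -> C) : Prop :=
  entire L /\
  forall s : C, 1 < complex.Re s ->
    series (fun n => x n.+1 * natCpow n.+1 (- s) : C^o) @ \oo --> (L s : C^o).

(* L(s, x): the entire continuation, unique by the identity theorem.  The
   default value 0 is taken only if there is no continuation; it exists when x
   is periodic of mean zero. *)
Definition Lfun (x : nat -> C) : C -> C :=
  xget (fun=> 0) [set L | is_dirichlet_continuation x L].

Definition Tcoef (m a n : nat) : C :=
  2^-1 * (- 1) ^+ n.+1 * Lfun (chi C m a) (- (2 * n + 1)%:R).

End LFunction.

(* Main.v *)
(* Put x = e^(2yt), q = e^(-t) and insert (x)_(k_m + 1) x^(k_m + 2(k_1 + ... + k_(m-1)))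
   into the sum defining X.  For y = J, i.e. x = q^(-2J), the sum terminates and
   Bailey's lemma (parameter x^2 up to k_a, then x^2 q) evaluates it to
     e^((fJ - c)^2 t / 8M) sum_(0 < n < fJ) chi(n) e^(-n^2 t / 8M),
   M = 2m + 1, f = 4M, c = 2m - 2a - 1.  Every t-coefficient of both sides is a
   polynomial in J, the right one by the Bernoulli formula for power sums, so the
   identity persists for indeterminate y.  Both sides vanish at y = 0, and their
   y-derivatives there are -2t X(e^(-t)) and the claimed Bernoulli series.

   For the L-values, chi(n + 2M) = - chi(n) makes the Dirichlet series alternating.
   With D h(x) = h(x + 2M) - h(x), Euler's transformation
     2 sum chi(n) h(n) = sum_(n <= 2M) chi(n) h(n) - sum chi(n) (D h)(n),
   iterated p times, replaces n^(-s) by D^p n^(-s) = O(n^(1 - Re s - p)): this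
   continues L(s) to Re s > 2 - p, and at s = -k the process stops after k + 1 steps
   because D^(k+1) n^k = 0.  The Bernoulli expression obeys the same recursion. *)
Require Import Defs.
From HB Require Import structures.
From mathcomp Require Import all_boot all_order all_algebra.
From mathcomp Require Import complex.
From mathcomp Require Import all_classical all_reals all_analysis.
From mathcomp Require Import ring lra zify.

Set Implicit Arguments.
Unset Strict Implicit.
Unset Printing Implicit Defensive.
Import Order.TTheory GRing.Theory Num.Theory.
Local Open Scope ring_scope.

(** * Gaussian binomials and Bailey pairs *)

(** Two obstacles shape the formal half. Bailey's lemma divides by 1 - q^i, which is not invertible
    at q = e^(-t). The terminating identity is therefore proved in a field, converted into a
    polynomial in q with infinitely many integer roots, and only then evaluated on power series.
    Moreover the number of terms at y = J grows with J, which no polynomial in J can express; a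
    truncation of fixed length has the same coefficient of t^n as soon as J is large. The factor 1 -
    x of (x)_(k_m + 1) puts a factor J on both sides. Cancelling it before J becomes y replaces the
    derivative at y = 0 by a plain evaluation. The exponent 2J is even because the evaluated sum
    alternates in sign: two consecutive terms make up one full period of chi. On the analytic side
    all bounds on differences of n^(-s) are uniform over the Taylor coefficients in s. The
    continuation is thus a local power series by mere exchange of sums, without Cauchy's theory. An
    identity theorem is still required, since [Lfun] is an arbitrary choice among continuations. *)

Section QCalculus.
Variable S : comNzRingType.

Definition poc (q x : S) (n : nat) : S := \prod_(i < n) (1 - x * q ^+ i).

(** The q-Pascal recursion gives Gaussian binomials without division, hence in rings where (q)_n is
    not invertible. *)
Fixpoint gb (q : S) (n k : nat) : S :=
  match n, k with
  | _, 0 => 1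
  | 0, _.+1 => 0
  | n'.+1, k'.+1 => gb q n' k'.+1 + q ^+ (n' - k') * gb q n' k'
  end.

Lemma poc0 q x : poc q x 0 = 1.
Proof. by rewrite /poc big_ord0. Qed.

Lemma pocS q x n : poc q x n.+1 = poc q x n * (1 - x * q ^+ n).
Proof. by rewrite /poc big_ord_recr. Qed.

Lemma pocD q x n k : poc q x (n + k) = poc q x n * poc q (x * q ^+ n) k.
Proof.
elim: k => [|k IHk]; first by rewrite addn0 poc0 mulr1.
by rewrite addnS !pocS IHk exprD !mulrA.
Qed.

Lemma pocSl q x n : poc q x n.+1 = (1 - x) * poc q (x * q) n.
Proof. by rewrite -add1n pocD pocS poc0 mul1r expr0 mulr1 expr1. Qed.

Lemma gb0 q n : gb q n 0 = 1. Proof. by case: n. Qed.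

Lemma gb_gt q n k : (n < k)%N -> gb q n k = 0.
Proof.
elim: n k => [|n IHn] [|k] //= nk.
by rewrite !IHn ?mulr0 ?addr0 // ltnW.
Qed.

Lemma gbS q n k :
  gb q n.+1 k.+1 = gb q n k.+1 + q ^+ (n - k) * gb q n k.
Proof. by []. Qed.

Lemma gb_fact q n k : (k <= n)%N ->
  gb q n k * (poc q q k * poc q q (n - k)) = poc q q n.
Proof.
elim: n k => [|n IHn] [|k] // kn; rewrite ?gb0 ?poc0 ?subn0 ?mul1r //.
rewrite gbS subSS (pocS q q k) mulrDl (pocS q q n).
have e2 : q ^+ (n - k) * gb q n k * (poc q q k * (1 - q * q ^+ k) * poc q q (n - k))
   = q ^+ (n - k) * (1 - q * q ^+ k) * poc q q n.
  by rewrite -(IHn k) //; ring.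
rewrite e2; have [kn'|] := ltnP k n.
- have -> : (n - k = (n - k.+1).+1)%N by lia.
  rewrite pocS -(pocS q q k).
  have -> : gb q n k.+1 * (poc q q k.+1 * (poc q q (n - k.+1) * (1 - q * q ^+ (n - k.+1))))
     = poc q q n * (1 - q * q ^+ (n - k.+1)) by rewrite -(IHn k.+1 kn'); ring.
  have -> : q ^+ n = q ^+ k * q ^+ (n - k.+1) * q.
    by rewrite -exprD -exprSr; congr (_ ^+ _); lia.
  by rewrite exprS; ring.
- move=> nk; have -> : k = n by apply/eqP; rewrite eqn_leq nk -ltnS kn.
  by rewrite gb_gt // subnn expr0; ring.
Qed.

(** q-Chu-Vandermonde with denominators cleared. The q-Pascal rule splits the sum at n + 1 into the
    sums at n for [c] and for [c * q], with weights [1 - c * q ^+ n] and [- q ^+ n * (d - c)], which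
    add up to [1 - d * q ^+ n]. *)
Lemma q_vandermonde q c d n :
  \sum_(i < n.+1) gb q n i * (- 1) ^+ i * q ^+ 'C(i, 2)
     * (\prod_(j < i) (d - c * q ^+ j)) * poc q (c * q ^+ i) (n - i)
  = poc q d n.
Proof.
elim: n c => [|n IHn] c.
  by rewrite big_ord1 gb0 big_ord0 bin0n !expr0 !poc0 !mulr1.
pose F (k : nat) := (- 1) ^+ k * q ^+ 'C(k, 2)
     * (\prod_(j < k) (d - c * q ^+ j)) * poc q (c * q ^+ k) (n.+1 - k).
transitivity (\sum_(i < n.+1) gb q n i * F i
    + \sum_(i < n.+1) q ^+ (n - i) * gb q n i * F i.+1).
  transitivity (\sum_(i < n.+2) gb q n.+1 i * F i).
    by apply: eq_bigr => i _; rewrite /F !mulrA.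
  rewrite big_ord_recl gb0 [X in _ = X + _]big_ord_recl gb0 /=.
  have -> : \sum_(i < n.+1) gb q n.+1 (lift ord0 i) * F (lift ord0 i)
     = \sum_(i < n.+1) gb q n i.+1 * F i.+1
       + \sum_(i < n.+1) q ^+ (n - i) * gb q n i * F i.+1.
    by rewrite -big_split; apply: eq_bigr => i _; rewrite lift0 gbS mulrDl.
  rewrite [X in _ + (X + _)]big_ord_recr /= gb_gt // mul0r addr0 addrA.
  by congr (_ + _ + _); apply: eq_bigr => i _; rewrite lift0.
transitivity ((1 - c * q ^+ n) * poc q d n + - q ^+ n * (d - c) * poc q d n);
  last by rewrite pocS; ring.
congr (_ + _).
- rewrite -(IHn c) big_distrr; apply: eq_bigr => -[i /= ilt] _.
  have -> : q ^+ n = q ^+ i * q ^+ (n - i) by rewrite -exprD subnKC.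
  by rewrite /F subSn // pocS; ring.
- rewrite -(IHn (c * q)) big_distrr; apply: eq_bigr => -[i /= ilt] _.
  have -> : q ^+ n = q ^+ (n - i) * q ^+ i by rewrite -exprD subnK.
  rewrite /F big_ord_recl expr0 mulr1 subSS exprS binS bin1 exprD exprS (mulrA c q).
  have -> : \prod_(j < i) (d - c * q ^+ lift ord0 j)
     = \prod_(j < i) (d - c * q * q ^+ j).
    by apply: eq_bigr => j _; rewrite lift0 exprS mulrA.
  ring.
Qed.

(* kern q A a i n sums the summand of X, with A^(k_1 + ... + k_(i-1)) inserted, over
   k_1, ..., k_(i-1) for fixed k_i = n; the index i = 0 stands for k_0 = 0. *)
Fixpoint kern (q A : S) (a i n : nat) : S :=
  if i is i'.+1 then
    \sum_(k < n.+2) gb q (n + (i' == a)) k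
       * (A ^+ k * q ^+ (k ^ 2 + (a < i')%N * k)) * kern q A a i' k
  else (n == 0%N)%:R.

Lemma kernS q A a i n : kern q A a i.+1 n =
  \sum_(k < n.+2) gb q (n + (i == a)) k
       * (A ^+ k * q ^+ (k ^ 2 + (a < i)%N * k)) * kern q A a i k.
Proof. by []. Qed.

End QCalculus.

Lemma sum_triangle (S : nmodType) (g : nat -> nat -> S) n :
  \sum_(k < n.+1) \sum_(r < k.+1) g k r
  = \sum_(r < n.+1) \sum_(i < (n - r).+1) g (r + i)%N r.
Proof.
elim: n => [|n IHn]; first by rewrite !big_ord1.
rewrite big_ord_recr IHn /= [X in _ + X = _]big_ord_recr [in RHS]big_ord_recr /= addrA.
congr (_ + _); last by rewrite subnn big_ord1 addn0.
rewrite -big_split; apply: eq_bigr => -[r /= rn] _.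
by rewrite subSn // [in RHS]big_ord_recr /= -subSn // subnKC // ltnW.
Qed.

Lemma sqrn_bin2 i : (i ^ 2 = i + 'C(i, 2) + 'C(i, 2))%N.
Proof. by elim: i => // i IHi; rewrite binS bin1; nia. Qed.

(** * Bailey's lemma, its iteration and the change of base *)

Section BaileyChain.
Variables (F : fieldType) (q : F).
Hypothesis q_neq1 : forall i, (0 < i)%N -> 1 - q ^+ i != 0.

Lemma pocq_neq0 n : poc q q n != 0.
Proof. by apply/prodf_neq0 => i _; rewrite -exprS q_neq1. Qed.

(* Bailey's weight 1 / ((q)_(n-r) (Aq)_(n+r)) without the factor (Aq)_(2r): the latter
   may vanish for A = q^(-2N), r = N. *)
Definition bwt (A : F) (n r : nat) : F :=
  (poc q q (n - r) * poc q (A * q ^+ (2 * r).+1) (n - r))^-1.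

(** [q_vandermonde] at [c = B * q] and [d = 0]: the signs cancel in pairs, and [sqrn_bin2] collects
    the powers of q. *)
Lemma bailey_kernel (B : F) n : poc q (B * q) n != 0 ->
  \sum_(i < n.+1) B ^+ i * q ^+ (i ^ 2)
     / (poc q q (n - i) * (poc q q i * poc q (B * q) i))
  = (poc q q n * poc q (B * q) n)^-1.
Proof.
move=> Bn.
have := q_vandermonde q (B * q) 0 n.
have -> : poc q 0 n = 1.
  by rewrite /poc big1 // => i _; rewrite mul0r subr0.
move=> V; rewrite -[RHS]mul1r -[X in X / _]V big_distrl.
apply: eq_bigr => -[i /= ilt] _.
have gE : gb q n i = poc q q n / (poc q q i * poc q q (n - i)).
  by rewrite -(@gb_fact _ q n i) // mulfK // mulf_neq0 ?pocq_neq0.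
have pE : poc q (B * q) n = poc q (B * q) i * poc q (B * q * q ^+ i) (n - i).
  by rewrite -pocD subnKC.
move: Bn; rewrite pE mulf_eq0 negb_or => /andP[Bi Bni].
have -> : \prod_(j < i) (0 - B * q * q ^+ j)
    = (-1) ^+ i * B ^+ i * q ^+ i * q ^+ 'C(i, 2).
  elim: i {V gE pE Bi Bni ilt} => [|i IHi].
    by rewrite big_ord0 bin0n !expr0 !mulr1.
  by rewrite big_ord_recr IHi /= sub0r binS bin1 !exprS exprD; ring.
have -> : q ^+ (i ^ 2) = q ^+ i * q ^+ 'C(i, 2) * q ^+ 'C(i, 2).
  by rewrite -!exprD sqrn_bin2.
have := pocq_neq0 n; have := pocq_neq0 i; have := pocq_neq0 (n - i).
have : (-1) ^+ i * (-1) ^+ i = 1 :> F by rewrite -exprMn mulrNN mulr1 expr1n.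
rewrite gE; move: ((-1) ^+ i) => e ee h1 h2 h3.
transitivity (e * e * (B ^+ i * (q ^+ i * q ^+ 'C(i, 2) * q ^+ 'C(i, 2)) /
  (poc q q (n - i) * (poc q q i * poc q (B * q) i)))); first by rewrite ee mul1r.
by field; rewrite h1 h2 h3 Bi Bni.
Qed.

(** Bailey's lemma with both free parameters sent to infinity: after exchanging the sums, the inner
    one is [bailey_kernel] for [B = A * q ^+ (2 * r)]. The hypothesis stops before [i = 2 * n],
    where the factor may vanish when A = q^(-2N). *)
Lemma bailey_step (A : F) (f : nat -> F) n :
  (forall i, (0 < i < 2 * n)%N -> 1 - A * q ^+ i != 0) ->
  \sum_(k < n.+1) A ^+ k * q ^+ (k ^ 2) / poc q q (n - k)
      * (\sum_(r < k.+1) f r * bwt A k r)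
  = \sum_(r < n.+1) A ^+ r * q ^+ (r ^ 2) * f r * bwt A n r.
Proof.
move=> hA.
under eq_bigr do rewrite big_distrr /=.
pose g k r := A ^+ k * q ^+ (k ^ 2) / poc q q (n - k) * (f r * bwt A k r).
rewrite (sum_triangle g n); apply: eq_bigr => -[r /= rn] _; rewrite /g.
set B := A * q ^+ (2 * r).
have Bn : poc q (B * q) (n - r) != 0.
  apply/prodf_neq0 => i _; rewrite /B -!mulrA -exprS -exprD hA //.
  by case: i => i /=; lia.
transitivity (A ^+ r * q ^+ (r ^ 2) * f r *
   \sum_(i < (n - r).+1) B ^+ i * q ^+ (i ^ 2)
     / (poc q q (n - r - i) * (poc q q i * poc q (B * q) i))).
  rewrite big_distrr; apply: eq_bigr => -[i /= ilt] _.
  rewrite /bwt addKn subnDA exprSr (mulrA A) -/B exprD.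
  have -> : B ^+ i = A ^+ i * q ^+ (2 * r * i) by rewrite exprMn -exprM.
  have -> : ((r + i) ^ 2 = r ^ 2 + i ^ 2 + 2 * r * i)%N by lia.
  by rewrite !exprD !invfM; ring.
by rewrite bailey_kernel // /bwt exprSr mulrA.
Qed.

(** Partial sums of the unit pair have a product form, so that [bailey_unit] follows from an
    induction on [s] that adds one term at a time. *)
Lemma bailey_unit_partial (A : F) n s : (s <= n)%N ->
  (forall i, (0 < i < 2 * n.+1)%N -> 1 - A * q ^+ i != 0) ->
  \sum_(r < s.+1) (- 1) ^+ r * q ^+ 'C(r, 2) * poc q (A * q) r.-1
      / (poc q q r * poc q (A * q) (2 * r).-1) * bwt A n.+1 r
  = (- 1) ^+ s * q ^+ 'C(s.+1, 2) * poc q (A * q) s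
    / (poc q q s * poc q q (n - s) * (1 - q ^+ n.+1) * poc q (A * q) (n.+1 + s)).
Proof.
move=> sn hA.
have hp k : (k < 2 * n.+1)%N -> poc q (A * q) k != 0.
  move=> kn; apply/prodf_neq0 => i _; rewrite -mulrA -exprS hA //.
  by case: i => i /=; lia.
elim: s sn => [|s IHs] sn.
  rewrite big_ord1 /bwt !subn0 !addn0 muln0 /= bin0n !expr0 !poc0 !mulr1 expr1.
  by rewrite invr1 !mul1r pocS -exprS.
set T := (X in \sum_(r < _) X r).
transitivity (\sum_(r < s.+1) T (widen_ord (leqnSn _) r) + T ord_max).
  by rewrite big_ord_recr.
rewrite (IHs (ltnW sn)) /T [nat_of_ord ord_max]/= [s.+1.-1]/= {T}.
have -> : (2 * s.+1).-1 = (2 * s).+1 by lia.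
pose u := q ^+ s.+1; pose w := q ^+ (n - s).
(* Two factorisations of the single symbol (Aq)_(n+s+2); they eliminate one of the shifted symbols
   before [field]. *)
have e1 : poc q (A * q) (n.+1 + s) * (1 - A * u * u * w) =
   poc q (A * q) (2 * s).+1 * (1 - A * u * u)
    * poc q (A * q ^+ (2 * s.+1).+1) (n - s).
  have := pocD q (A * q) (2 * s).+2 (n - s).
  have -> : ((2 * s).+2 + (n - s) = (n.+1 + s).+1)%N by lia.
  rewrite !pocS -!mulrA -!exprS /u /w -!exprD.
  have -> : ((n.+1 + s).+1 = s.+1 + (s.+1 + (n - s)))%N by lia.
  have -> : ((2 * s).+2 = s.+1 + s.+1)%N by lia.
  by have -> : (2 * s.+1 = s.+1 + s.+1)%N by lia.
have huu : 1 - A * u * u != 0 by rewrite -mulrA -exprD hA //; lia.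
have huuw : 1 - A * u * u * w != 0.
  by rewrite -!mulrA -!exprD hA //; lia.
have hX : poc q (A * q) (n.+1 + s) != 0 by apply: hp; lia.
have hY : poc q (A * q) (2 * s).+1 != 0 by apply: hp; lia.
have uw : q ^+ n.+1 = u * w by rewrite -exprD; congr (_ ^+ _); lia.
have auuw : A * q * q ^+ (n.+1 + s) = A * u * u * w.
  by rewrite -!mulrA -exprS -!exprD; congr (_ * _ ^+ _); lia.
have nsE : (n - s = (n - s.+1).+1)%N by lia.
have hQ : poc q (A * q ^+ (2 * s.+1).+1) (n - s) != 0.
  apply/negP => /eqP Q0; move: e1; rewrite Q0 mulr0 => /eqP.
  by rewrite mulf_eq0 (negbTE hX) (negbTE huuw).
have wE : w = q * q ^+ (n - s.+1) by rewrite -exprS /w nsE.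
have uE : u = q * q ^+ s by rewrite -exprS.
have h1 : 1 - u != 0 by rewrite q_neq1.
have h2 : 1 - w != 0 by rewrite q_neq1 // subn_gt0.
have h3 : 1 - u * w != 0 by rewrite -uw q_neq1.
have {}e1 : (poc q (A * q) (2 * s).+1 * poc q (A * q ^+ (2 * s.+1).+1) (n - s))^-1
   = (1 - A * u * u) / (poc q (A * q) (n.+1 + s) * (1 - A * u * u * w)).
  by rewrite e1; field; rewrite hY huu hQ.
have h4 := pocq_neq0 (n - s.+1); have h5 := pocq_neq0 s.
rewrite uw.
rewrite /bwt subSS.
have -> : poc q q (n - s) = poc q q (n - s.+1) * (1 - w).
  by rewrite wE -pocS nsE.
rewrite !(pocS q q s) (pocS q _ s) -uE (addnS n.+1) (pocS q _ (n.+1 + s)).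
rewrite auuw.
have -> : A * q * q ^+ s = A * u by rewrite uE mulrA.
have -> : q ^+ 'C(s.+2, 2) = u * q ^+ 'C(s.+1, 2) by rewrite binS bin1 exprD mulrC.
rewrite [(-1) ^+ s.+1]exprS.
set Y := poc q _ (2 * s).+1 in e1 hY *; set Q := poc q _ (n - s) in e1 hQ *.
set X := poc q _ (n.+1 + s) in e1 hX *.
transitivity ((- 1) ^+ s * q ^+ 'C(s.+1, 2) * poc q (A * q) s
    / (poc q q s * poc q q (n - s.+1) * (1 - w))
    * (((1 - u * w) * X)^-1 - (1 - u)^-1 * (Y * Q)^-1)).
  by field; rewrite hX hY hQ h1 h2 h3 h4 h5.
rewrite e1; field; rewrite hX h1 h2 h3 h4 h5.
by rewrite ?huuw.
Qed.

(** The weights are the alpha_r of the unit Bailey pair divided by (Aq)_(2r). The truncated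
    predecessors [r.-1] and [(2 * r).-1] give the correct value 1 at r = 0. *)
Lemma bailey_unit (A : F) n :
  (forall i, (0 < i < 2 * n)%N -> 1 - A * q ^+ i != 0) ->
  \sum_(r < n.+1) (- 1) ^+ r * q ^+ 'C(r, 2) * poc q (A * q) r.-1
      / (poc q q r * poc q (A * q) (2 * r).-1) * bwt A n r
  = (n == 0%N)%:R.
Proof.
case: n => [_|n hA].
  by rewrite big_ord1 /bwt !subn0 bin0n muln0 /= !poc0 !expr0 !mulr1 invr1 !mulr1.
rewrite big_ord_recr bailey_unit_partial //= /bwt !subnn !poc0 !mulr1 invr1 mulr1.
have -> : (n + 1 * n.+1)%coq_nat = (n.+1 + n)%N by lia.
have hX : poc q (A * q) (n.+1 + n) != 0.
  apply/prodf_neq0 => -[i /= ilt] _; rewrite -mulrA -exprS hA //; lia.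
rewrite [(-1) ^+ n.+1]exprS (pocS q q n) -(exprS q n).
have h1 := q_neq1 (ltn0Sn n); have h2 := pocq_neq0 n.
by field; rewrite h1 h2 hX.
Qed.

(** The pair relative to base Aq that comes out of level a. Its last factor compares the weights
    A^(br) q^(b r^2) of two neighbouring terms of the old pair, r = s and r = s + 1. *)
Definition acoef (A : F) b s : F :=
  (- 1) ^+ s * q ^+ 'C(s.+1, 2) * A ^+ (b * s) * q ^+ (b * s ^ 2)
    * poc q (A * q) s / (poc q q s * poc q (A * q) (2 * s).+1)
    * (1 - A ^+ b * q ^+ (b * (2 * s).+1)).

(** The factor [1 - q ^+ n.+1] is the surplus of (q)_(n+1) over (q)_n produced by the binomial
    [k_(a+1) + 1; k_a]. Thanks to it a term of base A is a combination of two terms of base Aq. *)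
Lemma bailey_change_base (A : F) b n :
  (forall i, (0 < i < 2 * n.+1)%N -> 1 - A * q ^+ i != 0) ->
  (1 - q ^+ n.+1) * (\sum_(r < n.+2) A ^+ (b * r) * q ^+ (b * r ^ 2)
    * ((- 1) ^+ r * q ^+ 'C(r, 2) * poc q (A * q) r.-1
      / (poc q q r * poc q (A * q) (2 * r).-1)) * bwt A n.+1 r)
  = \sum_(s < n.+1) acoef A b s * bwt (A * q) n s.
Proof.
move=> hA.
have hp k : (k < 2 * n.+1)%N -> poc q (A * q) k != 0.
  move=> kn; apply/prodf_neq0 => i _; rewrite -mulrA -exprS hA //.
  by case: i => i /=; lia.
pose X s := (- 1) ^+ s * q ^+ 'C(s.+1, 2)
    * poc q (A * q) s / (poc q q s * poc q (A * q) (2 * s).+1) * bwt (A * q) n s.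
pose w r := A ^+ (b * r) * q ^+ (b * r ^ 2).
(* the r-th term contributes to the indices r and r - 1 of the new pair *)
pose Y s := (- 1) ^+ s.+1 * q ^+ 'C(s.+1, 2)
    * poc q (A * q) s / (poc q q s * poc q (A * q) (2 * s).+1) * bwt (A * q) n s.
transitivity (\sum_(s < n.+1) w s * X s + \sum_(s < n.+1) w s.+1 * Y s); last first.
  rewrite -big_split; apply: eq_bigr => -[s /= sn] _.
  have -> : w s.+1 = w s * (A ^+ b * q ^+ (b * (2 * s).+1)).
    rewrite /w mulnSr exprD.
    have -> : (b * s.+1 ^ 2 = b * s ^ 2 + b * (2 * s).+1)%N by nia.
    by rewrite exprD; ring.
  by rewrite /X /Y /acoef /w [(-1) ^+ s.+1]exprS; ring.
pose T r := (1 - q ^+ n.+1) * (w r * ((- 1) ^+ r * q ^+ 'C(r, 2)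
      * poc q (A * q) r.-1 / (poc q q r * poc q (A * q) (2 * r).-1)) * bwt A n.+1 r).
transitivity (T 0%N + (\sum_(s < n) T s.+1 + T n.+1)).
  by rewrite big_distrr big_ord_recl /= [in LHS]big_ord_recr.
have -> : \sum_(s < n.+1) w s * X s = w 0%N * X 0%N + \sum_(s < n) w s.+1 * X s.+1.
  by rewrite big_ord_recl.
have -> : \sum_(s < n.+1) w s.+1 * Y s = \sum_(s < n) w s.+1 * Y s + w n.+1 * Y n.
  by rewrite big_ord_recr.
(* The outer terms r = 0 and r = n + 1 feed one index each; every inner term is matched with [X] at
   r plus [Y] at r - 1. *)
rewrite -addrA [\sum_(s < n) _ * X _ + _]addrA -big_split; congr (_ + (_ + _)).
- have hA1 : 1 - A * q != 0 by rewrite -(expr1 q) hA //; lia.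
  have := hp n.+1 ltac:(lia); rewrite pocSl mulf_eq0 (negbTE hA1) /= => hQ.
  rewrite /T /X /w /bwt !subn0 !muln0 bin0n (_ : 'C(1, 2) = 0%N) // !expr0.
  rewrite poc0 (pocS q q n) -exprS (pocSl q (A * q) n) pocSl poc0 !expr1 ?poc0.
  have h1 := q_neq1 (ltn0Sn n); have h2 := pocq_neq0 n.
  by field; rewrite hA1 h1 h2 hQ oner_neq0.
- apply: eq_bigr => -[s /= sn] _.
  rewrite -mulrDr /T -[w _ * _ * bwt _ _ _]mulrA mulrCA; congr (_ * _).
  pose u := q ^+ s.+1; pose v := q ^+ (n - s).
  have nsE : (n - s = (n - s.+1).+1)%N by lia.
  have uv : q ^+ n.+1 = u * v by rewrite -exprD; congr (_ ^+ _); lia.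
  have h1 : 1 - u != 0 by rewrite q_neq1.
  have h2 : 1 - v != 0 by rewrite q_neq1 // subn_gt0.
  have h3 : 1 - A * u * u != 0 by rewrite -mulrA -exprD hA //; lia.
  have h4 : 1 - A * u * u * v != 0 by rewrite -!mulrA -!exprD hA //; lia.
  have h5 : poc q (A * q) (2 * s).+1 != 0 by apply: hp; lia.
  have h6 := pocq_neq0 s; have h7 := pocq_neq0 (n - s.+1).
  have E1 : A * q ^+ (2 * s.+1).+1 = A * u * u * q.
    by rewrite /u -!mulrA -exprSr -!exprD; congr (_ * _ ^+ _); lia.
  have E2 : A * q * q ^+ (2 * s).+1 = A * u * u.
    by rewrite /u -!mulrA -exprS -!exprD; congr (_ * _ ^+ _); lia.
  have E3 : A * q * q ^+ (2 * s.+1).+1 = A * u * u * q * q.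
    by rewrite mulrAC E1.
  have E4 : A * u * u * q * q ^+ (n - s.+1) = A * u * u * v.
    by rewrite -!mulrA -exprS -nsE.
  have E5 : A * q * q ^+ (2 * s).+2 = A * u * u * q.
    by rewrite exprSr mulrA E2.
  pose Z := poc q (A * u * u * q) (n - s.+1).
  have F1 : poc q (A * u * u * q) (n - s) = Z * (1 - A * u * u * v).
    by rewrite nsE pocS E4.
  have F2 : poc q (A * u * u) (n - s) = (1 - A * u * u) * Z by rewrite nsE pocSl.
  have F3 : poc q (A * u * u * q) (n - s)
     = (1 - A * u * u * q) * poc q (A * u * u * q * q) (n - s.+1).
    by rewrite nsE pocSl.
  have h8 : Z != 0.
    apply/prodf_neq0 => -[i /= ilt] _.
    by rewrite /u -!mulrA -exprS -!exprD hA //; lia.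
  have : poc q (A * u * u * q) (n - s) != 0 by rewrite F1 mulf_neq0.
  rewrite F3 mulf_eq0 negb_or => /andP[h9 h10].
  (* [F1] and [F3] factor the same symbol in two ways; equating them removes one of the two shifted
     symbols. *)
  have F4 : ((1 - A * u * u * q) * poc q (A * u * u * q * q) (n - s.+1))^-1
    = (Z * (1 - A * u * u * v))^-1 by rewrite -F3 F1.
  have P2 : poc q (A * q) (2 * s.+1).-1 = poc q (A * q) (2 * s).+1.
    by rewrite mulnS.
  have P3 : poc q (A * q) (2 * s.+1).+1
     = poc q (A * q) (2 * s).+1 * (1 - A * u * u) * (1 - A * u * u * q).
    by rewrite mulnS !pocS E2 E5.
  have P4 : poc q q (n - s) = poc q q (n - s.+1) * (1 - v).
    by rewrite nsE pocS -exprS -nsE.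
  rewrite /X /Y /bwt subSS P2 E1 E2 E3 F1 F2 uv P3 P4 (pocS q (A * q) s) (pocS q q s).
  rewrite -(exprS q s) -/u -[A * q * _]mulrA -(exprS q s) -/u.
  rewrite (_ : 'C(s.+2, 2) = 'C(s.+1, 2) + s.+1)%N; last by rewrite binS bin1.
  rewrite [q ^+ (_ + s.+1)]exprD -/u.
  set e := (-1) ^+ s.+1; set k := q ^+ 'C(s.+1, 2).
  set Y2 := poc q (A * u * u * q * q) _ in F4 h10 *.
  set Y3 := poc q (A * q) (2 * s).+1 in h5 *.
  rewrite [s.+1.-1]/=; set Y4 := poc q (A * q) s.
  transitivity (e * k * Y4 / (poc q q s * poc q q (n - s.+1) * Y3) *
    (u * (1 - A * u) / ((1 - u) * (1 - A * u * u)) * ((1 - A * u * u * q) * Y2)^-1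
     + ((1 - v) * (1 - A * u * u) * Z)^-1)); last first.
    by field; rewrite h1 h2 h3 h5 h6 h7 h8 h9 h10.
  rewrite F4; field.
  by rewrite h1 h2 h3 h4 h5 h6 h7 h8.
- rewrite /T /Y -[w _ * _ * bwt _ _ _]mulrA mulrCA; congr (_ * _).
  rewrite /bwt !subnn !poc0 !mulr1 invr1 mulr1 (pocS q q n) -exprS.
  have h1 := q_neq1 (ltn0Sn n); have h2 := pocq_neq0 n.
  have -> : (2 * n.+1).-1 = (2 * n).+1 by lia.
  have hY : poc q (A * q) (2 * n).+1 != 0 by apply: hp; lia.
  by field; rewrite h1 h2 hY.
Qed.

Lemma gb_quot n k : (k <= n)%N ->
  gb q n k = poc q q n / (poc q q k * poc q q (n - k)).
Proof. by move=> kn; rewrite -(gb_fact q kn) mulfK // mulf_neq0 ?pocq_neq0. Qed.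

(** One level of the chain: the binomial supplies the 1/(q)_(n-k) of [bailey_step], and its 1/(q)_k
    cancels the prefactor of the inner pair. *)
Lemma kern_step (A : F) (f g : nat -> F) n :
  (forall i, (0 < i < 2 * n)%N -> 1 - A * q ^+ i != 0) ->
  (forall k, (k <= n)%N -> g k = poc q q k * \sum_(r < k.+1) f r * bwt A k r) ->
  \sum_(k < n.+1) gb q n k * (A ^+ k * q ^+ (k ^ 2)) * g k
  = poc q q n * \sum_(r < n.+1) A ^+ r * q ^+ (r ^ 2) * f r * bwt A n r.
Proof.
move=> hA hg; rewrite -bailey_step // big_distrr.
apply: eq_bigr => -[k /= kn] _; rewrite gb_quot // hg //.
have h1 := pocq_neq0 k; have h2 := pocq_neq0 (n - k).
by field; rewrite h1 h2.
Qed.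

(** Up to level a the unit pair is iterated i times, each step multiplying the r-th weight by
    [A ^+ r * q ^+ (r ^ 2)]. *)
Lemma kern_below (A : F) a i n : (i <= a)%N ->
  (forall j, (0 < j < 2 * n)%N -> 1 - A * q ^+ j != 0) ->
  kern q A a i n = poc q q n * \sum_(r < n.+1) A ^+ (i * r) * q ^+ (i * r ^ 2)
    * ((- 1) ^+ r * q ^+ 'C(r, 2) * poc q (A * q) r.-1
      / (poc q q r * poc q (A * q) (2 * r).-1)) * bwt A n r.
Proof.
elim: i n => [|i IHi] n ia hA.
  under eq_bigr do rewrite !mul0n !expr0 !mul1r.
  by rewrite bailey_unit //=; case: n {hA} => [|n]; rewrite ?poc0 ?mulr1 ?mulr0.
rewrite kernS (ltn_eqF ia) ltnNge (ltnW ia) addn0 big_ord_recr /=.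
(* [kern] sums up to [n.+1] at every level for the sake of level a alone; here the extra term has a
   zero binomial. *)
rewrite gb_gt // !mul0r addr0.
under eq_bigr do rewrite mul0n addn0.
rewrite (@kern_step A (fun r => A ^+ (i * r) * q ^+ (i * r ^ 2)
    * ((- 1) ^+ r * q ^+ 'C(r, 2) * poc q (A * q) r.-1
      / (poc q q r * poc q (A * q) (2 * r).-1)))) //; last first.
  move=> k kn; apply: IHi; first exact: ltnW.
  by move=> j jk; apply: hA; lia.
congr (_ * _); apply: eq_bigr => r _; congr (_ * _).
by rewrite !mulSn !exprD; ring.
Qed.

Lemma kern_at (A : F) a n :
  (forall j, (0 < j < 2 * n.+1)%N -> 1 - A * q ^+ j != 0) ->
  kern q A a a.+1 n
  = poc q q n * \sum_(s < n.+1) acoef A a.+1 s * bwt (A * q) n s.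
Proof.
move=> hA; rewrite -bailey_change_base // mulrA exprS -pocS.
rewrite kernS eqxx ltnn addn1.
under eq_bigr do rewrite mul0n addn0.
rewrite (@kern_step A (fun r => A ^+ (a * r) * q ^+ (a * r ^ 2)
    * ((- 1) ^+ r * q ^+ 'C(r, 2) * poc q (A * q) r.-1
      / (poc q q r * poc q (A * q) (2 * r).-1)))) //; last first.
  move=> k kn; apply: kern_below => // j jk; apply: hA; lia.
congr (_ * _); apply: eq_bigr => r _; congr (_ * _).
by rewrite !mulSn !exprD; ring.
Qed.

(** Beyond level a the linear exponent k_i turns [A ^+ k] into [(A * q) ^+ k], so the chain goes on
    in exactly the base in which [kern_at] delivers its pair. *)
Lemma kern_above (A : F) a i n :
  (forall j, (0 < j < 2 * n.+1)%N -> 1 - A * q ^+ j != 0) ->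
  kern q A a (i + a.+1) n
  = poc q q n * \sum_(s < n.+1) (A * q) ^+ (i * s) * q ^+ (i * s ^ 2)
       * acoef A a.+1 s * bwt (A * q) n s.
Proof.
elim: i n => [|i IHi] n hA.
  rewrite kern_at //; congr (_ * _); apply: eq_bigr => s _.
  by rewrite !mul0n !expr0 !mul1r.
rewrite addSn kernS.
have -> : (i + a.+1 == a) = false by apply/negbTE; lia.
have -> : (a < i + a.+1)%N by lia.
rewrite addn0 big_ord_recr /= gb_gt // !mul0r addr0.
transitivity (\sum_(k < n.+1) gb q n k * ((A * q) ^+ k * q ^+ (k ^ 2))
   * kern q A a (i + a.+1) k).
  apply: eq_bigr => k _; congr (_ * _ * _).
  by rewrite mul1n exprD exprMn; ring.
rewrite (@kern_step (A * q) (fun s => (A * q) ^+ (i * s) * q ^+ (i * s ^ 2)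
       * acoef A a.+1 s)); first last.
- by move=> k kn; rewrite IHi // => j jk; apply: hA; lia.
- by move=> j jn; rewrite -mulrA -exprS; apply: hA; lia.
congr (_ * _); apply: eq_bigr => s _; congr (_ * _).
by rewrite !mulSn !exprD; ring.
Qed.

(* q-Gauss summation, terminating because x q^N = 1 *)
Lemma bailey_gauss (x : F) N s : (s < N)%N -> x * q ^+ N = 1 ->
  (forall j, (0 < j < 2 * N)%N -> 1 - x ^+ 2 * q ^+ j != 0) ->
  \sum_(i < (N - s.+1).+1) poc q x (s + i).+1 * poc q q (s + i) * x ^+ (s + i)
     * bwt (x ^+ 2 * q) (s + i) s
  = poc q q s * x ^+ s * poc q (x ^+ 2 * q ^+ s.+1) s.+1.
Proof.
move=> sN xN hA; set v := (N - s.+1)%N.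
pose c := x ^+ 2 * q ^+ (2 * s.+1); pose d := x ^+ 2 * q ^+ s.+1.
have cn : poc q c v != 0.
  apply/prodf_neq0 => -[i /= ilt] _; rewrite /c -mulrA -exprD hA //.
  by rewrite /v in ilt; lia.
have dE : x * q ^+ s.+1 * q ^+ v = 1 by rewrite -mulrA -exprD subnKC.
have x_neq0 : x != 0.
  by apply/eqP => x0; move/eqP: xN; rewrite x0 mul0r eq_sym oner_eq0.
have q_neq0 : q != 0.
  apply/eqP => q0; move/eqP: xN; rewrite q0 expr0n.
  by case: N sN {hA v cn dE} => // N _; rewrite mulr0 eq_sym oner_eq0.
transitivity (poc q x s.+1 * poc q q s * x ^+ s / poc q c v
   * poc q d v); last first.
  have -> : poc q (x ^+ 2 * q ^+ s.+1) s.+1 = poc q d s.+1 by [].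
  (* Both sides equal [poc q d (v + s.+1)], because [d * q ^+ v = x] by termination and
     [d * q ^+ s.+1 = c]. *)
  have : poc q d v * poc q x s.+1 = poc q d s.+1 * poc q c v.
    have -> : c = d * q ^+ s.+1.
      by rewrite /c /d -mulrA -exprD; congr (_ * _ ^+ _); lia.
    rewrite -pocD addnC pocD; congr (_ * poc _ _ _).
    by rewrite /d -mulrA -exprD subnKC // expr2 -mulrA xN mulr1.
  move=> E; apply: (mulIf cn); rewrite mulrAC mulfVK // -[RHS]mulrA -E; ring.
rewrite -(q_vandermonde q c d v) big_distrr.
apply: eq_bigr => -[i /= ilt] _.
have ilv : (i <= v)%N by [].
rewrite /bwt addKn gb_quot // -addSn (pocD q x) (pocD q q s) exprD -exprS.
have -> : x ^+ 2 * q * q ^+ (2 * s).+1 = c.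
  by rewrite /c -mulrA -exprS; congr (_ * _ ^+ _); lia.
have E1 : poc q c v = poc q c i * poc q (c * q ^+ i) (v - i).
  by rewrite -pocD subnKC.
move: cn; rewrite E1 mulf_eq0 negb_or => /andP[c1 c2].
have -> : \prod_(j < i) (d - c * q ^+ j) = d ^+ i * poc q (q ^+ s.+1) i.
  have -> : c = d * q ^+ s.+1.
    by rewrite /c /d -mulrA -exprD; congr (_ * _ ^+ _); lia.
  elim: i {ilt ilv E1 c1 c2} => [|i IHi]; first by rewrite big_ord0 poc0 mulr1.
  by rewrite big_ord_recr IHi pocS (exprS d) /=; ring.
(* (q^-v)_i rewritten with positive powers *)
have E2 : poc q q v * (-1) ^+ i * q ^+ 'C(i, 2) * d ^+ i
    = poc q q (v - i) * poc q (x * q ^+ s.+1) i * x ^+ i.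
  elim: i ilv {ilt E1 c1 c2} => [|i IHi] iv.
    by rewrite subn0 bin0n !expr0 poc0 !mulr1.
  rewrite (exprS (-1)) binS bin1 exprD (exprSr d) (pocS q (x * _)) (exprSr x).
  transitivity (poc q q v * (-1) ^+ i * q ^+ 'C(i, 2) * d ^+ i
     * (- q ^+ i * d)); first by ring.
  rewrite IHi; last exact: ltnW.
  have -> : (v - i = (v - i.+1).+1)%N by lia.
  rewrite pocS -exprS -subSn // subSS.
  have -> : - q ^+ i * d = - (x * q ^+ s.+1 * q ^+ i) * x by rewrite /d; ring.
  have : x * q ^+ s.+1 * q ^+ i * q ^+ (v - i) = 1.
    by rewrite -[LHS]mulrA -exprD subnKC // ltnW.
  move: (q ^+ (v - i)) (x * q ^+ s.+1 * q ^+ i) => y z zy.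
  transitivity (poc q q (v - i.+1) * poc q (x * q ^+ s.+1) i * x ^+ i * x
     * (z * y - z)); last by rewrite zy; ring.
  by ring.
have h1 := pocq_neq0 i; have h2 := pocq_neq0 (v - i).
transitivity (poc q x s.+1 * poc q q s * x ^+ s * poc q (q ^+ s.+1) i
  / (poc q c i * poc q q i * poc q q (v - i))
  * (poc q q v * (-1) ^+ i * q ^+ 'C(i, 2) * d ^+ i)).
  by rewrite E2; field; rewrite c1 h1 h2.
by field; rewrite c1 c2 h1 h2.
Qed.

End BaileyChain.

(** * The terminating identity *)

Section FiniteIdentity.
Variable S : comNzRingType.

(** The range n < N is the natural one at x = q^(-N), where [poc q x n.+1] vanishes from n = N
    on. *)
Definition Hsum (q x : S) (m a N : nat) : S :=
  \sum_(n < N) poc q x n.+1 * x ^+ n * kern q (x ^+ 2) a m n.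

Definition Gsum (q x : S) (m b N : nat) : S :=
  \sum_(s < N) (- 1) ^+ s * x ^+ ((2 * m + 1) * s)
     * q ^+ (m * s ^ 2 + (m - b) * s + 'C(s.+1, 2))
     * (1 - x ^+ (2 * b) * q ^+ (b * (2 * s).+1)).

End FiniteIdentity.

(** [kern_above] writes the kernel as a sum over s. Exchanged with the sum over n, it leaves
    [bailey_gauss] inside, whose value together with the numerator (x^2 q)_s cancels the denominator
    (x^2 q)_(2s+1) of [acoef]. *)
Lemma Hsum_field (F : fieldType) (q x : F) m a N :
  (forall i, (0 < i)%N -> 1 - q ^+ i != 0) -> (a < m)%N ->
  x * q ^+ N = 1 -> Hsum q x m a N = Gsum q x m a.+1 N.
Proof.
move=> hq am xN; case: N xN => [|N] xN; first by rewrite /Hsum /Gsum !big_ord0.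
(* Since x^2 q^(2N) = 1, a relation x^2 q^j = 1 would force q^(2N-j) = 1. *)
have hA j : (0 < j < 2 * N.+1)%N -> 1 - x ^+ 2 * q ^+ j != 0.
  move=> jN; have qj : q ^+ (2 * N.+1 - j) != 0.
    rewrite expf_neq0 //; apply/eqP => q0; move/eqP: xN.
    by rewrite q0 expr0n mulr0 eq_sym oner_eq0.
  rewrite subr_eq0 -(inj_eq (mulIf qj)) mul1r -mulrA -exprD subnKC; last by lia.
  rewrite mulnC exprM -exprMn xN expr1n -subr_eq0 -opprB oppr_eq0.
  by apply: hq; lia.
pose g s := (x ^+ 2 * q) ^+ ((m - a.+1) * s) * q ^+ ((m - a.+1) * s ^ 2)
       * acoef q (x ^+ 2) a.+1 s.
pose G n s := poc q x n.+1 * poc q q n * x ^+ n * (g s * bwt q (x ^+ 2 * q) n s).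
transitivity (\sum_(n < N.+1) \sum_(s < n.+1) G n s).
  apply: eq_bigr => -[n /= nN] _.
  rewrite -(subnK am) kern_above //; last by move=> j jn; apply: hA; lia.
  rewrite -big_distrr /= /g; ring.
rewrite sum_triangle; apply: eq_bigr => -[s /= sN] _.
transitivity (g s * \sum_(i < (N.+1 - s.+1).+1) poc q x (s + i).+1 *
   poc q q (s + i) * x ^+ (s + i) * bwt q (x ^+ 2 * q) (s + i) s).
  by rewrite subSS big_distrr /=; apply: eq_bigr => i _; rewrite /G mulrCA.
rewrite bailey_gauss // /g /acoef.
have E : poc q (x ^+ 2 * q) (2 * s).+1
   = poc q (x ^+ 2 * q) s * poc q (x ^+ 2 * q ^+ s.+1) s.+1.
  have -> : ((2 * s).+1 = s + s.+1)%N by lia.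
  by rewrite pocD (exprS q) mulrA.
have : poc q (x ^+ 2 * q) (2 * s).+1 != 0.
  apply/prodf_neq0 => -[i /= ilt] _; rewrite -mulrA -exprS hA //; lia.
rewrite E mulf_eq0 negb_or => /andP[h1 h2].
have h3 := pocq_neq0 hq s.
rewrite ['C(s.+1, 2)]lock.
have -> : x ^+ ((2 * m + 1) * s)
    = x ^+ s * (x ^+ 2) ^+ (a.+1 * s) * (x ^+ 2) ^+ ((m - a.+1) * s).
  by rewrite -!exprM -!exprD; congr (_ ^+ _); nia.
have -> : q ^+ (m * s ^ 2 + (m - a.+1) * s + locked 'C(s.+1, 2))
   = q ^+ (a.+1 * s ^ 2) * q ^+ ((m - a.+1) * s ^ 2) * q ^+ ((m - a.+1) * s)
      * q ^+ (locked 'C(s.+1, 2)).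
  by rewrite -!exprD; congr (_ ^+ _); nia.
rewrite (exprMn_comm _ (mulrC _ _)) (exprM x 2 a.+1).
by field; rewrite h1 h2 h3.
Qed.

(** * Transfer to commutative rings *)

Section Specialisation.
Variables (S T : comNzRingType) (phi : {rmorphism S -> T}).

Lemma rmorph_poc q x n : phi (poc q x n) = poc (phi q) (phi x) n.
Proof.
rewrite /poc rmorph_prod; apply: eq_bigr => i _.
by rewrite rmorphB rmorph1 rmorphM rmorphXn.
Qed.

Lemma rmorph_gb q n k : phi (gb q n k) = gb (phi q) n k.
Proof.
elim: n k => [|n IHn] [|k]; rewrite ?gb0 ?rmorph1 ?rmorph0 //.
by rewrite !gbS rmorphD rmorphM rmorphXn !IHn.
Qed.

Lemma rmorph_kern q A a i n : phi (kern q A a i n) = kern (phi q) (phi A) a i n.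
Proof.
elim: i n => [|i IHi] n; first by rewrite /= rmorph_nat.
rewrite !kernS rmorph_sum; apply: eq_bigr => k _.
by rewrite !rmorphM !rmorphXn rmorph_gb IHi.
Qed.

Lemma rmorph_Hsum q x m a N : phi (Hsum q x m a N) = Hsum (phi q) (phi x) m a N.
Proof.
rewrite /Hsum rmorph_sum; apply: eq_bigr => n _.
by rewrite !rmorphM rmorphXn rmorph_kern rmorph_poc rmorphXn.
Qed.

Lemma rmorph_Gsum q x m b N : phi (Gsum q x m b N) = Gsum (phi q) (phi x) m b N.
Proof.
rewrite /Gsum rmorph_sum; apply: eq_bigr => n _.
by rewrite !(rmorphM, rmorphB, rmorphXn, rmorph1, rmorphN).
Qed.

End Specialisation.

(** The threshold [k] leaves out unusable small integers: q = 0 and q = 1 in one application, J too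
    small for the truncation in another. *)
Lemma poly_eq0_natS (K : numDomainType) (p : {poly K}) k :
  (forall j, (k <= j)%N -> p.[j%:R] = 0) -> p = 0.
Proof.
move=> hp; apply: (@roots_geq_poly_eq0 _ p [seq (k + i)%:R | i <- iota 0 (size p)]).
- by apply/allP => _ /mapP[i _ ->]; rewrite /root hp // leq_addr.
- rewrite map_inj_uniq ?iota_uniq // => i j /eqP.
  by rewrite eqr_nat eqn_add2l => /eqP.
- by rewrite size_map size_iota.
Qed.

Section BivariateEvaluation.
Variables (K S : comNzRingType) (phi : {rmorphism K -> S}) (q x : S).

Let comm_q : commr_rmorph phi q. Proof. by move=> c; apply: mulrC. Qed.
Let eval1 : {rmorphism {poly K} -> S} := horner_morph comm_q.
Let comm_x : commr_rmorph eval1 x. Proof. by move=> c; apply: mulrC. Qed.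
Definition eval2 : {rmorphism {poly {poly K}} -> S} := horner_morph comm_x.

Lemma eval2_x : eval2 'X = x.
Proof. exact: horner_morphX. Qed.

Lemma eval2_q : eval2 ('X)%:P = q.
Proof. by rewrite /eval2 /= horner_morphC /eval1 /= horner_morphX. Qed.

(* q^(N B) D(q^-N, q) as a polynomial in q, B bounding the x-degree of D *)
Lemma eval2_inv (D : {poly {poly K}}) N : x * q ^+ N = 1 ->
  q ^+ (N * size D) * eval2 D
  = (map_poly phi (\sum_(i < size D) D`_i * 'X^(N * (size D - i)))).[q].
Proof.
move=> xq.
have -> : forall p, (map_poly phi p).[q] = eval1 p by [].
have -> : eval2 D = \sum_(i < size D) eval1 D`_i * x ^+ i.
  rewrite -[in LHS](coefK D) poly_def rmorph_sum; apply: eq_bigr => i _.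
  rewrite -mul_polyC rmorphM rmorphXn eval2_x; congr (_ * _).
  by rewrite /eval2 /= horner_morphC.
rewrite rmorph_sum big_distrr; apply: eq_bigr => -[i /= iD] _.
rewrite rmorphM rmorphXn /= [eval1 'X]horner_morphX mulrCA; congr (_ * _).
rewrite -{1}(subnKC (ltnW iD)) mulnDr exprD mulrAC.
by rewrite [X in X * _]mulrC exprM -exprMn xq expr1n mul1r.
Qed.

End BivariateEvaluation.

(** The difference D of the two sides, a polynomial in x and q, vanishes only on x q^N = 1. There
    q^(N size D) D is a polynomial in q alone, with a root at each integer j >= 2 by [Hsum_field],
    hence zero. In [S] the power of q is removed again by multiplying with [x ^+ size D]. *)
Lemma Hsum_ring (K : numFieldType) (S : comNzRingType) (phi : {rmorphism K -> S})
    (q x : S) m a N : (a < m)%N -> x * q ^+ N = 1 ->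
  Hsum q x m a N = Gsum q x m a.+1 N.
Proof.
move=> am xq.
pose D : {poly {poly K}} := Hsum 'X%:P 'X m a N - Gsum 'X%:P 'X m a.+1 N.
have evD (S' : comNzRingType) (psi : {rmorphism K -> S'}) (q' x' : S') :
    eval2 psi q' x' D = Hsum q' x' m a N - Gsum q' x' m a.+1 N.
  by rewrite rmorphB rmorph_Hsum rmorph_Gsum eval2_x eval2_q.
apply/eqP; rewrite -subr_eq0 -(evD S phi); apply/eqP.
have := eval2_inv phi D xq.
have -> : \sum_(i < size D) D`_i * 'X^(N * (size D - i)) = 0 :> {poly K}.
  apply: (@poly_eq0_natS _ _ 2) => j j2.
  have j0 : j%:R != 0 :> K by rewrite pnatr_eq0; lia.
  have xq' : (j%:R ^+ N)^-1 * j%:R ^+ N = 1 :> K by rewrite mulVf ?expf_neq0.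
  have := eval2_inv idfun D xq'; rewrite map_poly_id // => <-.
  rewrite evD Hsum_field ?subrr ?mulr0 // => i i0.
  by rewrite subr_eq0 -natrX -[1]/(1%:R) eqr_nat neq_ltn -{1}(exp1n i) ltn_exp2r // j2.
rewrite map_polyC /= rmorph0 hornerC => /(congr1 (fun z => x ^+ size D * z)).
rewrite mulr0 mulrA exprM -exprMn xq expr1n mul1r.
by [].
Qed.

(** * Formal power series *)

(** A record keeps the Cauchy product apart from the pointwise product of functions. *)
Record pser (K : comNzRingType) := PSer { pcoef :> nat -> K }.

HB.instance Definition _ (K : comNzRingType) := gen_eqMixin (pser K).
HB.instance Definition _ (K : comNzRingType) := gen_choiceMixin (pser K).

Section PowerSeriesRing.
Variable K : comNzRingType.
Implicit Types f g h : pser K.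

Lemma pserP f g : f =1 g -> f = g.
Proof. by case: f g => [f] [g] /= /funext->. Qed.

Let trunc n f : {poly K} := \poly_(i < n.+1) f i.

Definition pser_zero : pser K := PSer (fun _ => 0).
Definition pser_one : pser K := PSer (fun n => (n == 0%N)%:R).
Definition pser_opp f : pser K := PSer (fun n => - f n).
Definition pser_add f g : pser K := PSer (fun n => f n + g n).
Definition pser_mul f g : pser K :=
  PSer (fun n => \sum_(i < n.+1) f i * g (n - i)%N).

(** Coefficients up to n of a product depend only on truncations at n, so the ring laws are
    inherited from [{poly K}]. *)
Let pser_mulE n k f g : (k <= n)%N ->
  pser_mul f g k = (trunc n f * trunc n g)`_k.
Proof.
move=> kn; rewrite coefM; apply: eq_bigr => -[i /= ik] _.
rewrite !coef_poly !ltnS (leq_trans (leq_subr i k) kn).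
by rewrite (leq_trans _ kn).
Qed.

Let truncM n f g k : (k <= n)%N -> (trunc n (pser_mul f g))`_k = (trunc n f * trunc n g)`_k.
Proof. by move=> kn; rewrite coef_poly ltnS kn (pser_mulE _ _ kn). Qed.

Fact pser_addA : associative pser_add.
Proof. by move=> f g h; apply: pserP => n /=; rewrite addrA. Qed.
Fact pser_addC : commutative pser_add.
Proof. by move=> f g; apply: pserP => n /=; rewrite addrC. Qed.
Fact pser_add0 : left_id pser_zero pser_add.
Proof. by move=> f; apply: pserP => n /=; rewrite add0r. Qed.
Fact pser_addN : left_inverse pser_zero pser_opp pser_add.
Proof. by move=> f; apply: pserP => n /=; rewrite addNr. Qed.

HB.instance Definition _ :=
  GRing.isZmodule.Build (pser K) pser_addA pser_addC pser_add0 pser_addN.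

Fact pser_mulC : commutative pser_mul.
Proof.
by move=> f g; apply: pserP => n; rewrite !(@pser_mulE n) // mulrC.
Qed.

Fact pser_mulA : associative pser_mul.
Proof.
move=> f g h; apply: pserP => n; rewrite !(@pser_mulE n) //.
transitivity ((trunc n f * (trunc n g * trunc n h))`_n).
  rewrite !coefM; apply: eq_bigr => -[i /= ik] _; congr (_ * _).
  by rewrite truncM // leq_subr.
rewrite mulrA !coefM; apply: eq_bigr => -[i /= ik] _; congr (_ * _).
by rewrite truncM.
Qed.

Fact pser_mul1 : left_id pser_one pser_mul.
Proof.
move=> f; apply: pserP => n /=; rewrite big_ord_recl /= mul1r subn0.
by rewrite big1 ?addr0 // => i _; rewrite mul0r.
Qed.

Fact pser_mulDl : left_distributive pser_mul pser_add.
Proof.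
move=> f g h; apply: pserP => n /=; rewrite -big_split /=.
by apply: eq_bigr => i _; rewrite mulrDl.
Qed.

Fact pser_one_neq0 : pser_one != 0 :> pser K.
Proof.
apply/eqP => /(congr1 (fun f : pser K => f 0%N)) /eqP.
by rewrite /= oner_eq0.
Qed.

HB.instance Definition _ := GRing.Zmodule_isComNzRing.Build (pser K)
  pser_mulA pser_mulC pser_mul1 pser_mulDl pser_one_neq0.

Lemma pcoefD f g n : (f + g) n = f n + g n. Proof. by []. Qed.
Lemma pcoefN f n : (- f) n = - f n. Proof. by []. Qed.
Lemma pcoefB f g n : (f - g) n = f n - g n. Proof. by []. Qed.
Lemma pcoef1 n : (1 : pser K) n = (n == 0%N)%:R. Proof. by []. Qed.
Lemma pcoefM f g n : (f * g) n = \sum_(i < n.+1) f i * g (n - i)%N.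
Proof. by []. Qed.

Lemma pcoef_sum I (r : seq I) (P : pred I) (F : I -> pser K) n :
  (\sum_(i <- r | P i) F i) n = \sum_(i <- r | P i) F i n.
Proof. by elim/big_rec2: _ => // i x y _ <-. Qed.

Definition pcst (c : K) : pser K := PSer (fun n => c *+ (n == 0%N)).

Lemma pcoef_cstM c f n : (pcst c * f) n = c * f n.
Proof.
rewrite pcoefM big_ord_recl subn0 big1 ?addr0 // => i _.
by rewrite /= mul0r.
Qed.

Fact pcst_is_zmod_morphism : zmod_morphism pcst.
Proof. by move=> c d; apply: pserP => n; rewrite pcoefB /= mulrnBl. Qed.
HB.instance Definition _ :=
  GRing.isZmodMorphism.Build K (pser K) pcst pcst_is_zmod_morphism.

Fact pcst_is_monoid_morphism : monoid_morphism pcst.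
Proof.
split; first by apply: pserP.
by move=> c d; apply: pserP => n; rewrite pcoef_cstM /= mulrnAr.
Qed.
HB.instance Definition _ :=
  GRing.isMonoidMorphism.Build K (pser K) pcst pcst_is_monoid_morphism.

Definition pX : pser K := PSer (fun n => (n == 1%N)%:R).

Lemma pcoef_pXM f n : (pX * f) n.+1 = f n.
Proof.
rewrite pcoefM 2!big_ord_recl /= mul0r add0r mul1r subSS subn0 big1 ?addr0 // => i _.
by rewrite mul0r.
Qed.

(** Order at least k, that is, f = O(t^k). *)
Definition pord k f := forall i, (i < k)%N -> f i = 0.

Lemma pordM k l f g : pord k f -> pord l g -> pord (k + l) (f * g).
Proof.
move=> fk gl n nkl; rewrite pcoefM big1 // => -[i /= ilt] _.
have [ik|ki] := ltnP i k; first by rewrite fk ?mul0r.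
by rewrite gl ?mulr0 //; lia.
Qed.

Lemma pordMr k f g : pord k f -> pord k (f * g).
Proof. by move=> fk; rewrite -[k]addn0; apply: pordM. Qed.

End PowerSeriesRing.

(** * Exponential series and substitution *)

Section ExponentialSeries.
Variable K : numFieldType.
Implicit Types (c d : K) (f : pser K).

Definition pexp c : pser K := PSer (fun n => c ^+ n / n`!%:R).

Lemma natf_neq0 n : n`!%:R != 0 :> K.
Proof. by rewrite pnatr_eq0 -lt0n fact_gt0. Qed.

Lemma bin_fact_inv n i : (i <= n)%N ->
  'C(n, i)%:R / n`!%:R = (i`!%:R * (n - i)`!%:R)^-1 :> K.
Proof.
move=> lin; rewrite -(bin_fact lin) !natrM.
have := natf_neq0 i; have := natf_neq0 (n - i).
have : 'C(n, i)%:R != 0 :> K by rewrite pnatr_eq0 -lt0n bin_gt0.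
by move=> *; field; apply/and3P.
Qed.

Lemma pexpD c d : pexp (c + d) = pexp c * pexp d.
Proof.
apply: pserP => n; rewrite pcoefM /= addrC exprDn big_distrl /=.
apply: eq_bigr => -[i /= ilt] _; rewrite -[X in X / _]mulr_natr -[LHS]mulrA bin_fact_inv //.
by rewrite invfM; ring.
Qed.

Lemma pexp0 : pexp 0 = 1.
Proof.
apply: pserP => -[|n]; first by rewrite /= expr0 divr1.
by rewrite /= expr0n mul0r.
Qed.

Lemma pexpX c n : pexp c ^+ n = pexp (c * n%:R).
Proof.
elim: n => [|n IHn]; first by rewrite mulr0 pexp0.
by rewrite exprS IHn -pexpD -natr1; congr pexp; ring.
Qed.

Lemma pord_1B_pexp c : pord 1 (1 - pexp c).
Proof. by move=> [|//] _; rewrite pcoefB pcoef1 /= expr0 divr1 subrr. Qed.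

Lemma fps_powE f j : fps_pow f j =1 f ^+ j.
Proof.
elim: j => [|j IHj] n; first by rewrite expr0.
rewrite exprS pcoefM; apply: eq_bigr => i _; congr (_ * _); exact: IHj.
Qed.

Lemma fps_substE (p : {poly K}) f : fps_subst p f =1 (map_poly (@pcst K) p).[f].
Proof.
move=> n; rewrite (@horner_coef_wide _ (size p)) ?size_poly // pcoef_sum.
by apply: eq_bigr => j _; rewrite coef_map pcoef_cstM fps_powE.
Qed.

End ExponentialSeries.

(** * Series with coefficients polynomial in a parameter *)

Section PolynomialFamilies.
Variable K : numFieldType.
Implicit Types F G : K -> pser K.

(** The degree in y may grow with n: only one coefficient at a time is ever extended from integers J
    to all y. *)
Definition polyfam F := forall n, exists p : {poly K}, forall y, F y n = p.[y].

Lemma polyfam_cst f : polyfam (fun _ => f).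
Proof. by move=> n; exists (f n)%:P => y; rewrite hornerC. Qed.

Lemma polyfamD F G : polyfam F -> polyfam G -> polyfam (fun y => F y + G y).
Proof.
move=> hF hG n; have [p hp] := hF n; have [r hr] := hG n.
by exists (p + r) => y; rewrite pcoefD hp hr hornerD.
Qed.

Lemma polyfamN F : polyfam F -> polyfam (fun y => - F y).
Proof.
by move=> hF n; have [p hp] := hF n; exists (- p) => y; rewrite pcoefN hp hornerN.
Qed.

Lemma polyfamM F G : polyfam F -> polyfam G -> polyfam (fun y => F y * G y).
Proof.
move=> hF hG n; have [p hp] := choice hF; have [r hr] := choice hG.
exists (\sum_(i < n.+1) p i * r (n - i)%N) => y.
rewrite pcoefM horner_sum; apply: eq_bigr => i _.
by rewrite hornerM hp hr.
Qed.

Lemma polyfamX F n : polyfam F -> polyfam (fun y => F y ^+ n).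
Proof.
move=> hF; elim: n => [|n IHn]; first exact: polyfam_cst.
by under eq_fun do rewrite exprS; apply: polyfamM.
Qed.

Lemma polyfam_sum I (r : seq I) (P : pred I) (F : I -> K -> pser K) :
  (forall i, polyfam (F i)) -> polyfam (fun y => \sum_(i <- r | P i) F i y).
Proof.
move=> hF; elim: r => [|i r IHr].
  by under eq_fun do rewrite big_nil; apply: polyfam_cst.
under eq_fun do rewrite big_cons; case: (P i) => //.
exact: polyfamD.
Qed.

Lemma polyfam_pexp (p : {poly K}) : polyfam (fun y => pexp p.[y]).
Proof.
by move=> n; exists (p ^+ n * (n`!%:R^-1)%:P) => y; rewrite /= hornerM hornerC horner_exp.
Qed.

Lemma polyfam_poc q F n : polyfam F -> polyfam (fun y => poc q (F y) n).
Proof.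
move=> hF; elim: n => [|n IHn].
  by under eq_fun do rewrite poc0; apply: polyfam_cst.
under eq_fun do rewrite pocS; apply: polyfamM => //; apply: polyfamD.
  exact: polyfam_cst.
by apply: polyfamN; apply: polyfamM => //; apply: polyfam_cst.
Qed.

Lemma polyfam_kern q F a i n : polyfam F -> polyfam (fun y => kern q (F y) a i n).
Proof.
move=> hF; elim: i n => [|i IHi] n; first exact: polyfam_cst.
under eq_fun do rewrite kernS; apply: polyfam_sum => k.
by do !apply: polyfamM => //; [exact: polyfam_cst|exact: polyfamX|exact: polyfam_cst].
Qed.

Lemma polyfam_eq F G n k : polyfam F -> polyfam G ->
  (forall j, (k <= j)%N -> F j%:R n = G j%:R n) -> forall y, F y n = G y n.
Proof.
move=> hF hG FG y; have [p hp] := hF n; have [r hr] := hG n.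
suff /eqP : p - r = 0 by rewrite subr_eq0 hp hr => /eqP->.
apply: (@poly_eq0_natS _ _ k) => j kj.
by rewrite hornerD hornerN -hp -hr FG // subrr.
Qed.

End PolynomialFamilies.

(** * Bernoulli polynomials and power sums *)

Section BernoulliPolynomials.
Variable K : numFieldType.
Local Notation B := (bernoulli K).
Local Notation Bp n z := (bernoulli_poly K n).[z].

Lemma size_bernoulli_seq n : size (bernoulli_seq K n) = n.
Proof. by elim: n => //= n IHn; rewrite size_rcons IHn. Qed.

Lemma nth_bernoulli_seq n k : (k < n)%N -> (bernoulli_seq K n)`_k = B k.
Proof.
elim: n => // n IHn; rewrite ltnS leq_eqVlt => /predU1P[->//|kn].
by rewrite /= nth_rcons size_bernoulli_seq kn IHn.
Qed.

Lemma bernoulli_rec n :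
  \sum_(k < n.+1) 'C(n.+1, k)%:R * B k = (n == 0%N)%:R.
Proof.
rewrite big_ord_recr /= {2}/bernoulli /= nth_rcons size_bernoulli_seq ltnn eqxx.
under [in X in _ + X]eq_bigr => k _ do rewrite nth_bernoulli_seq //.
have -> : 'C(n.+1, n) = n.+1 by rewrite binSn.
have n1 : n.+1%:R != 0 :> K by rewrite pnatr_eq0.
rewrite mulrBr mulVKf // addrC subrK.
by case: n {n1} => [|n]; rewrite ?mulr1 ?mulr0.
Qed.

Lemma pexpB1_0 (c : K) : (pexp c - 1) 0%N = 0.
Proof. by rewrite pcoefB pcoef1 /pexp /= expr0 divr1 subrr. Qed.

Lemma pexpB1_S (c : K) n : (pexp c - 1) n.+1 = c ^+ n.+1 / n.+1`!%:R.
Proof. by rewrite pcoefB pcoef1 /= subr0. Qed.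

Definition pB : pser K := PSer (fun n => B n / n`!%:R).

(** The recursion of the Bernoulli numbers, read as B(t) (e^t - 1) = t. The difference and addition
    formulas below are coefficients of B(t) e^(zt). *)
Lemma pB_pexp1 : pB * (pexp 1 - 1) = pX K.
Proof.
apply: pserP => -[|n].
  by rewrite pcoefM big_ord1 pexpB1_0 mulr0.
transitivity (\sum_(i < n.+1) pB i * (pexp 1 - 1) (n.+1 - i)%N
   + pB n.+1 * (pexp 1 - 1) (n.+1 - n.+1)%N); first by rewrite pcoefM big_ord_recr.
rewrite subnn pexpB1_0 mulr0 addr0.
transitivity (\sum_(i < n.+1) 'C(n.+1, i)%:R * B i / n.+1`!%:R).
  apply: eq_bigr => -[i ilt] _; rewrite [nat_of_ord _]/=.
  rewrite subSn // pexpB1_S -subSn // expr1n [RHS]mulrAC bin_fact_inv ?(ltnW ilt) //.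
  by rewrite /pB /= invfM mul1r; ring.
rewrite -big_distrl /= bernoulli_rec.
by case: n => [|n]; rewrite ?fact0 /= ?divr1 // mul0r.
Qed.

Lemma bernoulli_polyE n z : Bp n z / n`!%:R = (pB * pexp z) n.
Proof.
rewrite pcoefM /bernoulli_poly horner_sum big_distrl; apply: eq_bigr => -[i /= ilt] _.
rewrite hornerZ hornerXn -mulrA -[_ * _ * (_ / _)]mulrA mulrC -mulrA mulrACA.
have := @bin_fact_inv K n i ilt; rewrite invfM => E.
transitivity ('C(n, i)%:R / n`!%:R * B i * z ^+ (n - i)); first by ring.
by rewrite E; ring.
Qed.

Lemma bernoulli_poly_diff n z : Bp n.+1 (z + 1) - Bp n.+1 z = n.+1%:R * z ^+ n.
Proof.
have h := natf_neq0 K n.+1.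
apply: (mulIf (invr_neq0 h)); rewrite mulrBl !bernoulli_polyE -pcoefB.
have -> : pB * pexp (z + 1) - pB * pexp z = pX K * pexp z.
  by rewrite pexpD -pB_pexp1; ring.
rewrite pcoef_pXM /= factS natrM invfM.
have n1 : n.+1%:R != 0 :> K by rewrite pnatr_eq0.
have h' := natf_neq0 K n.
by field; rewrite h' addrC natr1.
Qed.

Lemma bernoulli_poly_add n z y :
  Bp n (z + y) = \sum_(j < n.+1) 'C(n, j)%:R * Bp (n - j) z * y ^+ j.
Proof.
have h := natf_neq0 K n.
apply: (mulIf (invr_neq0 h)); rewrite bernoulli_polyE pexpD mulrA mulrC pcoefM.
rewrite big_distrl; apply: eq_bigr => -[j jlt] _.
rewrite [nat_of_ord _]/= -bernoulli_polyE [pcoef (pexp y) j]/= [RHS]/=.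
have := @bin_fact_inv K n j jlt; rewrite invfM => E.
transitivity ('C(n, j)%:R / n`!%:R * Bp (n - j) z * y ^+ j); last by ring.
by rewrite E; ring.
Qed.

(** Expanded in powers of J, so that the common factor J is visible; it is cancelled before J is
    made a variable. *)
Lemma sum_powers n z J : \sum_(j < J) (z + j%:R) ^+ n
  = n.+1%:R^-1 * \sum_(j < n.+1) 'C(n.+1, j.+1)%:R * Bp (n - j) z * J%:R ^+ j.+1.
Proof.
have n1 : n.+1%:R != 0 :> K by rewrite pnatr_eq0.
have -> : \sum_(j < n.+1) 'C(n.+1, j.+1)%:R * Bp (n - j) z * J%:R ^+ j.+1
   = Bp n.+1 (z + J%:R) - Bp n.+1 z.
  rewrite bernoulli_poly_add [in RHS]big_ord_recl bin0 subn0 expr0 mul1r mulr1 /=.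
  rewrite addrAC subrr add0r.
  by apply: eq_bigr => j _; rewrite /= /bump /= add1n subSS.
elim: J => [|J IHJ]; first by rewrite big_ord0 addr0 subrr mulr0.
rewrite big_ord_recr IHJ /= -[J.+1%:R]natr1 addrA.
have := bernoulli_poly_diff n (z + J%:R).
move=> /(canRL (subrK _)) ->.
by field.
Qed.

End BernoulliPolynomials.

(** * The character as four signed residues *)

Section Character.
Variables (K : numFieldType) (m a : nat).
Hypothesis am : (a < m)%N.

(** The sum of [g] over one period weighted by [chi]; defined in any Z-module, it serves for
    numbers, polynomials and series alike. *)
Definition four_sum (V : zmodType) (g : nat -> V) : V :=
  g (2 * m - 2 * a - 1)%N - g (2 * m + 2 * a + 3)%N
  - g (6 * m - 2 * a + 1)%N + g (6 * m + 2 * a + 5)%N.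

Lemma chiE r : (0 < r < (8 * m + 4).+1)%N ->
  chi K m a r = four_sum (fun k => (r == k)%:R).
Proof.
move=> rf; rewrite /chi /four_sum.
have E k : (0 < k < 8 * m + 4)%N -> (r == k %[mod 8 * m + 4])%N = (r == k).
  move=> kf; rewrite (modn_small (m := k)); last by lia.
  (* The full period is the only index of the range that is not its own residue. *)
  have [->|] := eqVneq r (8 * m + 4)%N; first by rewrite modnn; lia.
  by move=> rne; rewrite modn_small //; lia.
rewrite !E; [|lia..].
do 4![case: eqP => ? //=; first by
  repeat (case: eqP => ? //=; try lia); rewrite ?subr0 ?sub0r ?add0r ?addr0].
by rewrite !subr0 addr0.
Qed.

Lemma chi_sum (g : nat -> K) :
  \sum_(1 <= r < (8 * m + 4).+1) chi K m a r * g r = four_sum g.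
Proof.
have E k : (0 < k < (8 * m + 4).+1)%N ->
   \sum_(1 <= r < (8 * m + 4).+1) (r == k)%:R * g r = g k.
  move=> kf; rewrite -[RHS](_ : (if (0 < k < (8 * m + 4).+1)%N then g k else 0) = _);
    last by rewrite kf.
  rewrite -(big_nat1_eq +%R g) [RHS]big_mkcond; apply: eq_bigr => r _.
  by case: eqP; rewrite ?mul1r ?mul0r.
rewrite big_nat; under eq_bigr => r rf do rewrite chiE //.
rewrite -big_nat /four_sum; under eq_bigr do rewrite mulrDl !mulrBl.
rewrite !big_split /= !sumrN !E //; lia.
Qed.

Lemma four_sumE (V : zmodType) (g h : nat -> V) : g =1 h -> four_sum g = four_sum h.
Proof. by move=> gh; rewrite /four_sum !gh. Qed.

End Character.

Lemma sum_ord_double (V : nmodType) (g : nat -> V) J :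
  \sum_(s < 2 * J) g s = \sum_(j < J) (g (2 * j)%N + g (2 * j).+1).
Proof.
elim: J => [|J IHJ]; first by rewrite muln0 !big_ord0.
by rewrite mulnS !big_ord_recr /= IHJ addrA.
Qed.

(** * Interpolation in y and evaluation at y = 0 *)

Section FormalSide.
Variables (K : numFieldType) (m a : nat).
Hypothesis am : (a < m)%N.
Local Notation C := ((8 * (2 * m + 1))%N%:R : K).
Local Notation f := ((8 * m + 4)%N%:R : K).
Local Notation c := ((2 * m - 2 * a - 1)%N%:R : K).
Local Notation Bp n z := (bernoulli_poly K n).[z].
Local Notation q := (pexp (- 1 : K)).

Let C_neq0 : C != 0. Proof. by rewrite pnatr_eq0; lia. Qed.
Let f_neq0 : f != 0. Proof. by rewrite pnatr_eq0; lia. Qed.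

Definition gauss (z : K) : pser K := pexp (- z ^+ 2 / C).

(** Completing the square: with M = 2m + 1, b = a + 1 and u_s = (2s + 1) M, the exponents of [Gsum]
    are ((fJ - c)^2 - (fJ - u_s + 2b)^2) / C and the same with -2b. *)
Lemma Gsum_pexp J :
  Gsum q (pexp (2 * J)%N%:R) m a.+1 (2 * J)
  = pexp ((f * J%:R - c) ^+ 2 / C)
    * \sum_(j < J) four_sum m a (fun r => gauss (r%:R + f * j%:R)).
Proof.
pose N := (2 * J)%N; pose b : K := a.+1%:R; pose M : K := (2 * m + 1)%:R.
pose u s : K := (2 * s + 1)%:R * M.
pose g s := gauss (u s - 2 * b) - gauss (u s + 2 * b).
have mE : m%:R = (m - a.+1)%:R + b :> K by rewrite -natrD subnK.
have cE : c = M - 2 * b.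
  apply/eqP; rewrite eq_sym subr_eq -natrM -natrD eqr_nat; apply/eqP; lia.
have CE : C = 8 * M by rewrite natrM.
have ME : M = 2 * m%:R + 1 by rewrite /M natrD natrM.
have M0 : M != 0 by rewrite pnatr_eq0; lia.
have fE : f = 4 * M by rewrite -natrM; congr _%:R; lia.
transitivity (\sum_(s < N) (- 1) ^+ s * (pexp ((f * J%:R - c) ^+ 2 / C)
    * (gauss (f * J%:R - u s + 2 * b) - gauss (f * J%:R - u s - 2 * b)))).
  apply: eq_bigr => -[s sN] _; rewrite [nat_of_ord _]/= -!mulrA; congr (_ * _).
  rewrite !pexpX mulrA -!pexpD mulrBr mulr1 -pexpD [RHS]mulrBr /gauss -!pexpD.
  have sE : 'C(s.+1, 2)%:R = s%:R * (s%:R + 1) / 2 :> K.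
    apply: (@mulIf _ 2); first by rewrite pnatr_eq0.
    rewrite divfK ?pnatr_eq0 // -natrM natr1 -natrM; congr _%:R.
    elim: s {sN} => // s IHs; rewrite binS bin1 mulnDl IHs; lia.
  move: 'C(s.+1, 2) sE => t tE.
  have E2 : (m * s ^ 2 + (m - a.+1) * s + t)%:R
     = m%:R * s%:R ^+ 2 + (m - a.+1)%:R * s%:R + s%:R * (s%:R + 1) / 2 :> K.
    by rewrite 2!natrD 2!natrM natrX tE.
  have E1 : ((2 * m + 1) * s)%:R = M * s%:R :> K by rewrite natrM.
  have E3 : (a.+1 * (2 * s).+1)%:R = b * (2 * s%:R + 1) :> K.
    by rewrite natrM -[(2 * s).+1%:R]natr1 natrM.
  have E4 : u s = (2 * s%:R + 1) * M by rewrite /u natrD natrM.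
  congr (pexp _ - pexp _).
  - rewrite E1 E2 E4 CE cE fE (natrM _ 2 J).
    have -> : (m - a.+1)%:R = (M - 1) / 2 - b by rewrite ME mE; field.
    have -> : m%:R = (M - 1) / 2 by rewrite ME; field.
    by field.
  - rewrite E1 E2 E3 E4 CE cE fE (natrM _ 2 J) (natrM _ 2 a.+1) -/b.
    have -> : (m - a.+1)%:R = (M - 1) / 2 - b by rewrite ME mE; field.
    have -> : m%:R = (M - 1) / 2 by rewrite ME; field.
    by field.
(* Reversing s sends fJ - u_s to u_s and, the length 2J being even, changes the sign. *)
rewrite (reindex_inj rev_ord_inj) /=.
transitivity (\sum_(s < N) pexp ((f * J%:R - c) ^+ 2 / C) * ((- 1) ^+ s * g s)).
  apply: eq_bigr => -[s /= sN] _.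
  have -> : f * J%:R - u (N - s.+1)%N = u s.
    apply/eqP; rewrite subr_eq fE /u -mulrDl mulrAC -natrM -natrD; apply/eqP.
    by congr (_%:R * M); rewrite /N in sN *; lia.
  have -> : (- 1) ^+ (N - s.+1) = - (- 1) ^+ s :> pser K.
    rewrite -signr_odd oddB // /N oddM /= -[in RHS]signr_odd.
    by case: (odd s); rewrite ?expr0 ?expr1 ?opprK.
  by rewrite /g; ring.
rewrite -big_distrr /=; congr (_ * _).
(* The terms 2j and 2j + 1 have u_s = fj + M and fj + 3M; shifting these by -2b and 2b gives the
   four residues. *)
rewrite (sum_ord_double (fun s => (- 1) ^+ s * g s)); apply: eq_bigr => j _.
rewrite exprS -signr_odd oddM /= expr0 !mulr1 mulN1r mul1r /g /four_sum.
rewrite opprB addrA -[in RHS]addrA [X in _ = _ + X]addrC [RHS]addrA.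
have E (r : nat) (z : K) : r%:R + f * j%:R = z -> gauss (r%:R + f * j%:R) = gauss z.
  by move=> ->.
rewrite [gauss (c + _)](E _ (u (2 * j)%N - 2 * b)); last first.
  by rewrite cE fE /u (natrD _ (2 * (2 * j))) 2!natrM; ring.
rewrite [gauss ((2 * m + 2 * a + 3)%:R + _)](E _ (u (2 * j)%N + 2 * b)); last first.
  rewrite fE /u; apply/eqP.
  rewrite -!natrM -!natrD eqr_nat; apply/eqP; rewrite -?[a.+1]addn1; nia.
rewrite [gauss ((6 * m - 2 * a + 1)%:R + _)](E _ (u (2 * j).+1 - 2 * b)); last first.
  rewrite fE /u; apply/eqP; rewrite eq_sym subr_eq.
  rewrite -!natrM -!natrD eqr_nat; apply/eqP; rewrite -?[a.+1]addn1; nia.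
rewrite [gauss ((6 * m + 2 * a + 5)%:R + _)](E _ (u (2 * j).+1 + 2 * b)); last first.
  rewrite fE /u; apply/eqP.
  rewrite -!natrM -!natrD eqr_nat; apply/eqP; rewrite -?[a.+1]addn1; nia.
by ring.
Qed.

Lemma pcoef_four_sum (G : nat -> pser K) k :
  (four_sum m a G) k = four_sum m a (fun r => G r k).
Proof. by []. Qed.

(** The Bernoulli formula for the sum in [sum_four_powers], divided by J. Its value at 0 is the
    linear coefficient in J of that sum. *)
Definition Qpoly k : {poly K} := four_sum m a (fun r => \sum_(j < (2 * k).+1)
  (f ^+ (2 * k) / (2 * k).+1%:R * ('C((2 * k).+1, j.+1)%:R * Bp (2 * k - j) (r%:R / f)))
    *: 'X^j).

Lemma horner_four_sum (p : nat -> {poly K}) y :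
  (four_sum m a p).[y] = four_sum m a (fun r => (p r).[y]).
Proof. by rewrite /four_sum !(hornerD, hornerN). Qed.

Lemma sum_four_sum (V : zmodType) (g : nat -> nat -> V) J :
  \sum_(j < J) four_sum m a (g j) = four_sum m a (fun r => \sum_(j < J) g j r).
Proof. by rewrite /four_sum !big_split /= !sumrN. Qed.

Lemma mulr_four_sum (V : nzRingType) z (g : nat -> V) :
  z * four_sum m a g = four_sum m a (fun r => z * g r).
Proof. by rewrite /four_sum !(mulrDr, mulrN). Qed.

Lemma sum_four_powers J k :
  \sum_(j < J) four_sum m a (fun r => (r%:R + f * j%:R) ^+ (2 * k))
  = J%:R * (Qpoly k).[J%:R].
Proof.
rewrite (sum_four_sum (fun j r => (r%:R + f * j%:R) ^+ (2 * k))).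
rewrite horner_four_sum mulr_four_sum; apply: four_sumE => r.
transitivity (f ^+ (2 * k) * \sum_(j < J) (r%:R / f + j%:R) ^+ (2 * k)).
  rewrite big_distrr /=; apply: eq_bigr => j _; rewrite -exprMn; congr (_ ^+ _).
  by field.
rewrite sum_powers horner_sum !big_distrr; apply: eq_bigr => j _.
by rewrite hornerZ hornerXn exprS /=; ring.
Qed.

Lemma Qpoly0 k :
  (Qpoly k).[0] = f ^+ (2 * k) * four_sum m a (fun r => Bp (2 * k) (r%:R / f)).
Proof.
rewrite horner_four_sum mulr_four_sum; apply: four_sumE => r.
rewrite horner_sum big_ord_recl big1 ?addr0; last first.
  by move=> j _; rewrite hornerZ hornerXn expr0n mulr0.
rewrite hornerZ hornerXn expr0 mulr1 subn0 bin1.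
have k1 : (2 * k).+1%:R != 0 :> K by rewrite pnatr_eq0.
by rewrite mulrA divfK.
Qed.

Definition Qser (y : K) : pser K :=
  PSer (fun k => (- 1 / C) ^+ k / k`!%:R * (Qpoly k).[y]).

Lemma gauss_sum J :
  \sum_(j < J) four_sum m a (fun r => gauss (r%:R + f * j%:R))
  = pcst J%:R * Qser J%:R.
Proof.
apply: pserP => k; rewrite pcoef_sum pcoef_cstM [pcoef (Qser _) k]/=.
rewrite mulrCA -sum_four_powers big_distrr; apply: eq_bigr => j _.
rewrite [RHS]/= mulr_four_sum pcoef_four_sum; apply: four_sumE => r.
rewrite /gauss /= exprM [RHS]mulrAC -exprMn; congr (_ ^+ _ / _).
by ring.
Qed.

(** [Hsum] without its factor 1 - x, cut at a length [B] that does not depend on y. *)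
Definition Zsum (B : nat) (y : K) : pser K :=
  \sum_(n < B) poc q (pexp (2 * y) * q) n * pexp (2 * y) ^+ n
     * kern q (pexp (2 * y) ^+ 2) a m n.

(** The series (e^(2yt) - 1) / (2yt), equal to 1 at y = 0. *)
Definition Eser (y : K) : pser K := PSer (fun n => (2 * y) ^+ n / n.+1`!%:R).

Lemma pexp1B y : 1 - pexp (2 * y) = pcst (- 2 * y) * (pX K * Eser y).
Proof.
apply: pserP => -[|n].
  rewrite pord_1B_pexp // pcoef_cstM pcoefM big_ord1.
  by rewrite mul0r mulr0.
rewrite pcoef_cstM pcoef_pXM pcoefB pcoef1 /= sub0r exprS.
by rewrite !mulNr !mulrA.
Qed.

Lemma Hsum_Zsum B y : Hsum q (pexp (2 * y)) m a B = (1 - pexp (2 * y)) * Zsum B y.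
Proof.
rewrite /Hsum /Zsum big_distrr; apply: eq_bigr => n _.
by rewrite pocSl /= !mulrA.
Qed.

Lemma pord_poc z n : pord n (poc q (pexp z) n).
Proof.
elim: n => [|n IHn]; first by [].
rewrite pocS -addn1; apply: pordM => //; rewrite pexpX -pexpD.
exact: pord_1B_pexp.
Qed.

(** The n-th term is O(t^n): each of the n factors 1 - e^(ct) of (xq)_n lacks a constant term. *)
Lemma Zsum_trunc B B' y : (B <= B')%N -> pord B (Zsum B' y - Zsum B y).
Proof.
move=> BB'; rewrite /Zsum.
pose F n := poc q (pexp (2 * y) * q) n * pexp (2 * y) ^+ n
     * kern q (pexp (2 * y) ^+ 2) a m n.
rewrite -(big_mkord xpredT F) -[X in _ - X](big_mkord xpredT F).
rewrite (big_cat_nat (leq0n B) BB') /= addrAC subrr add0r => i iB.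
rewrite pcoef_sum big_nat big1 // => n /andP[Bn _].
suff : pord n (F n) by apply; apply: leq_trans iB Bn.
by rewrite /F -mulrA -pexpD; apply/pordMr/pord_poc.
Qed.

Lemma polyfam_X n : polyfam (fun y => pexp (2 * y) ^+ n : pser K).
Proof.
apply: polyfamX; have := polyfam_pexp (2%:P * 'X : {poly K}).
by congr polyfam; apply/funext => y; rewrite !hornerE.
Qed.

Lemma polyfam_Zsum B : polyfam (Zsum B).
Proof.
apply: polyfam_sum => n; apply: polyfamM; last first.
  exact/polyfam_kern/polyfam_X.
apply: polyfamM; last exact: polyfam_X.
by apply/polyfam_poc/polyfamM; [exact: (polyfam_X 1)|exact: polyfam_cst].
Qed.

Lemma polyfam_Eser : polyfam Eser.
Proof.
move=> n; exists ((2%:P * 'X) ^+ n * (n.+1`!%:R^-1)%:P) => y.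
by rewrite /= !hornerE.
Qed.

Lemma polyfam_Qser : polyfam Qser.
Proof.
move=> n; exists (((- 1 / C) ^+ n / n`!%:R)%:P * Qpoly n) => y.
by rewrite /= hornerM hornerC.
Qed.

(** At y = J > D the terminating sum has 2J terms, at least D + 1, so up to the order that matters
    it agrees with the fixed truncation, which is polynomial in y. Both sides are compared after
    division by J; with that factor left in, y = 0 would only say 0 = 0. *)
Lemma Zsum_Qser D y :
  (pcst (- 2) * (pX K * (Eser y * Zsum D.+1 y))) D.+1
  = (pexp ((f * y - c) ^+ 2 / C) * Qser y) D.+1.
Proof.
apply: (@polyfam_eq _ (fun y => pcst (- 2) * (pX K * (Eser y * Zsum D.+1 y)))
  (fun y => pexp ((f * y - c) ^+ 2 / C) * Qser y) D.+1 D.+1).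
- do 2!(apply: polyfamM; first exact: polyfam_cst).
  by apply: polyfamM; [exact: polyfam_Eser|exact: polyfam_Zsum].
- apply: polyfamM; last exact: polyfam_Qser.
  have := polyfam_pexp ((f%:P * 'X - c%:P) ^+ 2 * (C^-1)%:P : {poly K}).
  by congr polyfam; apply/funext => z; rewrite !hornerE.
move=> J DJ.
have J0 : J%:R != 0 :> K by rewrite pnatr_eq0; lia.
apply: (mulfI J0); rewrite -!pcoef_cstM.
have -> : pcst J%:R * (pexp ((f * J%:R - c) ^+ 2 / C) * Qser J%:R)
   = Hsum q (pexp (2 * J%:R)) m a (2 * J).
  rewrite (Hsum_ring (@pcst K) am); last first.
    rewrite pexpX -pexpD -[RHS]pexp0; congr pexp.
    by rewrite natrM; ring.
  by rewrite -(natrM _ 2 J) Gsum_pexp gauss_sum; ring.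
rewrite Hsum_Zsum pexp1B.
have -> : pcst (- 2 * J%:R : K) = pcst (J%:R : K) * pcst (- 2 : K).
  by rewrite mulrC rmorphM.
rewrite -!mulrA !pcoef_cstM; congr (_ * (_ * _)).
rewrite !pcoef_pXM; apply/eqP; rewrite eq_sym -subr_eq0 -pcoefB -mulrBr mulrC.
apply/eqP; suff : pord D.+1 ((Zsum (2 * J) J%:R - Zsum D.+1 J%:R) * Eser J%:R).
  exact.
by apply/pordMr/Zsum_trunc; lia.
Qed.

(** [Zsum_Qser] at y = 0, where x = 1. The factor t on its left shifts the index, which is why
    B_(2n+2) stands at t^n. *)
Lemma kern_series_coef D :
  (\sum_(n < D.+1) poc q q n * kern q 1 a m n) D
  = (pexp (c ^+ 2 / C) * PSer (fun n =>
       (- 1) ^+ n * 2 ^+ (4 * n) * ((2 * m + 1)%N%:R ^+ (2 * n + 1) / n.+1%:R)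
       * four_sum m a (fun r => Bp (2 * n + 2) (r%:R / f)) / n`!%:R / C ^+ n)) D.
Proof.
have := Zsum_Qser D 0; rewrite mulr0 sub0r sqrrN pcoef_cstM pcoef_pXM.
have -> : Eser 0 = 1.
  apply: pserP => -[|n]; first by rewrite /= expr0 divr1.
  by rewrite /= mulr0 expr0n mul0r.
rewrite mul1r.
have -> : Zsum D.+1 0 = \sum_(n < D.+1) poc q q n * kern q 1 a m n.
  by apply: eq_bigr => n _; rewrite mulr0 pexp0 !expr1n mul1r mulr1.
have two0 : - 2 != 0 :> K by rewrite oppr_eq0 pnatr_eq0.
move=> E; apply: (mulfI two0); rewrite E.
transitivity (\sum_(i < D.+1) pexp (c ^+ 2 / C) i * Qser 0 (D - i).+1).
  rewrite pcoefM.
  pose F i := pexp (c ^+ 2 / C) i * Qser 0 (D.+1 - i)%N.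
  transitivity (\sum_(i < D.+1) F i + F D.+1); first by rewrite big_ord_recr.
  rewrite {2}/F subnn [pcoef (Qser 0) _]/= Qpoly0.
  (* [four_sum] kills constants, so [Qser 0] has no constant term and the factor t can be divided
     out. *)
  have -> : four_sum m a (fun r => Bp (2 * 0) (r%:R / f)) = 0.
    have B0 z : Bp 0 z = Bp 0 0 by rewrite /bernoulli_poly big_ord1 !hornerE.
    by rewrite (@four_sumE m a _ _ (fun=> Bp 0 0)) // /four_sum subrr sub0r addNr.
  rewrite !mulr0 addr0; apply: eq_bigr => -[i ilt] _.
  by rewrite /F [nat_of_ord _]/= subSn.
rewrite pcoefM big_distrr; apply: eq_bigr => i _.
rewrite [RHS]mulrCA; congr (_ * _).
set n := (D - i)%N; rewrite [LHS]/= [pcoef (PSer _) _]/=.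
rewrite Qpoly0.
have -> : (2 * n + 2 = 2 * n.+1)%N by lia.
set S := four_sum _ _ _.
pose M : K := (2 * m + 1)%:R; rewrite -/M.
(* From f = 4M and C = 8M; it turns f^(2(n+1)) / C^(n+1) into (2M)^(n+1). *)
have fE : f ^+ 2 = 2 * M * C.
  have -> : f = 4 * M by rewrite -natrM; congr _%:R; lia.
  by rewrite natrM -/M; ring.
have n1 : n.+1%:R != 0 :> K by rewrite pnatr_eq0.
have h := natf_neq0 K n; have Cn : C ^+ n != 0 by rewrite expf_neq0.
rewrite -[_ * 2 ^+ (4 * n) * _]mulrA.
have -> : 2 ^+ (4 * n) * (M ^+ (2 * n + 1) / n.+1%:R) = (2 * M * C) ^+ n * M / n.+1%:R.
  rewrite mulrA exprD mulrA !exprM -exprMn expr1; congr (_ ^+ _ * _ / _).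
  by rewrite natrM -/M; ring.
rewrite (exprM f) fE !(exprSr _ n) [(- 1 / C) ^+ n]exprMn exprVn factS (natrM _ n.+1).
move: (C) C_neq0 Cn (M) => C' C0 Cn' M'.
by field; rewrite C0 Cn' h addrC natr1 n1.
Qed.

End FormalSide.

(** * From the multiple sum to the iterated kernel *)

Lemma qpochE (K : fieldType) n : qpoch 'X n = poc 'X 'X n :> {poly K}.
Proof.
rewrite /qpoch /poc big_add1 /= big_mkord; apply: eq_bigr => i _.
by [].
Qed.

Lemma qpoch_neq0 (K : fieldType) n : qpoch 'X n != 0 :> {poly K}.
Proof.
rewrite qpochE; apply/prodf_neq0 => i _; apply/eqP => /(congr1 (fun p : {poly K} => p.[0])) /eqP.
by rewrite !hornerE ?mul0r ?subr0 oner_eq0.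
Qed.

Lemma qbinomE (K : fieldType) n k : qbinom K n k = gb 'X n k.
Proof.
rewrite /qbinom; case: leqP => kn; last by rewrite gb_gt.
by rewrite qpochE -(gb_fact 'X kn) -!qpochE mulpK // mulf_neq0 ?qpoch_neq0.
Qed.

Section TupleSum.
Variables (K : numFieldType) (a : nat).
Local Notation q := (pexp (- 1 : K)).

(** The part of the summand that links k_j to k_(j+1). At j = 0 it is 1 because k_0 = 0, so products
    may start there. *)
Definition kfactor (kap : nat -> nat) (j : nat) : pser K :=
  gb q (kap j.+1 + (j == a)) (kap j) * q ^+ (kap j ^ 2 + (a < j)%N * kap j).

Lemma subst_Xterm m (k : m.-tuple nat) : (a < m)%N ->
  fps_subst (Xterm K a k) (fps_expX (- 1))
  =1 poc q q (kidx k m) * \prod_(j < m) kfactor (kidx k) j.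
Proof.
move=> am n; rewrite (@fps_substE _ _ q); move: n.
pose ev : {rmorphism {poly K} -> pser K} :=
  horner_morph (fun c => mulrC q (pcst c)).
have -> : (map_poly (@pcst K) (Xterm K a k)).[q] = ev (Xterm K a k) by [].
have evX : ev 'X = q by rewrite /ev /= horner_morphX.
suff -> : ev (Xterm K a k) = poc q q (kidx k m) * \prod_(j < m) kfactor (kidx k) j.
  by [].
rewrite /Xterm !rmorphM qpochE rmorph_poc evX rmorphXn evX -!mulrA; congr (_ * _).
rewrite rmorph_prod qbinomE rmorph_gb evX.
have -> : \prod_(1 <= i < m | i != a) ev (qbinom K (kidx k i.+1) (kidx k i))
   = \prod_(1 <= i < m | i != a) gb q (kidx k i.+1) (kidx k i).
  by apply: eq_bigr => i _; rewrite qbinomE rmorph_gb evX.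
rewrite -(big_mkord xpredT (kfactor (kidx k))) big_split /= [LHS]mulrC [X in X * _ = _]mulrC.
have k0 : kidx k 0 = 0%N by [].
congr (_ * _); last first.
  rewrite prodrXr big_split /=; congr (_ ^+ (_ + _)).
    by rewrite [RHS]big_ltn ?k0 // (leq_ltn_trans _ am).
  have z : (\sum_(0 <= i < a.+1) (a < i) * kidx k i = 0)%N.
    rewrite big_nat big1 // => i /andP[_]; rewrite ltnS leqNgt => /negbTE->.
    by rewrite mul0n.
  rewrite [RHS](big_cat_nat (n := a.+1)) //= z add0n.
  by rewrite [LHS]big_nat [RHS]big_nat; apply: eq_bigr => i /andP[-> _]; rewrite mul1n.
rewrite [RHS](bigD1_seq a) ?mem_index_iota ?iota_uniq //= eqxx addn1; congr (_ * _).
rewrite [RHS]big_ltn_cond; last exact: leq_ltn_trans am.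
rewrite k0 gb0 mul1r if_same; apply: eq_bigr => i /negbTE->.
by rewrite addn0.
Qed.

Lemma kfactor_ext kap kap' j : kap j = kap' j -> kap j.+1 = kap' j.+1 ->
  kfactor kap j = kfactor kap' j.
Proof. by rewrite /kfactor => -> ->. Qed.

Lemma kidx_rcons p (t : p.-tuple nat) n j : (j <= p)%N ->
  kidx (rcons_tuple t n) j = kidx t j.
Proof. by case: j => //= j jp; rewrite /kidx /= nth_rcons size_tuple jp. Qed.

Lemma kidx_rcons_last p (t : p.-tuple nat) n : kidx (rcons_tuple t n) p.+1 = n.
Proof. by rewrite /kidx /= nth_rcons size_tuple ltnn eqxx. Qed.

(** Enumerated by the last entry, because [kern] recurses from k_m downwards. *)
Fixpoint box (B m : nat) : seq (m.-tuple nat) :=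
  if m is m'.+1 then [seq (rcons_tuple k j) | k <- box B m', j <- iota 0 B]
  else [:: [tuple]].

Lemma mem_box B m (k : m.-tuple nat) : (k \in box B m) = all (fun i => i < B)%N k.
Proof.
elim: m k => [|m IHm] k; first by rewrite tuple0 inE eqxx.
have [k' [j kE]] : exists k' : m.-tuple nat, exists j, k = (rcons_tuple k' j).
  case/tupleP: k => x t; exists [tuple of belast x t], (last x t).
  by apply: val_inj; rewrite /= lastI.
rewrite {k}kE /= all_rcons -IHm andbC.
apply/allpairsP/andP => [[[k1 j1] /= [k1B j1B kE]]|[k'B jB]].
  have /rcons_inj[/val_inj-> ->] : rcons k' j = rcons k1 j1 by exact: (congr1 val kE).
  by rewrite k1B; move: j1B; rewrite mem_iota.
by exists (k', j); split; rewrite // mem_iota.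
Qed.

Lemma box_uniq B m : uniq (box B m).
Proof.
elim: m => //= m IHm; apply: allpairs_uniq => //; first exact: iota_uniq.
by move=> [k1 j1] [k2 j2] _ _ /= /(congr1 val) /= /rcons_inj[/val_inj-> ->].
Qed.

Lemma sum_box (V : nmodType) B m (F : m.+1.-tuple nat -> V) :
  \sum_(k <- box B m.+1) F k
  = \sum_(j < B) \sum_(k <- box B m) F (rcons_tuple k j).
Proof.
rewrite [LHS]big_allpairs_dep exchange_big /=.
rewrite -(big_mkord xpredT (fun j => \sum_(k <- box B m) F (rcons_tuple k j))).
by rewrite /index_iota subn0.
Qed.

(** An index exceeds the next one by at most 1, so [n + i] bounds all of them; box tuples outside
    the range of [kern] carry a zero binomial. *)
Lemma kern_box B i n : (n + i < B)%N ->
  kern q 1 a i.+1 n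
  = \sum_(k <- box B i) \prod_(j < i.+1) kfactor (kidx (rcons_tuple k n)) j.
Proof.
elim: i n => [|i IHi] n nB.
  rewrite big_seq1 big_ord1 kernS big_ord_recl big1 ?addr0; last first.
    by move=> k _; rewrite /= mulr0.
  by rewrite /kfactor /kidx /= mulr1 expr1n mul1r !gb0.
rewrite sum_box kernS.
transitivity (\sum_(k < B) gb q (n + (i.+1 == a)) k
   * (1 ^+ k * q ^+ (k ^ 2 + (a < i.+1)%N * k)) * kern q 1 a i.+1 k).
  pose G k := gb q (n + (i.+1 == a)) k
   * (1 ^+ k * q ^+ (k ^ 2 + (a < i.+1)%N * k)) * kern q 1 a i.+1 k.
  have z : \sum_(n.+2 <= k < B) G k = 0.
    rewrite big_nat big1 // => k /andP[nk _].
    by rewrite /G gb_gt ?mul0r //; case: eqP; lia.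
  rewrite -!(big_mkord xpredT G) [RHS](big_cat_nat (n := n.+2)) //=; last by lia.
  by rewrite z addr0.
apply: eq_bigr => -[k kB] _; rewrite [nat_of_ord _]/=.
have [kn|kn] := leqP k n.+1; last first.
  rewrite gb_gt; last by case: eqP; lia.
  rewrite !mul0r big1 // => s _; rewrite big_ord_recr /=.
  rewrite [X in _ * X]/kfactor kidx_rcons_last kidx_rcons // kidx_rcons_last.
  by rewrite gb_gt ?mul0r ?mulr0 //; case: eqP; lia.
rewrite IHi; last by lia.
rewrite big_distrr; apply: eq_bigr => s _; rewrite [RHS]big_ord_recr /= mulrC.
congr (_ * _).
  apply: eq_bigr => -[j /= ji] _; apply: kfactor_ext; rewrite [RHS]kidx_rcons //.
  exact: ltnW.
by rewrite /kfactor kidx_rcons_last kidx_rcons // kidx_rcons_last expr1n mul1r.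
Qed.

(** (q)_(k_m) = O(t^(k_m)) forces k_m <= D, and nonzero binomials force k_j <= k_(j+1) + 1;
    descending from m bounds every entry. This is the finite support behind [X_exp_opp]. *)
Lemma tuple_coef_supp m (k : m.-tuple nat) D : (0 < m)%N ->
  (poc q q (kidx k m) * \prod_(j < m) kfactor (kidx k) j) D != 0 ->
  all (fun i => i < D + m)%N k.
Proof.
move=> m0 kD.
have kmD : (kidx k m <= D)%N.
  rewrite leqNgt; apply/negP => Dk; move/eqP: kD; apply.
  have : pord (kidx k m) (poc q q (kidx k m) * \prod_(j < m) kfactor (kidx k) j).
    by apply: pordMr; apply: pord_poc.
  exact.
have kS j : (j < m)%N -> (kidx k j <= (kidx k j.+1).+1)%N.
  move=> jm; rewrite leqNgt; apply/negP => jk; move/eqP: kD; apply.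
  have -> : \prod_(j < m) kfactor (kidx k) j = 0; last by rewrite mulr0.
  rewrite (bigD1 (Ordinal jm)) //= [X in X * _]/kfactor gb_gt ?mul0r //.
  by case: eqP; lia.
have kB j : (j <= m)%N -> (kidx k (m - j) <= D + j)%N.
  elim: j => [|j IHj] jm; first by rewrite subn0 addn0.
  have := kS (m - j.+1)%N; rewrite -subSn // subSS => H.
  by have := H ltac:(lia); have := IHj (ltnW jm); lia.
apply/allP => x /(nthP 0%N)[j]; rewrite size_tuple => jm <-.
have -> : nth 0%N k j = kidx k (m - (m - j.+1)) by rewrite subKn.
by apply: leq_ltn_trans (kB _ _) _; lia.
Qed.

Lemma X_exp_opp_kern m D : (a < m)%N ->
  X_exp_opp K m a D = (\sum_(n < D.+1) poc q q n * kern q 1 a m n) D.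
Proof.
case: m => // m am; rewrite /X_exp_opp.
rewrite (eq_fsbigr (fun k : m.+1.-tuple nat =>
  (poc q q (kidx k m.+1) * \prod_(j < m.+1) kfactor (kidx k) j) D)); last first.
  by move=> k _; rewrite subst_Xterm.
rewrite (@fsbigE _ _ _ _ _ (box (D + m.+1) m.+1)); first last.
- move=> k _ /=; rewrite mem_box; apply: contraNeq; exact: tuple_coef_supp.
- by [].
- exact: box_uniq.
under eq_bigl do rewrite in_setT.
rewrite sum_box.
pose G n := (poc q q n * \sum_(k <- box (D + m.+1) m)
   \prod_(j < m.+1) kfactor (kidx (rcons_tuple k n)) j) D.
transitivity (\sum_(n < D + m.+1) G n).
  apply: eq_bigr => n _; rewrite /G big_distrr pcoef_sum; apply: eq_bigr => k _ /=.
  by rewrite kidx_rcons_last.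
have z : \sum_(D.+1 <= n < D + m.+1) G n = 0.
  rewrite big_nat big1 // => n /andP[Dn _]; rewrite /G.
  suff : pord n (poc q q n * \sum_(k <- box (D + m.+1) m)
    \prod_(j < m.+1) kfactor (kidx (rcons_tuple k n)) j) by apply.
  by apply: pordMr; apply: pord_poc.
rewrite pcoef_sum -(big_mkord xpredT G) (big_cat_nat (n := D.+1)) //=; last by lia.
rewrite z addr0 big_mkord; apply: eq_bigr => -[n nD] _.
by rewrite /G -kern_box //=; rewrite /=; lia.
Qed.

End TupleSum.

Import numFieldNormedType.Exports.
Local Open Scope complex_scope.

(** * Analytic continuation of the Dirichlet series *)

Section ComplexLimits.
Variable R : realType.
Local Notation C := R[i].
Implicit Types (z w l : C) (u v : nat -> C).

(** A real-valued norm equivalent to the modulus. The norm of R[i] takes values in R[i] with its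
    partial order, whereas bounds on [n1] are real inequalities open to [lra]. *)
Definition n1 z : R := `|complex.Re z| + `|complex.Im z|.

Lemma n1_ge0 z : 0 <= n1 z.
Proof. by rewrite addr_ge0. Qed.

Lemma n1_0 : n1 0 = 0.
Proof. by rewrite /n1 /= normr0 addr0. Qed.

Lemma n1_eq0 z : n1 z = 0 -> z = 0.
Proof.
case: z => a b /eqP; rewrite /n1 /= paddr_eq0 // !normr_eq0.
by move=> /andP[/eqP-> /eqP->].
Qed.

Lemma n1N z : n1 (- z) = n1 z.
Proof. by case: z => a b; rewrite /n1 /= !normrN. Qed.

Lemma n1B z w : n1 (z - w) = n1 (w - z).
Proof. by rewrite -n1N opprB. Qed.

Lemma n1D z w : n1 (z + w) <= n1 z + n1 w.
Proof.
case: z w => [a b] [c d]; rewrite /n1 /=.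
have := ler_normD a c; have := ler_normD b d; lra.
Qed.

Lemma n1_sub z w : n1 (z - w) <= n1 z + n1 w.
Proof. by rewrite -(n1N w); apply: n1D. Qed.

Lemma n1M z w : n1 (z * w) <= n1 z * n1 w.
Proof.
case: z w => [a b] [c d]; rewrite /n1 /= mulrDl !mulrDr -!normrM.
have := ler_normB (a * c) (b * d); have := ler_normD (a * d) (b * c); lra.
Qed.

Lemma n1_real (r : R) : n1 r%:C = `|r|.
Proof. by rewrite /n1 /= normr0 addr0. Qed.

Lemma natC n : n%:R = (n%:R : R)%:C :> C.
Proof. by rewrite rmorph_nat. Qed.

Lemma n1_1 : n1 1 = 1.
Proof. by rewrite -[1]/(1%:C) n1_real normr1. Qed.

Lemma n1X z n : n1 (z ^+ n) <= n1 z ^+ n.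
Proof.
elim: n => [|n IHn]; first by rewrite !expr0 n1_1.
rewrite !exprS; apply: le_trans (n1M _ _) _.
by rewrite ler_wpM2l ?n1_ge0.
Qed.

Lemma n1_sum I (r : seq I) (P : pred I) (F : I -> C) :
  n1 (\sum_(i <- r | P i) F i) <= \sum_(i <- r | P i) n1 (F i).
Proof.
elim/big_rec2: _ => [|i x y _ IH]; first by rewrite n1_0.
by apply: le_trans (n1D _ _) _; rewrite lerD2l.
Qed.

Lemma Re_le_n1 z : `|complex.Re z| <= n1 z.
Proof. by rewrite lerDl. Qed.

Lemma Im_le_n1 z : `|complex.Im z| <= n1 z.
Proof. by rewrite lerDr. Qed.

Lemma norm_lt_n1 z (e : R) : n1 z < e -> `|z| < e%:C.
Proof.
move=> ze; rewrite normc_def ltcR.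
apply: le_lt_trans ze; have e0 := n1_ge0 z.
rewrite -[leRHS]ger0_norm // -sqrtr_sqr ler_wsqrtr // /n1 sqrrD !real_normK ?num_real //.
by rewrite addrAC lerDl mulrn_wge0 // mulr_ge0.
Qed.

Lemma n1_lt_norm z (e : R) : `|z| < e%:C -> n1 z < e + e.
Proof.
move=> ze.
have h1 : `|complex.Re z| < e.
  by rewrite -ltcR; apply: le_lt_trans (normc_ge_Re z) ze.
have h2 : `|complex.Im z| < e.
  rewrite -ltcR; apply: le_lt_trans ze; rewrite normc_def lecR.
  by rewrite -sqrtr_sqr ler_wsqrtr // lerDr sqr_ge0.
by rewrite /n1 ltrD.
Qed.

Definition ctends u l :=
  forall e : R, 0 < e -> exists N, forall n, (N <= n)%N -> n1 (u n - l) < e.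

Lemma ctendsP u l : ctends u l -> ((u : nat -> C^o) @ \oo --> (l : C^o))%classic.
Proof.
move=> ul; apply/cvgrPdist_lt => e; rewrite ltcE /= => /andP[/eqP e0 ep].
have [N hN] := ul _ ep; exists N => // n /= Nn.
have -> : e = (complex.Re e)%:C by case: e e0 {ep hN} => a b /= ->.
by apply: norm_lt_n1; rewrite n1B hN.
Qed.

Lemma ctends_of_cvg u l : ((u : nat -> C^o) @ \oo --> (l : C^o))%classic -> ctends u l.
Proof.
move=> /cvgrPdist_lt ul e e0.
have e20 : 0 < (e / 2)%:C :> C by rewrite ltcR divr_gt0.
have [N _ hN] := ul _ e20; exists N => n Nn.
by rewrite n1B [ltRHS]splitr; apply/n1_lt_norm/hN.
Qed.

Lemma near_n1 z (P : C -> Prop) (d : R) : 0 < d ->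
  (forall w, n1 (w - z) < d -> P w) -> (\forall w \near (z : C^o), P w)%classic.
Proof.
move=> d0 hP; have d20 : 0 < (d / 2)%:C :> C by rewrite ltcR divr_gt0.
apply/nbhs_ballP; exists (d / 2)%:C => //= w zw; apply: hP.
by rewrite n1B [ltRHS]splitr; apply/n1_lt_norm.
Qed.

Lemma n1_near z (P : C -> Prop) : (\forall w \near (z : C^o), P w)%classic ->
  exists2 d : R, 0 < d & forall w, n1 (w - z) < d -> P w.
Proof.
move=> /nbhs_ballP[e /=]; rewrite ltcE /= => /andP[/eqP e0 ep] hP.
exists (complex.Re e) => // w wz; apply: hP; rewrite /ball /=.
have -> : e = (complex.Re e)%:C by case: e e0 {ep wz} => a b /= ->.
by apply: norm_lt_n1; rewrite n1B.
Qed.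

Lemma n1_le_small z : (forall e : R, 0 < e -> n1 z < e) -> z = 0.
Proof.
move=> h; apply: n1_eq0; apply/eqP; rewrite eq_le n1_ge0 andbT leNgt.
by apply/negP => z0; have := h _ z0; rewrite ltxx.
Qed.

Lemma ctends_uniq u l l' : ctends u l -> ctends u l' -> l = l'.
Proof.
move=> ul ul'; apply/eqP; rewrite -subr_eq0; apply/eqP/n1_le_small => e e0.
have e20 : 0 < e / 2 by rewrite divr_gt0.
have [N hN] := ul _ e20; have [N' hN'] := ul' _ e20.
have h1 := hN _ (leq_maxl N N'); have h2 := hN' _ (leq_maxr N N').
have -> : l - l' = (u (maxn N N') - l') - (u (maxn N N') - l) by ring.
by apply: le_lt_trans (n1_sub _ _) _; rewrite [ltRHS]splitr ltrD.
Qed.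

Lemma ctends_cst l : ctends (fun _ => l) l.
Proof. by move=> e e0; exists 0%N => n _; rewrite subrr n1_0. Qed.

Lemma ctendsD u v l l' : ctends u l -> ctends v l' ->
  ctends (fun n => u n + v n) (l + l').
Proof.
move=> ul vl e e0.
have e20 : 0 < e / 2 by rewrite divr_gt0.
have [N hN] := ul _ e20; have [N' hN'] := vl _ e20.
exists (maxn N N') => n; rewrite geq_max => /andP[/hN h1 /hN' h2].
have -> : u n + v n - (l + l') = (u n - l) + (v n - l') by ring.
by apply: le_lt_trans (n1D _ _) _; rewrite [ltRHS]splitr ltrD.
Qed.

Lemma ctendsZ u l c : ctends u l -> ctends (fun n => c * u n) (c * l).
Proof.
move=> ul e e0; have c0 : 0 < n1 c + 1 by rewrite ltr_wpDl ?n1_ge0.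
have [N hN] := ul _ (divr_gt0 e0 c0); exists N => n /hN.
rewrite ltr_pdivlMr // -mulrBr => h; apply: le_lt_trans (n1M _ _) _.
apply: le_lt_trans h; rewrite mulrC ler_wpM2l ?n1_ge0 //.
by rewrite lerDl.
Qed.

Lemma ctendsN u l : ctends u l -> ctends (fun n => - u n) (- l).
Proof.
move=> /(@ctendsZ _ _ (-1)); rewrite mulN1r; congr ctends.
by apply/funext => n; rewrite mulN1r.
Qed.

Lemma ctendsB u v l l' : ctends u l -> ctends v l' ->
  ctends (fun n => u n - v n) (l - l').
Proof. by move=> ul vl; apply: ctendsD ul (ctendsN vl). Qed.

Lemma ctends_sum I (r : seq I) (F : I -> nat -> C) (G : I -> C) :
  (forall i, ctends (F i) (G i)) ->
  ctends (fun n => \sum_(i <- r) F i n) (\sum_(i <- r) G i).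
Proof.
move=> FG; elim: r => [|i r IHr].
  rewrite big_nil; under eq_fun do rewrite big_nil; exact: ctends_cst.
rewrite big_cons; under eq_fun do rewrite big_cons; exact: ctendsD.
Qed.

Lemma ctends_shift u l k : ctends u l -> ctends (fun n => u (n + k)%N) l.
Proof.
move=> ul e e0; have [N hN] := ul _ e0; exists N => n Nn.
by apply: hN; rewrite (leq_trans Nn) ?leq_addr.
Qed.

Lemma ctends_bound u l (B : R) : ctends u l -> (forall n, n1 (u n) <= B) -> n1 l <= B.
Proof.
move=> ul uB; rewrite leNgt; apply/negP => Bl.
have e0 : 0 < n1 l - B by rewrite subr_gt0.
have [N hN] := ul _ e0; have := hN _ (leqnn N); rewrite n1B ltNge => /negP; apply.
have := n1D (l - u N) (u N); rewrite subrK; have := uB N; lra.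
Qed.

Lemma ctends_ext u v l : (forall n, u n = v n) -> ctends u l -> ctends v l.
Proof. by move=> /funext->. Qed.

Lemma ctends_real (u : nat -> C) (a b : nat -> R) (l : C) :
  (forall n, u n = a n +i* b n) ->
  (a @ \oo --> complex.Re l)%classic -> (b @ \oo --> complex.Im l)%classic ->
  ctends u l.
Proof.
move=> uE /cvgrPdist_lt ha /cvgrPdist_lt hb e e0.
have e20 : 0 < e / 2 by rewrite divr_gt0.
have [N _ hN] := ha _ e20; have [N' _ hN'] := hb _ e20.
exists (maxn N N') => n; rewrite geq_max => /andP[/hN h1 /hN' h2].
rewrite n1B uE /n1 [ltRHS]splitr; apply: ltrD.
  by case: l h1 {ha hb hN hN' h2}.
by case: l h2 {ha hb hN hN' h1}.
Qed.

Definition psum_le (B : nat -> R) (T : R) :=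
  (forall n, 0 <= B n) /\ forall N, \sum_(n < N) B n <= T.

Lemma psum_cvg B T : psum_le B T -> cvgn (series B).
Proof.
move=> [B0 BT]; apply: nondecreasing_is_cvgn.
  apply/nondecreasing_seqP => n; rewrite /series /= big_nat_recr //=.
  by rewrite lerDl.
by exists T => _ [N _ <-]; rewrite /series /= big_mkord.
Qed.

Lemma psum_tail B T : psum_le B T -> forall e : R, 0 < e ->
  exists N, forall M, \sum_(N <= n < N + M) B n <= e.
Proof.
move=> BT e e0; have /cvg_ex[l /cvgrPdist_lt hl] := psum_cvg BT.
have e20 : 0 < e / 2 by rewrite divr_gt0.
have [N _ hN] := hl _ e20; exists N => M.
have h1 := hN _ (leqnn N); have h2 := hN _ (leq_addr M N).
have E : series B (N + M)%N = series B N + \sum_(N <= n < N + M) B n.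
  by rewrite /series /= (big_cat_nat (n := N)) ?leq_addr.
move: h1 h2; rewrite E !ltr_norml => /andP[h1 h2] /andP[h3 h4].
by rewrite /=; lra.
Qed.

Lemma abs_conv u B T : psum_le B T -> (forall n, n1 (u n) <= B n) ->
  exists l, ctends (fun N => \sum_(n < N) u n) l.
Proof.
move=> BT uB; have cB := psum_cvg BT.
have cvg_part (g : nat -> R) : (forall n, `|g n| <= B n) -> cvgn (series g).
  move=> gB; apply: normed_cvg; apply: series_le_cvg cB => // n; last exact: BT.1.
  exact: normr_ge0.
have cRe : cvgn (series (fun n => complex.Re (u n))).
  by apply: cvg_part => n; apply: le_trans (Re_le_n1 _) (uB n).
have cIm : cvgn (series (fun n => complex.Im (u n))).
  by apply: cvg_part => n; apply: le_trans (Im_le_n1 _) (uB n).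
exists (limn (series (fun n => complex.Re (u n))) +i*
        limn (series (fun n => complex.Im (u n)))).
apply: (@ctends_real _ (series (fun n => complex.Re (u n)))
  (series (fun n => complex.Im (u n)))); [|exact: cRe|exact: cIm].
move=> N; rewrite /series /= !big_mkord.
elim: N => [|N IHN]; first by rewrite !big_ord0.
by rewrite !big_ord_recr IHN /=; case: (u N).
Qed.

End ComplexLimits.

(** * Exchanging a series with power series *)

Section DoubleSeries.
Variable R : realType.
Local Notation C := R[i].

Lemma geo_half (x : R) N : 0 <= x -> x <= 2^-1 -> \sum_(q < N) x ^+ q <= 2.
Proof.
(* The added 2 x^N pays for the next term, since x <= 1/2. *)
move=> x0 x2; suff : \sum_(q < N) x ^+ q + 2 * x ^+ N <= 2.
  by apply: le_trans; rewrite lerDl mulr_ge0 ?exprn_ge0.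
elim: N => [|N IHN]; first by rewrite big_ord0 add0r expr0 mulr1.
apply: le_trans IHN; rewrite big_ord_recr /= -addrA lerD2l exprS.
have := exprn_ge0 N x0; nra.
Qed.

Lemma power_sum_le (c : nat -> C) (w : C) (B : R) N : (forall q, n1 (c q) <= B) ->
  n1 w <= 2^-1 -> n1 (\sum_(q < N) c q * w ^+ q) <= 2 * B.
Proof.
move=> cB w2; apply: le_trans (n1_sum _ _ _) _.
have B0 : 0 <= B by apply: le_trans (cB 0%N); apply: n1_ge0.
apply: le_trans (_ : \sum_(q < N) B * n1 w ^+ q <= _).
  apply: ler_sum => q _; apply: le_trans (n1M _ _) _.
  by apply: ler_pM; rewrite ?n1_ge0 ?n1X.
by rewrite -big_distrr /= mulrC ler_wpM2r // geo_half // n1_ge0.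
Qed.

(** A majorant [B i] uniform in q, with [n1 w] at most 1/2, controls the tails in i of the
    coefficients and of the values at once. A series of power series is therefore again a power
    series. *)
Lemma sum_power_series (c : nat -> nat -> C) (d : nat -> C) (f : nat -> C) (F w : C) B T :
  psum_le B T -> (forall i q, n1 (c i q) <= B i) -> n1 w <= 2^-1 ->
  (forall i, ctends (fun Q => \sum_(q < Q) c i q * w ^+ q) (f i)) ->
  ctends (fun I => \sum_(i < I) f i) F ->
  (forall q, ctends (fun I => \sum_(i < I) c i q) (d q)) ->
  ctends (fun Q => \sum_(q < Q) d q * w ^+ q) F.
Proof.
move=> BT cB w2 hf hF hd e e0.
(* Error budget: e/4 for the coefficient tails, e/2 for finitely many power series, e/4 for the tail
   of the values. *)
have e80 : 0 < e / 8 by rewrite divr_gt0.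
have e20 : 0 < e / 2 by rewrite divr_gt0.
have [I hI] := psum_tail BT e80.
have fB i : n1 (f i) <= 2 * B i.
  by apply: ctends_bound (hf i) _ => N; apply: power_sum_le.
have tail_le (g : nat -> C) (G : C) (k : R) : 0 <= k -> (forall i, n1 (g i) <= k * B i) ->
    ctends (fun I => \sum_(i < I) g i) G -> n1 (G - \sum_(i < I) g i) <= k * (e / 8).
  move=> k0 gB hG.
  have hG' := ctends_shift I hG.
  have := ctendsB hG' (ctends_cst (\sum_(i < I) g i)).
  move=> /ctends_bound; apply => N.
  have -> : \sum_(i < N + I) g i - \sum_(i < I) g i = \sum_(I <= i < I + N) g i.
    rewrite -!(big_mkord xpredT g) (big_cat_nat (n := I)) ?leq_addl //=.
    by rewrite addrAC subrr add0r addnC.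
  apply: le_trans (n1_sum _ _ _) _; apply: le_trans (_ : k * \sum_(I <= i < I + N) B i <= _).
    by rewrite big_distrr; apply: ler_sum => i _; apply: gB.
  by rewrite ler_wpM2l.
have hdI q : n1 (d q - \sum_(i < I) c i q) <= e / 8.
  by rewrite -[leRHS]mul1r; apply: (tail_le (fun i => c i q)) => // i; rewrite mul1r.
have hFI : n1 (F - \sum_(i < I) f i) <= 2 * (e / 8) by apply: tail_le.
have hfI := @ctends_sum R _ (index_enum 'I_I)
  (fun i Q => \sum_(q < Q) c i q * w ^+ q) (fun i => f i) (fun i => hf i).
have [Q hQ] := hfI _ e20; exists Q => n /hQ hn.
have -> : \sum_(q < n) d q * w ^+ q - F
  = \sum_(q < n) (d q - \sum_(i < I) c i q) * w ^+ q
   + (\sum_(i < I) \sum_(q < n) c i q * w ^+ q - \sum_(i < I) f i)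
   - (F - \sum_(i < I) f i).
  have -> : \sum_(q < n) (d q - \sum_(i < I) c i q) * w ^+ q
     = \sum_(q < n) d q * w ^+ q - \sum_(i < I) \sum_(q < n) c i q * w ^+ q.
    rewrite [X in _ = _ - X]exchange_big -sumrB; apply: eq_bigr => q _.
    by rewrite mulrBl big_distrl.
  by ring.
have h1 := power_sum_le n hdI w2.
apply: le_lt_trans (n1_sub _ _) _; have := n1D (\sum_(q < n) (d q - \sum_(i < I) c i q) * w ^+ q)
  (\sum_(i < I) \sum_(q < n) c i q * w ^+ q - \sum_(i < I) f i).
move: hn h1 hFI; rewrite /=; lra.
Qed.

End DoubleSeries.

(** * The complex exponential as a power series *)

Section ComplexExponential.
Variable R : realType.
Local Notation C := R[i].
Implicit Types z w : C.

Lemma CexpD z w : Cexp (z + w) = Cexp z * Cexp w.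
Proof.
case: z w => [a b] [c d]; rewrite /Cexp /= expRD cosD sinD.
by apply/eqP; rewrite eq_complex /=; apply/andP; split; apply/eqP; ring.
Qed.

Definition esum_ (F : fieldType) (x : F) N : F := \sum_(q < N) x ^+ q / q`!%:R.

Lemma esumD (F : numFieldType) (x y : F) N :
  esum_ x N * esum_ y N - esum_ (x + y) N
  = \sum_(i < N) \sum_(N - i <= j < N) x ^+ i / i`!%:R * (y ^+ j / j`!%:R).
Proof.
case: N => [|N]; first by rewrite /esum_ !big_ord0 mulr0 subrr.
have -> : esum_ (x + y) N.+1
  = \sum_(i < N.+1) \sum_(0 <= j < N.+1 - i) x ^+ i / i`!%:R * (y ^+ j / j`!%:R).
  pose g k r := x ^+ r / r`!%:R * (y ^+ (k - r) / (k - r)`!%:R).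
  transitivity (\sum_(k < N.+1) \sum_(r < k.+1) g k r).
    apply: eq_bigr => k _; rewrite addrC exprDn big_distrl /=.
    apply: eq_bigr => -[r /= rk] _.
    rewrite -[X in X / _]mulr_natr -[LHS]mulrA bin_fact_inv //.
    by rewrite /g invfM; ring.
  rewrite sum_triangle; apply: eq_bigr => -[r /= rN] _.
  rewrite subSn // big_mkord; apply: eq_bigr => i _.
  by rewrite /g addKn.
rewrite /esum_ big_distrl /= -sumrB; apply: eq_bigr => i _.
rewrite big_distrr /=.
rewrite -(big_mkord xpredT (fun j => x ^+ i / i`!%:R * (y ^+ j / j`!%:R))).
rewrite (big_cat_nat (n := N.+1 - i)) ?leq_subr //=.
by rewrite addrAC subrr add0r.
Qed.

Lemma esum_cvg (x : R) : ((esum_ x) @ \oo --> expR x)%classic.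
Proof.
have -> : esum_ x = series (exp_coeff x).
  by apply/funext => N; rewrite /series /= big_mkord.
exact: is_cvg_series_exp_coeff.
Qed.

Lemma n1_fact n : n1 ((n`!%:R : C)^-1) = (n`!%:R)^-1.
Proof.
rewrite natC -fmorphV n1_real ger0_norm // invr_ge0; exact: ler0n.
Qed.

(** The remainder in [esumD] runs over i + j >= N and is bounded termwise by the same remainder at
    the real numbers [n1 z] and [n1 w], which tends to 0 by the real addition formula. *)
Lemma ctends_esumD z w : ctends (esum_ z) (Cexp z) -> ctends (esum_ w) (Cexp w) ->
  ctends (esum_ (z + w)) (Cexp (z + w)).
Proof.
move=> hz hw; rewrite CexpD.
have hM : ctends (fun N => esum_ z N * esum_ w N) (Cexp z * Cexp w).
  have B1 : exists B, forall N, n1 (esum_ w N) <= B.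
    exists (expR (n1 w)) => N; apply: le_trans (n1_sum _ _ _) _.
    apply: le_trans (_ : esum_ (n1 w) N <= _).
      apply: ler_sum => i _; apply: le_trans (n1M _ _) _.
      by rewrite n1_fact ler_wpM2r ?n1X // invr_ge0 ler0n.
    have h := @esum_cvg (n1 w).
    have := cvg_lim _ h => <- //.
    apply: nondecreasing_cvgn_le; last first.
      by apply/cvg_ex; exists (expR (n1 w)).
    apply/nondecreasing_seqP => k; rewrite /esum_ big_ord_recr /= lerDl.
    by rewrite divr_ge0 ?exprn_ge0 ?n1_ge0 ?ler0n.
  have [B hB] := B1.
  move=> e e0.
  have B0 : 0 < B + 1 by apply: ltr_wpDl => //; apply: le_trans (hB 0%N); exact: n1_ge0.
  have e20 : 0 < e / 2 by rewrite divr_gt0.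
  have [N hN] := hz _ (divr_gt0 e20 B0).
  have [N' hN'] := (ctendsZ (Cexp z) hw) _ e20.
  exists (maxn N N') => n; rewrite geq_max => /andP[/hN h1 /hN' h2].
  have -> : esum_ z n * esum_ w n - Cexp z * Cexp w
    = (esum_ z n - Cexp z) * esum_ w n + (Cexp z * esum_ w n - Cexp z * Cexp w) by ring.
  apply: le_lt_trans (n1D _ _) _; rewrite [ltRHS]splitr ltrD //.
  apply: le_lt_trans (n1M _ _) _; move: h1; rewrite ltr_pdivlMr // => h1.
  apply: le_lt_trans h1; rewrite ler_wpM2l ?n1_ge0 //.
  by apply: le_trans (hB n) _; rewrite lerDl.
have hD : ctends (fun N => esum_ z N * esum_ w N - esum_ (z + w) N) 0.
  move=> e e0; pose a := n1 z; pose b := n1 w.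
  have h : ((fun N => esum_ a N * esum_ b N - esum_ (a + b) N)
      @ \oo --> (expR a * expR b - expR (a + b)))%classic.
    by apply: cvgB; [apply: cvgM|]; apply: esum_cvg.
  move: h; rewrite expRD subrr => /cvgrPdist_lt /(_ _ e0)[N _ hN].
  exists N => n /hN; rewrite subr0 sub0r normrN => h.
  apply: le_lt_trans h; apply: le_trans (ler_norm _); rewrite !esumD.
  apply: le_trans (n1_sum _ _ _) _; apply: ler_sum => i _.
  apply: le_trans (n1_sum _ _ _) _; apply: ler_sum => j _.
  apply: le_trans (n1M _ _) _; apply: ler_pM; rewrite ?n1_ge0 //;
    apply: le_trans (n1M _ _) _; rewrite n1_fact ler_wpM2r ?n1X //;
    by rewrite invr_ge0 ler0n.
have := ctendsB hM hD; rewrite subr0; apply: ctends_ext => n.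
by ring.
Qed.

Lemma ctends_esum_real (x : R) : ctends (esum_ x%:C) (Cexp x%:C).
Proof.
apply: (@ctends_real _ _ (esum_ x) (fun=> 0)).
- move=> N; rewrite -[RHS]/((esum_ x N)%:C) /esum_ rmorph_sum.
  by apply: eq_bigr => q _; rewrite rmorphM rmorphXn fmorphV rmorph_nat.
- rewrite /Cexp /= cos0 sin0 mulr1 mulr0 subr0; exact: esum_cvg.
- rewrite /Cexp /= cos0 sin0 mulr0 mul0r addr0; exact: cvg_cst.
Qed.

Lemma ctends_esum_imag (y : R) : ctends (esum_ (0 +i* y)) (Cexp (0 +i* y)).
Proof.
have E q : (0 +i* y) ^+ q / q`!%:R = cos_coeff y q +i* sin_coeff y q.
  have iE : (0 +i* y) ^+ q =
     ((~~ odd q)%:R * (-1) ^+ q./2 * y ^+ q) +i* ((odd q)%:R * (-1) ^+ q.-1./2 * y ^+ q).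
    elim: q => [|q IHq].
      by apply/eqP; rewrite !expr0 !mulr1 eq_complex /= !eqxx.
    rewrite exprS IHq.
    have [oq|eq] := boolP (odd q).
      have -> : q.+1./2 = q./2.+1 by lia.
      have -> : q.-1./2 = q./2 by lia.
      rewrite /= oq /= !mul0r !mul1r.
      by apply/eqP; rewrite eq_complex /= (exprS y) (exprS (-1));
        apply/andP; split; apply/eqP; ring.
    rewrite /= (negbTE eq) /= !mul0r !mul1r.
    by apply/eqP; rewrite eq_complex /= (exprS y); apply/andP; split; apply/eqP; ring.
  rewrite iE natC -fmorphV.
  by apply/eqP; rewrite eq_complex /=; apply/andP; split; apply/eqP;
    rewrite -?exprnP ?mulr0 ?subr0 ?add0r //; ring.
apply: (@ctends_real _ _ (series (cos_coeff y)) (series (sin_coeff y))).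
- move=> N; rewrite /esum_ /series /= !big_mkord.
  elim: N => [|N IHN]; first by rewrite !big_ord0.
  by rewrite !big_ord_recr IHN /= E.
- rewrite /Cexp /= expR0 mul1r mul0r subr0.
  by rewrite cos.unlock; exact: is_cvg_series_cos_coeff.
- rewrite /Cexp /= expR0 mul1r mul0r addr0.
  by rewrite sin.unlock; exact: is_cvg_series_sin_coeff.
Qed.

Lemma ctends_esum z : ctends (esum_ z) (Cexp z).
Proof.
have -> : z = (complex.Re z)%:C + (0 +i* complex.Im z).
  by case: z => a b; apply/eqP; rewrite eq_complex /= addr0 add0r !eqxx.
by apply: ctends_esumD; [exact: ctends_esum_real|exact: ctends_esum_imag].
Qed.

End ComplexExponential.

(** * Complex powers and their iterated differences *)

Section ComplexPowers.
Variable R : realType.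
Local Notation C := R[i].
Implicit Types (s w : C) (x y h : R) (f g : R -> C).

(* x^(-s) *)
Definition pw s x : C := Cexp (- s * (ln x)%:C).

Lemma Cexp_real (r : R) : Cexp r%:C = (expR r)%:C.
Proof.
rewrite /Cexp /= cos0 sin0.
by apply/eqP; rewrite eq_complex /=; apply/andP; split; apply/eqP; ring.
Qed.

Lemma n1_Cexp (z : C) : n1 (Cexp z) <= 2 * expR (complex.Re z).
Proof.
case: z => a b; rewrite /n1 /Cexp /= !mul0r subr0 addr0 !normrM.
have e0 := expR_ge0 a; rewrite (ger0_norm e0).
have : `|cos b| <= 1 by rewrite ler_norml cos_geN1 cos_le1.
have : `|sin b| <= 1 by rewrite ler_norml sin_geN1 sin_le1.
nra.
Qed.

Lemma pwD s w x : pw (s + w) x = pw s x * Cexp (- w * (ln x)%:C).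
Proof. by rewrite /pw -CexpD; congr Cexp; ring. Qed.

Lemma pw1 s x : 0 < x -> pw (s + 1) x = pw s x * (x^-1)%:C.
Proof.
move=> x0; rewrite pwD; congr (_ * _).
have -> : -1 * (ln x)%:C = (- ln x)%:C by rewrite mulN1r rmorphN.
by rewrite Cexp_real expRN lnK.
Qed.

(* the q-th Taylor coefficient of s |-> x^(-s) *)
Definition Kq s q x : C := pw s x * ((- ln x) ^+ q / q`!%:R)%:C.

Lemma Kq_series s w x : ctends (fun Q => \sum_(q < Q) Kq s q x * w ^+ q) (pw (s + w) x).
Proof.
rewrite pwD; have := ctendsZ (pw s x) (@ctends_esum _ (- w * (ln x)%:C)).
apply: ctends_ext => Q; rewrite /esum_ big_distrr; apply: eq_bigr => q _.
rewrite /Kq -mulrA; congr (_ * _).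
rewrite mulNr -mulrN -rmorphN exprMn rmorphM rmorphXn fmorphV rmorph_nat.
by rewrite -[LHS]mulrA mulrC.
Qed.

(** (ln x)^q / q! <= x: giving up one power of x buys a bound independent of q. *)
Lemma Kq_bound s q x : 1 <= x -> n1 (Kq s q x) <= 2 * expR ((1 - complex.Re s) * ln x).
Proof.
move=> x1; have l0 : 0 <= ln x by apply: ln_ge0.
apply: le_trans (n1M _ _) _; rewrite n1_real.
have -> : (1 - complex.Re s) * ln x = - complex.Re s * ln x + ln x by ring.
rewrite expRD mulrA; apply: ler_pM; rewrite ?n1_ge0 //.
  apply: le_trans (n1_Cexp _) _.
  by case: s => a b /=; rewrite mulr0 subr0.
rewrite normrM normrX normrN (ger0_norm l0) ger0_norm ?invr_ge0 ?ler0n //.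
case: q => [|q]; first by rewrite expr0 divr1 -expR0 ler_expR.
by apply: le_trans (expR_ge1Dxn q l0); rewrite lerDr.
Qed.

Lemma ReB (z z' : C) : complex.Re (z - z') = complex.Re z - complex.Re z'.
Proof. by case: z z' => [? ?] [? ?]. Qed.

Lemma ImB (z z' : C) : complex.Im (z - z') = complex.Im z - complex.Im z'.
Proof. by case: z z' => [? ?] [? ?]. Qed.

Definition cder f g := forall x, 0 < x ->
  is_derive x 1 (fun y => complex.Re (f y)) (complex.Re (g x)) /\
  is_derive x 1 (fun y => complex.Im (f y)) (complex.Im (g x)).

(** The derivative of [Kq s q] in x. It stays in the same family with s raised to s + 1, so it
    decays one power faster. *)
Definition Kq' s q x : C :=
  - s * Kq (s + 1) q x - (if q is q'.+1 then Kq (s + 1) q' x else 0).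

Lemma is_derive_cln (c x : R) : 0 < x -> is_derive x 1 (fun y => c * ln y) (c * x^-1).
Proof.
move=> x0; have := is_derive1_ln x0 => H.
exact: (@is_deriveZ R _ _ (@ln R) c x 1 x^-1 H).
Qed.

Lemma is_derive_lnpow (q : nat) x : 0 < x ->
  is_derive x 1 (fun y => (- ln y) ^+ q / q`!%:R)
    (- (if q is q'.+1 then (- ln x) ^+ q' / q'`!%:R else 0) * x^-1).
Proof.
move=> x0; have H : is_derive x 1 (fun y => - ln y) (- x^-1).
  have := is_derive_cln (-1) x0; rewrite mulN1r.
  have -> // : (fun y : R => -1 * ln y) = (fun y => - ln y).
  by apply/funext => y; rewrite mulN1r.
case: q => [|q].
  have := is_derive_cst (1 : R) x 1; rewrite oppr0 mul0r.
  have -> // : (fun y : R => (- ln y) ^+ 0 / 0`!%:R) = cst 1.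
  by apply/funext => y; rewrite expr0 divr1.
have HX : is_derive x 1 (fun y => (- ln y) ^+ q.+1)
    (q.+1%:R * (- ln x) ^+ q * (- x^-1)).
  have := @is_deriveX R _ (fun y => - ln y) q.+1 x 1 (- x^-1) H.
  by rewrite exprfctE.
have := @is_deriveZ R _ _ _ (q.+1`!%:R^-1) x 1 _ HX.
have -> : q.+1`!%:R^-1 *: (q.+1%:R * (- ln x) ^+ q * - x^-1)
   = - ((- ln x) ^+ q / q`!%:R) * x^-1.
  have q1 : q.+1%:R != 0 :> R by rewrite pnatr_eq0.
  have qf : q`!%:R != 0 :> R by rewrite pnatr_eq0 -lt0n fact_gt0.
  rewrite factS natrM /GRing.scale /= invfM.
  transitivity (q.+1%:R^-1 * q.+1%:R * (q`!%:R^-1 * (- ln x) ^+ q * - x^-1)); first by ring.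
  by rewrite mulVf //; ring.
have -> // : (fun y : R => (- ln y) ^+ q.+1 / q.+1`!%:R)
   = q.+1`!%:R^-1 \*: (fun y : R => (- ln y) ^+ q.+1).
by apply/funext => y; rewrite mulrC.
Qed.

Lemma is_derive_mul (f g : R -> R) x (a b : R) : is_derive x 1 f a -> is_derive x 1 g b ->
  is_derive x 1 (fun y => f y * g y) (f x * b + g x * a).
Proof. by move=> hf hg; have := @is_deriveM R _ f g x 1 a b hf hg. Qed.

Lemma cder_Kq s q : cder (Kq s q) (Kq' s q).
Proof.
move=> x x0; case: s => a b.
(* Here [e], [t], [r] are the exponential, cosine and sine, [g] and [u] the logarithmic power and
   its predecessor, [xi] the inverse of x; the left sides are what the product rule yields. *)
have alg1 (e t r g u c d xi : R) :
    e * t * (- u * xi) + g * (e * (- r * (- d * xi)) + t * (e * (- c * xi)))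
    = e * ((- c * t + d * r) * xi * g - t * (u * xi)) by ring.
have alg2 (e t r g u c d xi : R) :
    e * r * (- u * xi) + g * (e * (t * (- d * xi)) + r * (e * (- c * xi)))
    = e * ((- c * r - d * t) * xi * g - r * (u * xi)) by ring.
have de : is_derive x 1 (fun y => expR (- a * ln y)) (expR (- a * ln x) * (- a * x^-1)).
  exact: (is_derive1_comp (is_derive_expR _) (is_derive_cln (- a) x0)).
have dc : is_derive x 1 (fun y => cos (- b * ln y)) (- sin (- b * ln x) * (- b * x^-1)).
  exact: (is_derive1_comp (is_derive_cos _) (is_derive_cln (- b) x0)).
have ds : is_derive x 1 (fun y => sin (- b * ln y)) (cos (- b * ln x) * (- b * x^-1)).
  exact: (is_derive1_comp (is_derive_sin _) (is_derive_cln (- b) x0)).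
have dl := is_derive_lnpow q x0.
have KE y : Kq (a +i* b) q y =
   (expR (- a * ln y) * cos (- b * ln y) * ((- ln y) ^+ q / q`!%:R)) +i*
   (expR (- a * ln y) * sin (- b * ln y) * ((- ln y) ^+ q / q`!%:R)).
  rewrite /Kq /pw /Cexp /=; apply/eqP; rewrite eq_complex /= !mulr0 !mul0r !subr0 !add0r.
  by rewrite !addr0 !eqxx.
have K'E : Kq' (a +i* b) q x =
  (expR (- a * ln x) * ((- a * cos (- b * ln x) + b * sin (- b * ln x)) * x^-1
        * ((- ln x) ^+ q / q`!%:R)
     - cos (- b * ln x) * ((if q is q'.+1 then (- ln x) ^+ q' / q'`!%:R else 0) * x^-1))) +i*
  (expR (- a * ln x) * ((- a * sin (- b * ln x) - b * cos (- b * ln x)) * x^-1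
        * ((- ln x) ^+ q / q`!%:R)
     - sin (- b * ln x) * ((if q is q'.+1 then (- ln x) ^+ q' / q'`!%:R else 0) * x^-1))).
  rewrite /Kq' /Kq pw1 // /pw /Cexp /=.
  by case: q {dl KE} => [|q]; apply/eqP; rewrite eq_complex /=;
    apply/andP; split; apply/eqP; rewrite ?mulr0 ?mul0r ?subr0 ?addr0 ?add0r; ring.
rewrite K'E; split.
  have -> : (fun y => complex.Re (Kq (a +i* b) q y)) = (fun y =>
     expR (- a * ln y) * cos (- b * ln y) * ((- ln y) ^+ q / q`!%:R)).
    by apply/funext => y; rewrite KE.
  exact: is_derive_eq (is_derive_mul (is_derive_mul de dc) dl) (alg1 _ _ _ _ _ _ _ _).
have -> : (fun y => complex.Im (Kq (a +i* b) q y)) = (fun y =>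
     expR (- a * ln y) * sin (- b * ln y) * ((- ln y) ^+ q / q`!%:R)).
  by apply/funext => y; rewrite KE.
exact: is_derive_eq (is_derive_mul (is_derive_mul de ds) dl) (alg2 _ _ _ _ _ _ _ _).
Qed.

Definition Dh h f : R -> C := fun x => f (x + h) - f x.

Lemma real_mvt (f df : R -> R) x h (B : R) : 0 < x -> 0 <= h ->
  (forall y, 0 < y -> is_derive y 1 f (df y)) ->
  (forall y, x <= y -> y <= x + h -> `|df y| <= B) ->
  `|f (x + h) - f x| <= h * B.
Proof.
move=> x0 h0 hf hB.
have xh : x <= x + h by rewrite lerDl.
have cf : {within `[x, x + h], continuous f}%classic.
  apply: derivable_within_continuous => y; rewrite in_itv /= => /andP[xy _].
  by have [] := hf y (lt_le_trans x0 xy).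
have hd y : y \in `]x, x + h[ -> is_derive y 1 f (df y).
  by rewrite in_itv /= => /andP[xy _]; apply: hf; apply: lt_trans xy.
have [c cI ->] := @MVT_segment R f df x (x + h) xh hd cf.
move: cI; rewrite in_itv /= => /andP[xc ch].
have -> : x + h - x = h by ring.
rewrite normrM (ger0_norm h0) mulrC ler_wpM2l //; exact: hB.
Qed.

(** The real mean value theorem is applied to Re and Im separately, whence the factor 2. *)
Lemma cder_mvt f g x h (B : R) : cder f g -> 0 < x -> 0 <= h ->
  (forall y, x <= y -> y <= x + h -> n1 (g y) <= B) -> n1 (Dh h f x) <= 2 * (h * B).
Proof.
move=> fg x0 h0 hB.
have h1 := @real_mvt (fun y => complex.Re (f y)) (fun y => complex.Re (g y)) x h B x0 h0
  (fun y py => (fg y py).1) (fun y py qy => le_trans (Re_le_n1 _) (hB y py qy)).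
have h2 := @real_mvt (fun y => complex.Im (f y)) (fun y => complex.Im (g y)) x h B x0 h0
  (fun y py => (fg y py).2) (fun y py qy => le_trans (Im_le_n1 _) (hB y py qy)).
rewrite /n1 /Dh; move: h1 h2; case: (f (x + h)) (f x) => [a b] [c d] /=; lra.
Qed.

Lemma is_derive_shift (f : R -> R) x h (a : R) : is_derive (x + h) 1 f a ->
  is_derive x 1 (fun y => f (y + h)) a.
Proof.
move=> hf; have hs : is_derive x 1 (fun y => y + h) (1 + 0).
  exact: (@is_deriveD R _ _ id (cst h) x 1 1 0).
have := @is_derive1_comp R f (fun y => y + h) x a (1 + 0) hf hs.
by rewrite addr0 mulr1.
Qed.

Lemma cder_Dh f g h : 0 <= h -> cder f g -> cder (Dh h f) (Dh h g).
Proof.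
move=> h0 fg x x0; have xh0 : 0 < x + h by rewrite ltr_wpDr.
have [r1 i1] := fg x x0; have [r2 i2] := fg _ xh0; rewrite /Dh.
rewrite ReB ImB; split.
  have -> : (fun y => complex.Re (f (y + h) - f y))
     = (fun y => complex.Re (f (y + h))) - (fun y => complex.Re (f y)).
    by apply/funext => y; rewrite ReB.
  exact: (@is_deriveB R _ _ _ _ x 1 _ _ (is_derive_shift r2) r1).
have -> : (fun y => complex.Im (f (y + h) - f y))
   = (fun y => complex.Im (f (y + h))) - (fun y => complex.Im (f y)).
  by apply/funext => y; rewrite ImB.
exact: (@is_deriveB R _ _ _ _ x 1 _ _ (is_derive_shift i2) i1).
Qed.

Lemma cder_iterDh f g h p : 0 <= h -> cder f g -> cder (iter p (Dh h) f) (iter p (Dh h) g).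
Proof. by move=> h0 fg; elim: p => //= p IHp; apply: cder_Dh. Qed.

Lemma iter_Dh_lin h p (a b : C) f g x :
  iter p (Dh h) (fun y => a * f y - b * g y) x
  = a * iter p (Dh h) f x - b * iter p (Dh h) g x.
Proof. by elim: p x => //= p IHp x; rewrite /Dh !IHp; ring. Qed.

Lemma iter_Dh0 h p x : iter p (Dh h) (fun=> 0) x = 0.
Proof. by elim: p x => //= p IHp x; rewrite /Dh !IHp subrr. Qed.

(** u / x lies between 1 and 1 + h, so u^e and x^e are comparable for either sign of e; bounds at an
    unknown intermediate point become bounds at x. *)
Lemma expR_ln_near (e x u h : R) : 1 <= x -> 0 <= h -> x <= u -> u <= x + h ->
  expR (e * ln u) <= expR (`|e| * ln (1 + h)) * expR (e * ln x).
Proof.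
move=> x1 h0 xu uh; rewrite -expRD ler_expR.
have x0 : 0 < x by lra.
have u0 : 0 < u by lra.
have h1 : 0 < 1 + h by lra.
have l1 : ln x <= ln u by rewrite ler_ln.
have l2 : ln u <= ln (1 + h) + ln x.
  by rewrite -lnM // ler_ln ?posrE ?mulr_gt0 //; nra.
have : `|e| * (ln u - ln x) <= `|e| * ln (1 + h) by rewrite ler_wpM2l //; lra.
have : e * (ln u - ln x) <= `|e| * (ln u - ln x).
  by rewrite ler_wpM2r ?ler_norm //; lra.
nra.
Qed.

(** Each difference costs one mean value estimate and passes to s + 1, gaining a power of x. The
    constant is free of q because the bound at s + 1 covers both terms of [Kq'], of index q and q -
    1. *)
Lemma iter_Dh_Kq_bound h : 0 <= h -> forall p s, exists2 A : R, 0 <= A &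
  forall q x, 1 <= x ->
    n1 (iter p (Dh h) (Kq s q) x) <= A * expR ((1 - complex.Re s - p%:R) * ln x).
Proof.
move=> h0; elim=> [|p IHp] s.
  by exists 2 => // q x x1; rewrite subr0; apply: Kq_bound.
have [A A0 hA] := IHp (s + 1).
pose e := 1 - complex.Re (s + 1) - p%:R.
exists (2 * (h * ((n1 s + 1) * A * expR (`|e| * ln (1 + h))))).
  by rewrite !mulr_ge0 ?expR_ge0 ?addr_ge0 ?n1_ge0.
move=> q x x1 /=; have x0 : 0 < x by lra.
have -> : 1 - complex.Re s - p.+1%:R = e.
  by rewrite /e -natr1; case: s {hA e} => a b /=; ring.
rewrite -mulrA -[h * _ * _]mulrA.
apply: (cder_mvt (cder_iterDh p h0 (@cder_Kq s q)) x0 h0) => u xu uh.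
have u1 : 1 <= u by lra.
have hq1 := hA q u u1.
have E1 : n1 (iter p (Dh h) (Kq' s q) u) <= (n1 s + 1) * (A * expR (e * ln u)).
  have -> : Kq' s q = fun y => - s * Kq (s + 1) q y -
      1 * (if q is q'.+1 then Kq (s + 1) q' else (fun=> 0)) y.
    by apply/funext => y; rewrite /Kq' mul1r; case: q {hq1}.
  rewrite iter_Dh_lin mul1r mulrDl mul1r; apply: le_trans (n1_sub _ _) _; apply: lerD.
    apply: le_trans (n1M _ _) _; rewrite n1N ler_wpM2l ?n1_ge0 //.
  case: q {hq1} => [|q]; last exact: hA.
  by rewrite iter_Dh0 n1_0 mulr_ge0 ?expR_ge0.
apply: le_trans E1 _; rewrite -!mulrA ler_wpM2l ?addr_ge0 ?n1_ge0 // ler_wpM2l //.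
exact: expR_ln_near.
Qed.

End ComplexPowers.

(** * Euler's transformation and the entire continuation *)

Section Continuation.
Variables (R : realType) (chi : nat -> R[i]) (P : nat).
Local Notation C := R[i].
Hypothesis chiP : forall n, chi (n + P)%N = - chi n.
Hypothesis chi_le1 : forall n, n1 (chi n) <= 1.
Implicit Types (h : R -> C) (s w : C).

Local Notation D := (Dh (P%:R : R)).

Definition csum h N : C := \sum_(n < N) chi n.+1 * h n.+1%:R.

Definition climit (u : nat -> C) : C := xget 0 [set l | ctends u l]%classic.

Lemma climitP u l : ctends u l -> climit u = l.
Proof.
move=> ul; apply: (ctends_uniq _ ul).
exact: (@xgetPex _ 0 [set l | ctends u l]%classic (ex_intro _ l ul)).
Qed.

(* Euler summation of the alternating structure chi (n + P) = - chi n *)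
Fixpoint euler_sum p h : C :=
  if p is p'.+1 then 2^-1 * (csum h P - euler_sum p' (D h)) else climit (csum h).

Definition vanish h := ctends (fun n => h n.+1%:R) 0.

Lemma csum_shift h N : csum h (N + P) = csum h P - csum (fun x => h (x + P%:R)) N.
Proof.
rewrite /csum addnC big_split_ord -sumrN /=; congr (_ + _); apply: eq_bigr => n _.
rewrite -addnS addnC chiP mulNr addSn; congr (- (_ * h _)).
by rewrite -natrD addSn.
Qed.

Lemma csum_D h N : csum (D h) N = csum (fun x => h (x + P%:R)) N - csum h N.
Proof. by rewrite /csum -sumrB; apply: eq_bigr => n _; rewrite mulrBr. Qed.

Lemma vanish_block h : vanish h -> ctends (fun N => csum h (N + P) - csum h N) 0.
Proof.
move=> hv.
have hn n : ctends (fun N => chi (N + n).+1 * h (N + n).+1%:R) 0.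
  move=> e e0; have [N hN] := ctends_shift n hv e0; exists N => k /hN.
  rewrite !subr0; apply: le_lt_trans; apply: le_trans (n1M _ _) _.
  by rewrite ler_piMl ?n1_ge0.
have := @ctends_sum _ _ (index_enum 'I_P)
  (fun n N => chi (N + n).+1 * h (N + n).+1%:R) (fun=> 0) (fun n => hn n).
rewrite big1 //; apply: ctends_ext => N.
by rewrite /csum big_split_ord /= addrAC subrr add0r.
Qed.

(** Antiperiodicity gives 2 [csum h N] = [csum h P - csum (D h) N - (csum h (N + P) - csum h N)],
    and the last block of P terms tends to 0. *)
Lemma euler_step h l : ctends (csum (D h)) l -> vanish h ->
  ctends (csum h) (2^-1 * (csum h P - l)).
Proof.
move=> hl hv.
have := ctendsB (ctendsB (ctends_cst (csum h P)) hl) (vanish_block hv).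
move=> /(ctendsZ 2^-1); rewrite subr0; apply: ctends_ext => N.
rewrite csum_shift csum_D.
have two : 2 != 0 :> C by rewrite pnatr_eq0.
by apply: (mulfI two); rewrite mulVKf //; ring.
Qed.

Lemma csum_ext h h' : (forall n, h n.+1%:R = h' n.+1%:R) -> csum h = csum h'.
Proof. by move=> hh; apply/funext => N; apply: eq_bigr => n _; rewrite hh. Qed.

Lemma euler_ext p h h' : (forall n, h n.+1%:R = h' n.+1%:R) ->
  euler_sum p h = euler_sum p h'.
Proof.
elim: p h h' => [|p IHp] h h' hh /=; first by rewrite (csum_ext hh).
rewrite (csum_ext hh); congr (_ * (_ - _)); apply: IHp => n.
by rewrite /Dh hh -natrD addSn hh.
Qed.

Lemma euler_cvg p h : (forall i, (i < p)%N -> vanish (iter i D h)) ->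
  (exists l, ctends (csum (iter p D h)) l) -> ctends (csum h) (euler_sum p h).
Proof.
elim: p h => [|p IHp] h hv [l hl] /=; first by rewrite (climitP hl).
apply: euler_step; last exact: (hv 0%N).
apply: IHp => [i ip|]; first by rewrite -iterSr; apply: hv.
by exists l; rewrite -iterSr.
Qed.

(** Only the innermost series is touched: [euler_step] expresses its limit by one more step. *)
Lemma euler_S p h : vanish (iter p D h) ->
  (exists l, ctends (csum (iter p.+1 D h)) l) -> euler_sum p.+1 h = euler_sum p h.
Proof.
elim: p h => [|p IHp] h hv [l hl].
  by rewrite /= (climitP hl) (climitP (euler_step hl hv)).
have -> : euler_sum p.+2 h = 2^-1 * (csum h P - euler_sum p.+1 (D h)) by [].
rewrite IHp //; first by rewrite -iterSr.
by exists l; rewrite -iterSr.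
Qed.

Lemma iter_Dh_tends p (c : nat -> R -> C) h w :
  (forall x, 1 <= x -> ctends (fun Q => \sum_(q < Q) c q x * w ^+ q) (h x)) ->
  forall x, 1 <= x ->
    ctends (fun Q => \sum_(q < Q) iter p D (c q) x * w ^+ q) (iter p D h x).
Proof.
move=> hc; elim: p => //= p IHp x x1.
have x2 : 1 <= x + P%:R by rewrite (le_trans x1) // lerDl.
have := ctendsB (IHp _ x2) (IHp _ x1); apply: ctends_ext => Q.
by rewrite -sumrB; apply: eq_bigr => q _; rewrite /Dh mulrBl.
Qed.

Lemma natS_ge1 n : 1 <= n.+1%:R :> R.
Proof. by rewrite (ler_nat R 1). Qed.

(** Domination is needed only for the innermost infinite series, after p differences; the outer
    steps combine finitely many power series linearly. *)
Lemma euler_power_series p (c : nat -> R -> C) (h : C -> R -> C) B T :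
  (forall w x, n1 w <= 2^-1 -> 1 <= x ->
     ctends (fun Q => \sum_(q < Q) c q x * w ^+ q) (h w x)) ->
  psum_le B T -> (forall q n, n1 (iter p D (c q) n.+1%:R) <= B n) ->
  exists d : nat -> C, forall w, n1 w <= 2^-1 ->
    ctends (fun Q => \sum_(q < Q) d q * w ^+ q) (euler_sum p (h w)).
Proof.
move=> hc BT; elim: p c h hc => [|p IHp] c h hc cB.
  have cB' q n : n1 (chi n.+1 * c q n.+1%:R) <= B n.
    apply: le_trans (n1M _ _) _; apply: le_trans (cB q n).
    by rewrite ler_piMl ?n1_ge0.
  have hd q : exists l, ctends (fun N => \sum_(n < N) chi n.+1 * c q n.+1%:R) l.
    by apply: (@abs_conv _ (fun n => chi n.+1 * c q n.+1%:R) B T BT) => n; apply: cB'.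
  have [d hd'] := choice hd; exists d => w w2 /=.
  have hf n : ctends (fun Q => \sum_(q < Q) (chi n.+1 * c q n.+1%:R) * w ^+ q)
      (chi n.+1 * h w n.+1%:R).
    have := ctendsZ (chi n.+1) (hc w _ w2 (natS_ge1 n)); apply: ctends_ext => Q.
    by rewrite big_distrr /=; apply: eq_bigr => q _; rewrite mulrA.
  have hB n : n1 (chi n.+1 * h w n.+1%:R) <= 2 * B n.
    apply: (ctends_bound (hf n)) => Q.
    by apply: (power_sum_le (c := fun q => chi n.+1 * c q n.+1%:R)).
  have BT2 : psum_le (fun n => 2 * B n) (2 * T).
    split=> [n|N]; first by rewrite mulr_ge0 // BT.1.
    by rewrite -big_distrr ler_wpM2l // BT.2.
  have [F hF] := abs_conv BT2 hB; rewrite (climitP hF).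
  exact: (sum_power_series BT (fun n q => cB' q n) w2 hf hF hd').
have hD w x : n1 w <= 2^-1 -> 1 <= x ->
   ctends (fun Q => \sum_(q < Q) D (c q) x * w ^+ q) (D (h w) x).
  by move=> w2 x1; apply: (iter_Dh_tends 1 (hc w ^~ w2)).
have [|d hd] := IHp (fun q => D (c q)) (fun w => D (h w)) hD.
  by move=> q n; rewrite -iterSr.
exists (fun q => 2^-1 * (csum (c q) P - d q)) => w w2 /=.
have hb : ctends (fun Q => \sum_(q < Q) csum (c q) P * w ^+ q) (csum (h w) P).
  have := @ctends_sum _ _ (index_enum 'I_P)
    (fun n Q => chi n.+1 * \sum_(q < Q) c q n.+1%:R * w ^+ q)
    (fun n => chi n.+1 * h w n.+1%:R)
    (fun n => ctendsZ (chi n.+1) (hc w _ w2 (natS_ge1 n))).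
  apply: ctends_ext => Q; under eq_bigr do rewrite big_distrr /=.
  rewrite exchange_big; apply: eq_bigr => q _ /=; rewrite big_distrl.
  by apply: eq_bigr => n _; rewrite /= mulrA.
have := ctendsZ 2^-1 (ctendsB hb (hd w w2)); apply: ctends_ext => Q.
rewrite -sumrB big_distrr; apply: eq_bigr => q _ /=.
by rewrite -mulrBl mulrA.
Qed.

Lemma psum_inv_sq (A : R) : 0 <= A -> psum_le (fun n => A * (n.+1%:R ^+ 2)^-1) (A * 2).
Proof.
move=> A0; split=> [n|N]; first by rewrite mulr_ge0 // invr_ge0 sqr_ge0.
rewrite -big_distrr ler_wpM2l //=.
case: N => [|N]; first by rewrite big_ord0.
suff : \sum_(n < N.+1) (n.+1%:R ^+ 2)^-1 <= 2 - N.+1%:R^-1 :> R.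
  by move=> /le_trans; apply; rewrite gerBl invr_ge0.
elim: N => [|N IHN]; first by rewrite big_ord1 expr1n invr1; lra.
rewrite big_ord_recr /=; apply: le_trans (lerD IHN (lexx _)) _.
have n1 : (0 : R) < N.+1%:R by [].
have E : N.+2%:R = N.+1%:R + 1 :> R by rewrite natr1.
rewrite -subr_ge0 E; move: (N.+1%:R : R) n1 => x x0.
have -> : 2 - (x + 1)^-1 - (2 - x^-1 + ((x + 1) ^+ 2)^-1) = (x * (x + 1) ^+ 2)^-1.
  by field; apply/andP; split; rewrite gt_eqF //; lra.
by rewrite invr_ge0 mulr_ge0 ?sqr_ge0 // ltW.
Qed.

Lemma Kq0 s : Kq s 0 = pw s :> (R -> C).
Proof. by apply/funext => x; rewrite /Kq expr0 divr1 mulr1. Qed.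

(** The constant 3 makes the exponent 1 - Re s - p at most -2, so a multiple of 1/n^2 is a
    majorant. *)
Lemma Kq_psum s p : 3 <= complex.Re s + p%:R ->
  exists B T, psum_le B T /\ forall q n, n1 (iter p D (Kq s q) n.+1%:R) <= B n.
Proof.
move=> sp; have [A A0 hA] := iter_Dh_Kq_bound (ler0n R P) p s.
exists (fun n => A * (n.+1%:R ^+ 2)^-1), (A * 2); split; first exact: psum_inv_sq.
move=> q n; apply: le_trans (hA _ _ (natS_ge1 n)) _; rewrite ler_wpM2l //.
have n0 : (0 : R) < n.+1%:R by [].
have -> : (n.+1%:R ^+ 2)^-1 = expR (- 2 * ln n.+1%:R) :> R.
  have -> : - 2 * ln n.+1%:R = - ln n.+1%:R + - ln n.+1%:R :> R by ring.
  by rewrite expRD expRN lnK // expr2 invfM.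
by rewrite ler_expR ler_wpM2r ?ln_ge0 ?natS_ge1 //; lra.
Qed.

Lemma vanish_pw s i : 1 < complex.Re s + i%:R -> vanish (iter i D (pw s)).
Proof.
move=> si; have [A A0 hA] := iter_Dh_Kq_bound (ler0n R P) i s.
move=> e e0; pose eta := complex.Re s + i%:R - 1.
have eta0 : 0 < eta by rewrite subr_gt0.
(* exp K is the (1/eta)-th power of (A + 1)/e; beyond it A n^(-eta) is less than e. *)
pose K := ln ((A + 1) / e) / eta.
have K1 : 0 < (A + 1) / e by rewrite divr_gt0 // ltr_wpDl.
exists (Num.bound (expR K)) => n Nn; rewrite subr0.
have := hA 0%N _ (natS_ge1 n); rewrite Kq0 => /le_lt_trans; apply.
have Kn : K < ln n.+1%:R.
  rewrite -[K]expRK ltr_ln ?posrE ?expR_gt0 //.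
  apply: lt_trans (archi_boundP (expR_ge0 K)) _.
  by rewrite ltr_nat ltnS.
have h1 : (1 - complex.Re s - i%:R) * ln n.+1%:R < - ln ((A + 1) / e).
  move: Kn; rewrite /K ltr_pdivrMr // -/eta => Kn.
  have -> : 1 - complex.Re s - i%:R = - eta by rewrite /eta; ring.
  by rewrite mulNr ltrN2 [eta * _]mulrC.
have {}h1 : expR ((1 - complex.Re s - i%:R) * ln n.+1%:R) < e / (A + 1).
  by rewrite -invf_div -[X in _ < X^-1]lnK // -expRN ltr_expR.
apply: le_lt_trans (_ : A * (e / (A + 1)) < e); first by rewrite ler_wpM2l // ltW.
have A1 : 0 < A + 1 by rewrite ltr_wpDl.
by rewrite mulrA ltr_pdivrMr // mulrC ltr_pM2l // ltrDl.
Qed.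

Lemma csum_pw_cvg s p : 3 <= complex.Re s + p%:R ->
  exists l, ctends (csum (iter p D (pw s))) l.
Proof.
move=> sp; have [B [T [BT hB]]] := Kq_psum sp.
apply: (@abs_conv _ (fun n => chi n.+1 * iter p D (pw s) n.+1%:R) B T BT) => n.
apply: le_trans (n1M _ _) _; apply: le_trans (hB 0%N n).
by rewrite Kq0 ler_piMl ?n1_ge0.
Qed.

(** The number of steps jumps with s, which hides analyticity; by [LextE] any sufficient number
    gives the same value. *)
Definition Lext s : C := euler_sum (Num.bound `|3 - complex.Re s|) (pw s).

Lemma euler_pw_eq s p k : 3 <= complex.Re s + p%:R ->
  euler_sum (k + p) (pw s) = euler_sum p (pw s).
Proof.
move=> sp; elim: k => // k IHk; rewrite addSn euler_S //.
- by apply: vanish_pw; rewrite natrD; have : (0 : R) <= k%:R by []; lra.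
- apply: csum_pw_cvg; rewrite -addSn natrD; have : (0 : R) <= k.+1%:R by [].
  lra.
Qed.

Lemma Lext_bound s : 3 <= complex.Re s + (Num.bound `|3 - complex.Re s|)%:R.
Proof.
have := archi_boundP (normr_ge0 (3 - complex.Re s)).
have := ler_norm (3 - complex.Re s); lra.
Qed.

Lemma LextE s p : 3 <= complex.Re s + p%:R -> Lext s = euler_sum p (pw s).
Proof.
move=> sp; have sb := Lext_bound s; rewrite /Lext.
set b := Num.bound _ in sb *.
have [bp|pb] := leqP b p; first by rewrite -(subnK bp) euler_pw_eq.
by rewrite -(subnK (ltnW pb)) euler_pw_eq.
Qed.

Lemma Lext_entire : entire Lext.
Proof.
move=> z; have zp := Lext_bound z; set b := Num.bound _ in zp.
(* One step more than z needs, so that the same number works on the whole neighbourhood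
   [n1 (w - z) < 2^-1]. *)
have zp1 : 3 <= complex.Re z + b.+1%:R by rewrite -natr1; lra.
have [B [T [BT hB]]] := Kq_psum zp1.
have [d hd] := @euler_power_series b.+1 (Kq z) (fun w => pw (z + w)) B T
  (fun w x _ _ => @Kq_series R z w x) BT hB.
exists d; apply: (@near_n1 _ _ _ 2^-1) => [|w wz]; first by rewrite invr_gt0.
apply: ctendsP; have := hd (w - z) (ltW wz).
have -> : z + (w - z) = w by ring.
rewrite -LextE; last first.
  have := Re_le_n1 (w - z); have := ler_norm (- complex.Re (w - z)).
  by rewrite normrN ReB -natr1; move: wz zp; lra.
by apply: ctends_ext => N; rewrite /series /= big_mkord.
Qed.

Lemma Lext_dirichlet : is_dirichlet_continuation chi Lext.
Proof.
split=> [|s s1]; first exact: Lext_entire.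
apply: ctendsP; have H : ctends (csum (pw s)) (Lext s).
  apply: euler_cvg => [i _|]; last exact/csum_pw_cvg/Lext_bound.
  by apply: vanish_pw; have : (0 : R) <= i%:R by []; lra.
by move: H; apply: ctends_ext => N; rewrite /csum /series /= big_mkord.
Qed.

End Continuation.

(** * Values at nonpositive integers *)

Section SpecialValues.
Variables (R : realType) (chi : nat -> R[i]) (P : nat).
Local Notation C := R[i].
Hypothesis P_gt0 : (0 < P)%N.
Hypothesis chiP : forall n, chi (n + P)%N = - chi n.
Hypothesis chi_le1 : forall n, n1 (chi n) <= 1.
Local Notation f := ((2 * P)%N%:R : C).
Local Notation Bp n z := (bernoulli_poly C n).[z].

(** The expected value of L(-k) by the generalised Bernoulli number formula, for the period f =
    2P. *)
Definition vB k : C := - (f ^+ k / k.+1%:R) *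
  \sum_(1 <= r < (2 * P).+1) chi r * Bp k.+1 (r%:R / f).

Let f_neq0 : f != 0. Proof. by rewrite pnatr_eq0; lia. Qed.

Lemma vBE k : vB k = - (f ^+ k / k.+1%:R) *
  \sum_(r < P) chi r.+1 * (Bp k.+1 (r.+1%:R / f) - Bp k.+1 (r.+1%:R / f + 2^-1)).
Proof.
congr (_ * _); rewrite big_add1 /= big_mkord mul2n -addnn big_split_ord /= addnn -mul2n.
rewrite -big_split; apply: eq_bigr => r _; rewrite mulrBr; congr (_ + _).
rewrite addnC -addSn chiP mulNr; congr (- (_ * _.[_])).
rewrite addnC natrD mulrDl addrC; congr (_ + _).
have P0 : P%:R != 0 :> C by rewrite pnatr_eq0; lia.
by rewrite natrM; field.
Qed.

(** Euler's recursion for the monomial x^k: the value attached to (x + P)^k is a finite sum minus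
    the value attached to x^k. *)
Lemma vB_shift k : \sum_(j < k.+1) 'C(k, j)%:R * P%:R ^+ (k - j) * vB j
  = \sum_(r < P) chi r.+1 * r.+1%:R ^+ k - vB k.
Proof.
have k1 : k.+1%:R != 0 :> C by rewrite pnatr_eq0.
(* Since P = f/2, the sum is the expansion of B_(k+1)(y + 1/2) short of its last term (1/2)^(k+1),
   which cancels between the two half-periods. *)
have half y : \sum_(j < k.+1) 'C(k, j)%:R * P%:R ^+ (k - j) * (f ^+ j / j.+1%:R) * Bp j.+1 y
   = f ^+ k / k.+1%:R * (Bp k.+1 (y + 2^-1) - 2^-1 ^+ k.+1).
  rewrite bernoulli_poly_add [in RHS]big_ord_recr /= subnn binn mul1r.
  have -> : Bp 0 y = 1.
    by rewrite /bernoulli_poly big_ord1 !hornerE /bernoulli /=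
         ?mulr1 ?big_ord0 ?mulr0 ?subr0.
  rewrite mul1r addrK (reindex_inj rev_ord_inj) big_distrr /=.
  apply: eq_bigr => -[j /= jk] _; rewrite subSS.
  have -> : (k.+1 - j = (k - j).+1)%N by lia.
  have -> : 'C(k.+1, j) = 'C(k.+1, (k - j).+1) by rewrite -bin_sub; [congr 'C(_, _)|]; lia.
  have -> : (k - (k - j) = j)%N by lia.
  have -> : P%:R = f / 2 :> C.
    by rewrite natrM; field.
  have bE : 'C(k, k - j)%:R / (k - j).+1%:R = 'C(k.+1, (k - j).+1)%:R / k.+1%:R :> C.
    have j1 : (k - j).+1%:R != 0 :> C by rewrite pnatr_eq0.
    apply/eqP; rewrite eqr_div // -!natrM eqr_nat mulnC mul_bin_diag mulnC; by [].
  have fE : f ^+ k = f ^+ j * f ^+ (k - j) by rewrite -exprD subnKC.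
  rewrite exprMn fE.
  transitivity (f ^+ j * f ^+ (k - j) * 2^-1 ^+ j * Bp (k - j).+1 y
     * ('C(k, k - j)%:R / (k - j).+1%:R)).
    by ring.
  by rewrite bE; ring.
under eq_bigr do rewrite vBE.
transitivity (- \sum_(r < P) chi r.+1 *
  (f ^+ k / k.+1%:R * (Bp k.+1 (r.+1%:R / f + 2^-1) - 2^-1 ^+ k.+1)
   - f ^+ k / k.+1%:R * (Bp k.+1 (r.+1%:R / f + 2^-1 + 2^-1) - 2^-1 ^+ k.+1))).
  under [in RHS]eq_bigr do rewrite -!half -sumrB big_distrr /=.
  rewrite exchange_big -sumrN /=; apply: eq_bigr => j _.
  by rewrite !big_distrr /= -sumrN; apply: eq_bigr => r _; ring.
rewrite vBE mulNr opprK big_distrr -big_split -sumrN /=; apply: eq_bigr => r _.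
have -> : r.+1%:R / f + 2^-1 + 2^-1 = r.+1%:R / f + 1 :> C.
  have h2 : 2^-1 + 2^-1 = 1 :> C by field.
  by rewrite -addrA h2.
have := bernoulli_poly_diff k (r.+1%:R / f : C) => /(canRL (subrK _)) ->.
have -> : r.+1%:R ^+ k = f ^+ k * (r.+1%:R / f) ^+ k :> C.
  by rewrite -exprMn mulrC divfK.
by field.
Qed.

(** Linear extension of x^k to [vB k], so that the recursion can be applied to differences of
    polynomials. *)
Definition vBpoly (g : {poly C}) : C := \sum_(k < size g) g`_k * vB k.

Lemma vBpoly_wide (g : {poly C}) n : (size g <= n)%N -> vBpoly g = \sum_(k < n) g`_k * vB k.
Proof.
move=> gn; rewrite /vBpoly -!(big_mkord xpredT (fun k => g`_k * vB k)).
have z : \sum_(size g <= k < n) g`_k * vB k = 0.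
  by rewrite big_nat big1 // => k /andP[gk _]; rewrite nth_default ?mul0r.
by rewrite [RHS](big_cat_nat (n := size g)) //= z addr0.
Qed.

Lemma vBpolyB (g h : {poly C}) : vBpoly (g - h) = vBpoly g - vBpoly h.
Proof.
pose n := maxn (size g) (size h).
rewrite !(@vBpoly_wide _ n) ?leq_maxl ?leq_maxr //; last first.
  by apply: leq_trans (size_polyD _ _) _; rewrite size_polyN.
by rewrite -sumrB; apply: eq_bigr => k _; rewrite coefB mulrBl.
Qed.

Lemma vBpoly_shift (g : {poly C}) : vBpoly (g \Po ('X + P%:R%:P))
  = \sum_(r < P) chi r.+1 * g.[r.+1%:R] - vBpoly g.
Proof.
rewrite (@vBpoly_wide _ (size g)); last first.
  by rewrite size_comp_poly2 // size_XaddC.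
have gE j : (g \Po ('X + P%:R%:P))`_j
   = \sum_(k < size g) g`_k * ('C(k, j)%:R * P%:R ^+ (k - j)).
  rewrite comp_polyE coef_sum; apply: eq_bigr => k _; rewrite coefZ; congr (_ * _).
  rewrite addrC exprDn coef_sum.
  have [jk|kj] := leqP j k.
    rewrite (bigD1 (Ordinal (jk : (j < k.+1)%N))) //= big1 ?addr0.
      by rewrite coefMn -polyC_exp coefCM coefXn eqxx mulr1 mulr_natl.
    move=> i ij; rewrite coefMn -polyC_exp coefCM coefXn.
    have /negbTE-> : j != i by apply: contraNneq ij => ji; apply/eqP/val_inj; rewrite /= ji.
    by rewrite mulr0 mul0rn.
  rewrite bin_small // mul0r big1 // => i _; rewrite coefMn -polyC_exp coefCM coefXn.
  have /negbTE-> : j != i by have := ltn_ord i; lia.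
  by rewrite mulr0 mul0rn.
transitivity (\sum_(k < size g) g`_k * \sum_(j < k.+1) 'C(k, j)%:R * P%:R ^+ (k - j) * vB j).
  under eq_bigr do rewrite gE big_distrl /=.
  rewrite exchange_big; apply: eq_bigr => -[k /= kg] _; rewrite big_distrr /=.
  pose F j := g`_k * ('C(k, j)%:R * P%:R ^+ (k - j) * vB j).
  transitivity (\sum_(j < size g) F j); first by apply: eq_bigr => j _; rewrite /F [RHS]mulrA.
  have z : \sum_(k.+1 <= j < size g) F j = 0.
    by rewrite big_nat big1 // => j /andP[kj _]; rewrite /F bin_small // !mul0r mulr0.
  by rewrite -!(big_mkord xpredT F) (big_cat_nat (n := k.+1)) //= z addr0.
under eq_bigr do rewrite vB_shift mulrBr.
rewrite sumrB; congr (_ - _); under eq_bigr do rewrite big_distrr /=.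
rewrite exchange_big; apply: eq_bigr => r _; rewrite horner_coef big_distrr /=.
by apply: eq_bigr => k _; rewrite mulrCA.
Qed.

Lemma size_shift_sub (g : {poly C}) c n : (size g <= n.+1)%N ->
  (size (g \Po ('X + c%:P) - g)%R <= n)%N.
Proof.
move=> gn; have hX k : (size (('X + c%:P) ^+ k - 'X^k : {poly C})%R <= k)%N.
  elim: k => [|k IHk]; first by rewrite !expr0 subrr size_poly0.
  have -> : ('X + c%:P) ^+ k.+1 - 'X^(k.+1)
     = (('X + c%:P) ^+ k - 'X^k) * ('X + c%:P) + c *: 'X^k :> {poly C}.
    by rewrite !exprS -mul_polyC; ring.
  apply: leq_trans (size_polyD _ _) _; rewrite geq_max; apply/andP; split.
    apply: leq_trans (size_polyMleq _ _) _; rewrite size_XaddC addn2 /=.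
    exact: IHk.
  by apply: leq_trans (size_scale_leq _ _) _; rewrite size_polyXn.
have -> : g \Po ('X + c%:P) - g = \sum_(k < size g) g`_k *: (('X + c%:P) ^+ k - 'X^k).
  rewrite comp_polyE -[X in _ - X]coefK poly_def -sumrB.
  by apply: eq_bigr => k _; rewrite scalerBr.
apply: leq_trans (size_sum _ _ _) _; apply/bigmax_leqP => -[k /= kg] _.
apply: leq_trans (size_scale_leq _ _) _.
by apply: leq_trans (hX k) _; rewrite -ltnS (leq_trans kg).
Qed.

(** Every difference lowers the degree, so p steps end in the zero series; by [vBpoly_shift] the
    functional [vBpoly] satisfies the same recursion. *)
Lemma euler_poly p (g : {poly C}) : (size g <= p)%N ->
  euler_sum chi P p (fun x => g.[x%:C]) = vBpoly g.
Proof.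
elim: p g => [|p IHp] g gp /=.
  move: gp; rewrite leqn0 size_poly_eq0 => /eqP->.
  rewrite /vBpoly size_poly0 big_ord0; apply: climitP.
  apply: ctends_ext (ctends_cst 0) => N.
  by rewrite /csum big1 // => n _; rewrite horner0 mulr0.
have -> : Dh P%:R (fun x => g.[x%:C]) = (fun x : R => (g \Po ('X + P%:R%:P) - g).[x%:C]).
  apply/funext => x; rewrite /Dh hornerD hornerN horner_comp; congr (_.[_] - _).
  by rewrite !hornerE rmorphD rmorph_nat.
rewrite IHp ?size_shift_sub // vBpolyB vBpoly_shift /csum.
under eq_bigr do rewrite rmorph_nat.
have two : 2 != 0 :> C by rewrite pnatr_eq0.
by field.
Qed.

Lemma pw_nat k x : 0 < x -> pw (- k%:R) x = (x%:C ^+ k) :> C.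
Proof.
move=> x0; rewrite /pw opprK -rmorphXn.
have -> : k%:R * (ln x)%:C = (k%:R * ln x)%:C :> C by rewrite rmorphM rmorph_nat.
rewrite Cexp_real; congr _%:C.
elim: k => [|k IHk]; first by rewrite mul0r expR0 expr0.
by rewrite -natr1 mulrDl mul1r expRD IHk lnK // exprSr.
Qed.

Lemma Lext_neg k : Lext chi P (- k%:R) = vB k.
Proof.
(* k + 3 steps meet the convergence condition 3 <= -k + p and exceed the k + 1 that annihilate
   x^k. *)
rewrite (@LextE _ _ _ chiP chi_le1 _ (k + 3)); last first.
  by rewrite natC -rmorphN /= natrD; lra.
rewrite (@euler_ext _ _ _ _ _ (fun x => ('X^k : {poly C}).[x%:C])); last first.
  by move=> n; rewrite pw_nat // hornerXn.
rewrite euler_poly ?size_polyXn ?addn3 //; last by lia.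
rewrite /vBpoly size_polyXn big_ord_recr /= coefXn eqxx mul1r big1 ?add0r // => j _.
by rewrite coefXn ltn_eqF // mul0r.
Qed.

End SpecialValues.

(** * Uniqueness of the continuation *)

Section IdentityTheorem.
Variable R : realType.
Local Notation C := R[i].

Lemma n1_scale (z : C) (r : R) : n1 (z * r%:C) = n1 z * `|r|.
Proof. by case: z => a b; rewrite /n1 /= !mulr0 subr0 add0r !normrM mulrDl. Qed.

Lemma power_series_bounded (c : nat -> C) (z l : C) :
  ctends (fun N => \sum_(n < N) c n * z ^+ n) l ->
  exists2 B : R, 0 <= B & forall n, n1 (c n * z ^+ n) <= B.
Proof.
move=> hl; have [N hN] := hl 1 ltr01.
exists (2 + \sum_(n < N) n1 (c n * z ^+ n)).
  by rewrite addr_ge0 // sumr_ge0 // => n _; apply: n1_ge0.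
move=> n; have [nN|Nn] := ltnP n N.
  rewrite (bigD1 (Ordinal nN)) //= addrCA lerDl addr_ge0 // sumr_ge0 // => k _.
  exact: n1_ge0.
have h1 := hN n Nn; have h2 := hN n.+1 (leqW Nn).
have E : c n * z ^+ n = (\sum_(k < n.+1) c k * z ^+ k - l) - (\sum_(k < n) c k * z ^+ k - l).
  by rewrite big_ord_recr /=; ring.
rewrite E; apply: le_trans (n1_sub _ _) _.
have : 0 <= \sum_(n < N) n1 (c n * z ^+ n) by apply: sumr_ge0 => k _; apply: n1_ge0.
move: h1 h2; lra.
Qed.

(** If the coefficients below p vanish, then at e = t r the terms beyond p amount to at most 2 B
    t^(p+1), hence |c_p| r^p <= 2 B t for all small t. Only positive real e are used, as
    [entire_identity] supplies no others. *)
Lemma power_series_zero (c : nat -> C) (d : R) : 0 < d ->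
  (forall e : R, 0 < e < d -> ctends (fun N => \sum_(n < N) c n * e%:C ^+ n) 0) ->
  forall n, c n = 0.
Proof.
move=> d0 hc; elim/ltn_ind => p IHp.
pose r := d / 2; have r0 : 0 < r by rewrite divr_gt0.
have rd : 0 < r < d by rewrite r0 /r; lra.
have [B B0 hB] := power_series_bounded (hc r rd).
have {}hB n : n1 (c n) * r ^+ n <= B.
  by have := hB n; rewrite -rmorphXn n1_scale ger0_norm // exprn_ge0 // ltW.
have key (t : R) : 0 < t -> t <= 2^-1 -> n1 (c p) * r ^+ p <= 2 * B * t.
  move=> t0 t2; have tp : 0 < t ^+ p by rewrite exprn_gt0.
  rewrite -(ler_pM2r tp).
  have -> : n1 (c p) * r ^+ p * t ^+ p = n1 (c p) * (t * r) ^+ p.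
    by rewrite [(t * r) ^+ p]exprMn [t ^+ p * _]mulrC mulrA.
  have -> : 2 * B * t * t ^+ p = 2 * B * t ^+ p.+1 by rewrite exprS; ring.
  have e0 : 0 < t * r by rewrite mulr_gt0.
  have ed : 0 < t * r < d by rewrite e0 /=; move: rd => /andP[_]; nra.
  rewrite leNgt; apply/negP => lt; pose eps := n1 (c p) * (t * r) ^+ p - 2 * B * t ^+ p.+1.
  have eps0 : 0 < eps by rewrite subr_gt0.
  have [N hN] := hc _ ed _ eps0.
  have := hN (N + p.+1)%N (leq_addr _ _); rewrite subr0 ltNge => /negP; apply.
  pose F n := c n * (t * r)%:C ^+ n.
  have -> : \sum_(n < N + p.+1) c n * (t * r)%:C ^+ n
     = c p * (t * r)%:C ^+ p + \sum_(p.+1 <= n < N + p.+1) F n.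
    rewrite -(big_mkord xpredT F) (big_cat_nat (n := p.+1)) ?leq_addl //=.
    rewrite big_nat_recr //= big_nat big1 ?add0r // => n /andP[_ np].
    by rewrite /F IHp // mul0r.
  set S := \sum_(p.+1 <= n < N + p.+1) F n.
  have hS : n1 S <= 2 * B * t ^+ p.+1.
    apply: le_trans (n1_sum _ _ _) _.
    apply: le_trans (_ : \sum_(p.+1 <= n < N + p.+1) B * t ^+ n <= _).
      apply: ler_sum => n _; rewrite /F -rmorphXn n1_scale ger0_norm ?exprn_ge0 ?(ltW e0) //.
      rewrite exprMn mulrCA mulrC; apply: ler_wpM2r => //; first by rewrite exprn_ge0 // ltW.
    rewrite -big_distrr /= -{1}[p.+1]add0n big_addn addnK big_mkord.
    under eq_bigr do rewrite exprD.
    rewrite -big_distrl /= mulrA -[2 * B]mulrC ler_wpM2r ?exprn_ge0 ?(ltW t0) //.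
    by rewrite ler_wpM2l // geo_half // ltW.
  have E : n1 (c p * (t * r)%:C ^+ p) = n1 (c p) * (t * r) ^+ p.
    by rewrite -rmorphXn n1_scale ger0_norm // exprn_ge0 // ltW.
  have := n1_sub (c p * (t * r)%:C ^+ p + S) S; rewrite addrK E /eps.
  lra.
apply: n1_eq0; apply/eqP; rewrite eq_le n1_ge0 andbT leNgt; apply/negP => cp.
have h0 : 0 < n1 (c p) * r ^+ p by rewrite mulr_gt0 // exprn_gt0.
have B1 : 0 < 4 * (B + 1) + 4 * (n1 (c p) * r ^+ p) by lra.
(* Both t <= 1/2 and 2 B t < [n1 (c p) * r ^+ p] follow from this denominator, contradicting
   [key]. *)
pose t := n1 (c p) * r ^+ p / (4 * (B + 1) + 4 * (n1 (c p) * r ^+ p)).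
have t0 : 0 < t by rewrite divr_gt0.
have t2 : t <= 2^-1 by rewrite ler_pdivrMr //; lra.
have := key t t0 t2; rewrite /t mulrA ler_pdivlMr //; nra.
Qed.

(** On a horizontal line through a point of disagreement, let x0 be the supremum of such points. To
    the right of x0 the functions agree, so their expansions at x0 coincide; they then agree on both
    sides of x0, against the choice of x0. *)
Lemma entire_identity (f g : C -> C) : entire f -> entire g ->
  (forall s, 1 < complex.Re s -> f s = g s) -> f = g.
Proof.
move=> hf hg fg; apply/funext => z; apply/eqP/negPn/negP => fgz.
pose y := complex.Im z.
pose E := [set x : R | f (x +i* y) != g (x +i* y)]%classic.
have Ez : E (complex.Re z) by rewrite /E /= /y; case: z fgz {y E}.
have E1 : ubound E 1.
  move=> x /=; apply: contraNT; rewrite -ltNge => x1.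
  by rewrite fg.
have hE : has_sup E by split; [exists (complex.Re z)|exists 1].
pose x0 := sup E; pose w0 : C := x0 +i* y.
have [cf /n1_near[df df0 hcf]] := hf w0.
have [cg /n1_near[dg dg0 hcg]] := hg w0.
pose d := Num.min df dg; have d0 : 0 < d by rewrite lt_min df0.
pose c n := cf n - cg n.
have hc w : n1 (w - w0) < d ->
    ctends (fun N => \sum_(n < N) c n * (w - w0) ^+ n) (f w - g w).
  rewrite lt_min => /andP[/hcf /ctends_of_cvg h1 /hcg /ctends_of_cvg h2].
  have := ctendsB h1 h2; apply: ctends_ext => N.
  rewrite /series /= !big_mkord -sumrB; apply: eq_bigr => n _.
  by rewrite /c mulrBl.
have c0 : forall n, c n = 0.
  apply: (power_series_zero d0) => e /andP[e0 ed].
  have wE : ((x0 + e) +i* y) - w0 = e%:C.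
    by rewrite /w0; apply/eqP; rewrite eq_complex /= subrr addrAC subrr add0r !eqxx.
  have := hc ((x0 + e) +i* y); rewrite wE n1_real gtr0_norm // => /(_ ed).
  have -> // : f ((x0 + e) +i* y) - g ((x0 + e) +i* y) = 0.
  apply/eqP; rewrite subr_eq0; apply: contraPT isT => fe.
  have : x0 + e <= x0 by apply: (sup_upper_bound hE).
  by rewrite gerDl leNgt e0.
have [x Ex xx0] := sup_adherent d0 hE.
have xle : x <= x0 by apply: (sup_upper_bound hE).
have wE : (x +i* y) - w0 = (x - x0)%:C.
  by rewrite /w0; apply/eqP; rewrite eq_complex /= subrr !eqxx.
have xd : n1 ((x +i* y) - w0) < d.
  by rewrite wE n1_real ltr_norml; apply/andP; split; move: xx0; rewrite -/x0; lra.
have h := hc _ xd; have : f (x +i* y) - g (x +i* y) = 0.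
  apply: (ctends_uniq h); apply: ctends_ext (ctends_cst 0) => N.
  by rewrite big1 // => n _; rewrite c0 mul0r.
by move/eqP; rewrite subr_eq0; apply/negP.
Qed.

End IdentityTheorem.

(** * The L-values of the character *)

Section Chi.
Variables (R : realType) (m a : nat).
Hypothesis am : (a < m)%N.

(** Half a period exchanges the first residue with the third and the second with the fourth, which
    carry opposite values. *)
Lemma chi_antiperiodic n : chi R[i] m a (n + (4 * m + 2)) = - chi R[i] m a n.
Proof.
set f := (8 * m + 4)%N.
have e1 : (6 * m - 2 * a + 1 + (4 * m + 2) = f + (2 * m - 2 * a - 1))%N.
  by rewrite /f; lia.
have e2 : (6 * m + 2 * a + 5 + (4 * m + 2) = f + (2 * m + 2 * a + 3))%N.
  by rewrite /f; lia.
have e3 : (2 * m - 2 * a - 1 + (4 * m + 2) = 6 * m - 2 * a + 1)%N by lia.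
have e4 : (2 * m + 2 * a + 3 + (4 * m + 2) = 6 * m + 2 * a + 5)%N by lia.
have E r r' : (r + (4 * m + 2) = r' %[mod f])%N ->
    (n + (4 * m + 2) == r' %[mod f])%N = (n == r %[mod f])%N.
  by move=> <-; rewrite eqn_modDr.
have E1 : (n + (4 * m + 2) == 2 * m - 2 * a - 1 %[mod f])%N
    = (n == 6 * m - 2 * a + 1 %[mod f])%N by apply: E; rewrite e1 modnDl.
have E2 : (n + (4 * m + 2) == 2 * m + 2 * a + 3 %[mod f])%N
    = (n == 6 * m + 2 * a + 5 %[mod f])%N by apply: E; rewrite e2 modnDl.
have E3 : (n + (4 * m + 2) == 6 * m - 2 * a + 1 %[mod f])%N
    = (n == 2 * m - 2 * a - 1 %[mod f])%N by apply: E; rewrite e3.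
have E4 : (n + (4 * m + 2) == 6 * m + 2 * a + 5 %[mod f])%N
    = (n == 2 * m + 2 * a + 3 %[mod f])%N by apply: E; rewrite e4.
rewrite /chi -/f E1 E2 E3 E4.
have s1 : ((2 * m - 2 * a - 1) %% f = 2 * m - 2 * a - 1)%N.
  by rewrite modn_small // /f; clear -am; lia.
have s2 : ((2 * m + 2 * a + 3) %% f = 2 * m + 2 * a + 3)%N.
  by rewrite modn_small // /f; clear -am; lia.
have s3 : ((6 * m - 2 * a + 1) %% f = 6 * m - 2 * a + 1)%N.
  by rewrite modn_small // /f; clear -am; lia.
have s4 : ((6 * m + 2 * a + 5) %% f = 6 * m + 2 * a + 5)%N.
  by rewrite modn_small // /f; clear -am; lia.
rewrite s1 s2 s3 s4; move: (n %% f)%N => x; clear -am.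
case: (x =P 2 * m - 2 * a - 1)%N => h1; case: (x =P 2 * m + 2 * a + 3)%N => h2;
case: (x =P 6 * m - 2 * a + 1)%N => h3; case: (x =P 6 * m + 2 * a + 5)%N => h4;
  rewrite ?opprK ?oppr0 //; exfalso; lia.
Qed.

Lemma chi_le1 n : n1 (chi R[i] m a n) <= 1.
Proof. by rewrite /chi; do !case: ifP => _; rewrite ?n1N ?n1_1 ?n1_0. Qed.

(** [Lext_dirichlet] shows that a continuation exists, so the default of [xget] is not taken;
    [entire_identity] then identifies the one chosen. *)
Lemma Lfun_chi : Defs.Lfun (chi R[i] m a) = Lext (chi R[i] m a) (4 * m + 2).
Proof.
have D := Lext_dirichlet chi_antiperiodic chi_le1.
have [E1 D1] : is_dirichlet_continuation (chi R[i] m a) (Defs.Lfun (chi R[i] m a)).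
  exact: (@xgetPex _ (fun=> 0) [set L | is_dirichlet_continuation (chi R[i] m a) L]%classic
    (ex_intro _ _ D)).
have [E0 D0] := D; apply: (entire_identity E1 E0) => s s1.
exact: ctends_uniq (ctends_of_cvg (D1 s s1)) (ctends_of_cvg (D0 s s1)).
Qed.

(** [Lext_neg] at k = 2n + 1. With f = 4M the constant f^(2n+1) / (2 (2n + 2)) becomes 2^(4n)
    M^(2n+1) / (n + 1). *)
Lemma Tcoef_bernoulli n :
  Tcoef R m a n =
       (- 1) ^+ n * 2 ^+ (4 * n) * ((2 * m + 1)%N%:R ^+ (2 * n + 1) / n.+1%:R)
       * \sum_(1 <= r < (8 * m + 4).+1)
           chi R[i] m a r *
           (bernoulli_poly R[i] (2 * n + 2)).[r%:R / (8 * m + 4)%N%:R].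
Proof.
rewrite /Tcoef Lfun_chi Lext_neg; [|lia|exact: chi_antiperiodic|exact: chi_le1].
rewrite /vB.
have -> : (2 * (4 * m + 2) = 8 * m + 4)%N by lia.
have -> : (2 * n + 1).+1 = (2 * n + 2)%N by lia.
set S := \sum_(1 <= r < _) _.
have -> : (8 * m + 4)%:R = 4 * (2 * m + 1)%:R :> R[i] by rewrite -natrM; congr _%:R; lia.
have -> : (2 * n + 2)%:R = 2 * n.+1%:R :> R[i] by rewrite -natrM; congr _%:R; lia.
have n0 : n.+1%:R != 0 :> R[i] by rewrite pnatr_eq0.
rewrite exprMn.
have -> : 4 ^+ (2 * n + 1) = 4 * 2 ^+ (4 * n) :> R[i].
  have -> : 4 = 2 ^+ 2 :> R[i] by rewrite -natrX.
  by rewrite -exprM -exprD; congr (_ ^+ _); lia.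
rewrite exprS; move: (n.+1%:R) n0 ((2 * m + 1)%:R ^+ _) (2 ^+ (4 * n)) ((-1) ^+ n) S.
by move=> x x0 y z t S; field.
Qed.

End Chi.

Theorem theorem1p2 (R : realType) (m a : nat) (hm : (0 < m)%N) (ha : (a < m)%N) :
  (X_exp_opp R[i] m a =1
     fps_mul
       (fps_expX ((2 * m - 2 * a - 1)%N%:R ^+ 2 / (8 * (2 * m + 1))%N%:R))
       (fun n => Tcoef R m a n / n`!%:R / (8 * (2 * m + 1))%N%:R ^+ n))
  /\
  (forall n : nat,
     Tcoef R m a n =
       (- 1) ^+ n * 2 ^+ (4 * n) * ((2 * m + 1)%N%:R ^+ (2 * n + 1) / n.+1%:R)
       * \sum_(1 <= r < (8 * m + 4).+1)
           chi R[i] m a r *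
           (bernoulli_poly R[i] (2 * n + 2)).[r%:R / (8 * m + 4)%N%:R]).
Proof.
split=> [D|n]; last exact: Tcoef_bernoulli.
rewrite X_exp_opp_kern // kern_series_coef // pcoefM; apply: eq_bigr => i _.
by congr (_ * _); rewrite /= Tcoef_bernoulli // chi_sum.
Qed.
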